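(* Let $p>2$. Then there are constants $\lambda_0>1$ and $c>0$, depending on $p$, such that $B_p(\lambda)\ge c(\log\lambda)^{\frac12-\frac1p}$ for all $\lambda>\lambda_0$.
   Context: For $f$ on $\mathbb{R}^2$ and $t>0$, $A_t f(x)=\frac{1}{2\pi}\int_0^{2\pi} f(x_1-t\cos\alpha,\,x_2-t\sin\alpha)\,d\alpha$. With $I=[1,2]$, \[V_2^I A f(x)=\sup_{N\in\mathbb{N}}\ \sup_{t_1<\dots<t_N,\ t_j\in I}\Big(\sum_{j=1}^{N-1}|A_{t_{j+1}}f(x)-A_{t_j}f(x)|^2\Big)^{1/2}.\] For $\lambda>1$, $E(\lambda)$ is the space of tempered distributions on $\mathbb{R}^2$ whose Fourier transform is supported in $\{\xi:|\xi|\le\lambda\}$, and \[B_p(\lambda)=\sup\{\|V_2^IAf\|_{L^p(\mathbb{R}^2)}:\ \|f\|_{L^p(\mathbb{R}^2)}\le 1,\ f\in E(\lambda)\}.\] *)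

(* Defs.v *)
From HB Require Import structures.
From mathcomp Require Import all_boot all_order all_algebra.
From mathcomp Require Import all_classical all_reals all_analysis.
Set Implicit Arguments. Unset Strict Implicit. Unset Printing Implicit Defensive.
Import Order.TTheory GRing.Theory Num.Theory.
Import numFieldNormedType.Exports.
Local Open Scope classical_set_scope.
Local Open Scope ring_scope.

Definition leb2 (R : realType) := ((@lebesgue_measure R) \x (@lebesgue_measure R))%E.

Definition norm2 (R : realType) (x : R * R) : R := Num.sqrt (x.1 ^+ 2 + x.2 ^+ 2).

(* A complex-valued function on R^2 is represented by the pair
   (real part, imaginary part). *)
Definition cfun2 (R : realType) := ((R * R -> R) * (R * R -> R))%type.

Definition cmod2 (R : realType) (f : cfun2 R) (x : R * R) : R :=
  Num.sqrt (f.1 x ^+ 2 + f.2 x ^+ 2).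

Definition LpN (R : realType) (p : R) (f : cfun2 R) : \bar R :=
  Lnorm (@leb2 R) p%:E (fun x => (cmod2 f x)%:E).

Definition smooth2 (R : realType) (phi : R * R -> R) : Prop :=
  exists D : nat -> nat -> (R * R -> R),
    D 0%N 0%N = phi /\
    (forall i j, continuous (D i j)) /\
    (forall i j (x : R * R),
        is_derive x.1 1 (fun s => D i j (s, x.2)) (D i.+1 j x)) /\
    (forall i j (x : R * R),
        is_derive x.2 1 (fun s => D i j (x.1, s)) (D i j.+1 x)).

(* Test functions: smooth real functions with compact support contained in
   the open set {xi : |xi| > lam}, i.e. vanishing for |xi| < r and for
   |xi| > M, for some r > lam. (Complex test functions reduce to these by
   linearity of the pairing.) *)
Definition test_outside (R : realType) (lam : R) (phi : R * R -> R) : Prop :=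
  smooth2 phi /\
  exists r M : R, lam < r /\
    forall xi : R * R, (norm2 xi < r \/ M < norm2 xi) -> phi xi = 0.

Definition dot2 (R : realType) (x y : R * R) : R := x.1 * y.1 + x.2 * y.2.

(* Fourier transform  phi^(x) = \int phi(xi) e^{-i x.xi} dxi  of a real
   test function: real part FTc, imaginary part - FTs. *)
Definition FTc (R : realType) (phi : R * R -> R) (x : R * R) : R :=
  Rintegral (@leb2 R) setT (fun xi => phi xi * cos (dot2 x xi)).
Definition FTs (R : realType) (phi : R * R -> R) (x : R * R) : R :=
  Rintegral (@leb2 R) setT (fun xi => phi xi * sin (dot2 x xi)).

(* E(lam) intersected with L^p: f is a (continuous, hence the smooth
   representative) function whose distributional Fourier transform is
   supported in {|xi| <= lam}:  <f, phi^> = \int f(x) phi^(x) dx = 0 for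
   every test function phi supported in {|xi| > lam}.
   With f = a + i b and phi^ = C - i S:  f phi^ = (aC + bS) + i (bC - aS). *)
Definition in_E (R : realType) (lam : R) (f : cfun2 R) : Prop :=
  continuous f.1 /\ continuous f.2 /\
  forall phi, test_outside lam phi ->
    (\int[@leb2 R]_x ((f.1 x * FTc phi x + f.2 x * FTs phi x)%:E) = 0)%E /\
    (\int[@leb2 R]_x ((f.2 x * FTc phi x - f.1 x * FTs phi x)%:E) = 0)%E.

Definition circ_mean (R : realType) (g : R * R -> R) (t : R) (x : R * R) : R :=
  (2 * pi)^-1 * Rintegral (@lebesgue_measure R) `[0, 2 * pi]
      (fun a => g (x.1 - t * cos a, x.2 - t * sin a)).

Definition circ_diff2 (R : realType) (f : cfun2 R) (s t : R) (x : R * R) : R :=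
  (circ_mean f.1 s x - circ_mean f.1 t x) ^+ 2
  + (circ_mean f.2 s x - circ_mean f.2 t x) ^+ 2.

Definition V2A (R : realType) (f : cfun2 R) (x : R * R) : \bar R :=
  ereal_sup [set v : \bar R | exists (N : nat) (t : nat -> R),
     (forall j, (j < N)%N -> 1 <= t j <= 2) /\
     (forall j, (j.+1 < N)%N -> t j < t j.+1) /\
     v = (Num.sqrt (\sum_(j < N.-1) circ_diff2 f (t j.+1) (t j) x))%:E].

Definition Bp (R : realType) (p lam : R) : \bar R :=
  ereal_sup [set Lnorm (@leb2 R) p%:E (V2A f)
            | f in [set f : cfun2 R | in_E lam f /\ (LpN p f <= 1)%E]].

(* Main.v *)
(* A Kakeya compression of wave packets.  Put kap = lam / 4.  There are 2^n lines
   with slopes in [1, 2] whose neighbourhoods of width w ~ 2^-n are pairwise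
   disjoint over -3 <= x <= -1/8, while over 0 <= x <= 1/8 they all lie in a set E
   of measure at most 1/n.  On the j-th tube over [-3, -1/8] put a wave packet
   oscillating along the tube at frequency kap, cut off by convolution with a
   Fejer kernel so that its spectrum stays within |xi| <= lam.  For x in the
   continuation of the tube over [0, 1/8] and 1 <= t <= 2, the circle of radius t
   about x crosses the tube tangentially to the wave fronts, so the circular mean
   of the packet has size kap^(-1/2), and its phase turns by pi when t increases
   by pi / kap.  Along a grid of ~ kap such times the square variation of the
   packet is thus bounded below on the continuation of its tube.  For suitable
   signs the sum f of the packets satisfies int_E V(f)^2 >= c, whereas
   ||f||_p <= 1 because the tubes are disjoint.  As |E| <= 1/n and p > 2, this
   forces ||V(f)||_p >= c n^(1/2 - 1/p), and n may be taken ~ log lam. *)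
Require Import Defs.
From HB Require Import structures.
From mathcomp Require Import all_boot all_order all_algebra.
From mathcomp Require Import all_classical all_reals all_analysis.
From mathcomp Require Import measurable_realfun ring lra.
Import Order.TTheory GRing.Theory Num.Theory.
Import numFieldNormedType.Exports.
Local Open Scope classical_set_scope.
Local Open Scope ring_scope.
Set Implicit Arguments. Unset Strict Implicit. Unset Printing Implicit Defensive.

(** * Reflection, scaling and product of Lebesgue measures *)

Section line_measure.
Variable R : realType.
Local Notation mu := (@lebesgue_measure R).

(** The width 2^-n cannot go much below kap^(-1/2): the stationary phase that produces the gain
    occupies an arc of that length about the point of tangency, and the tube has to contain it. The
    Fejer tails, small only like 1/(kap w), must also stay below kap^(-1/2), which is the same
    condition. Hence 2^n is of order lam^(1/2), and n of order log lam. The gain is scale free: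
    about kap time steps each contribute the square of kap^(-1/2), so a single packet has square
    variation bounded below at every point of its own core. Counted with multiplicity the cores have
    area of order 2^n w, that is a constant, although their union has area at most 1/n. Packets with
    overlapping cores might cancel there. Signs are chosen so that the integrated squares at least
    add up. Mollifying destroys the disjointness of the tubes, but the sum of the cutoffs remains at
    most 1 pointwise and has bounded integral, which controls all L^p norms at once. *)

Lemma lebesgue_measure_reflect (c : R) (A : set R) : measurable A ->
  pushforward mu ((fun x => c - x) : _ -> measurableTypeR R) A = mu A.
Proof.
move=> mA; apply/esym/lebesgue_measure_unique => //=.
  exact: measurable_funB.
move=> m _ [[a b]] _ <-.
rewrite /pushforward.
have -> : (fun x : R => c - x) @^-1` `]a, b] = `[c - b, c - a[%classic.
  by apply/seteqP; split => x /=; rewrite !in_itv /= => /andP[? ?]; apply/andP; split; lra.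
rewrite !lebesgue_measure_itv/= !lte_fin.
have -> : (c - b < c - a) = (a < b) by apply/idP/idP; lra.
by case: ifP => // _; rewrite -!EFinB; congr (_%:E); lra.
Qed.

Lemma lebesgue_measure_scale (s : R) (s0 : 0 < s) (A : set R) : measurable A ->
  pushforward (mscale (NngNum (ltW s0)) mu) (( *%R s) : _ -> measurableTypeR R) A = mu A.
Proof.
move=> mA; apply/esym/lebesgue_measure_unique => //=.
move=> _ [[a b]] _ <-.
rewrite /pushforward /mscale /=.
have -> : *%R s @^-1` `]a, b] = `]a / s, b / s]%classic.
  by apply/seteqP; split => x /=; rewrite !in_itv /= ltr_pdivrMr// ler_pdivlMr// mulrC.
rewrite !lebesgue_measure_itv/= !lte_fin ltr_pM2r ?invr_gt0//.
by case: ifP => // _; rewrite ?mule0// -!EFinB -EFinM; congr (_%:E); field; apply: lt0r_neq0.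
Qed.

Lemma ge0_integral_reflect (c : R) (f : R -> \bar R) :
  measurable_fun [set: R] f -> (forall x, (0 <= f x)%E) ->
  (\int[mu]_x f (c - x)%R = \int[mu]_x f x)%E.
Proof.
move=> mf f0.
have mphi : measurable_fun setT ((fun x => c - x) : measurableTypeR R -> measurableTypeR R).
  exact: measurable_funB.
have := @ge0_integral_pushforward _ _ _ _ R _ mphi mu setT f measurableT mf (fun y _ => f0 y).
rewrite preimage_setT => <-.
by apply: eq_measure_integral => //= A mA _; exact: lebesgue_measure_reflect.
Qed.

Lemma ge0_integral_scale (s : R) (f : R -> \bar R) : 0 < s ->
  measurable_fun [set: R] f -> (forall x, (0 <= f x)%E) ->
  (s%:E * \int[mu]_x f (s * x)%R = \int[mu]_x f x)%E.
Proof.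
move=> s0 mf f0.
have mphi : measurable_fun [set: measurableTypeR R] (( *%R s) : measurableTypeR R -> measurableTypeR R).
  exact: measurable_funM.
transitivity (\int[mscale (NngNum (ltW s0)) mu]_x f (s * x)%R)%E.
  by rewrite ge0_integral_mscale //; exact: measurableT_comp mphi.
have := @ge0_integral_pushforward _ _ _ _ R _ mphi (mscale (NngNum (ltW s0)) mu) setT f measurableT mf (fun y _ => f0 y).
rewrite preimage_setT => <-.
by apply: eq_measure_integral => //= A mA _; exact: lebesgue_measure_scale.
Qed.

Lemma integral_reflect (c : R) (f : R -> R) :
  measurable_fun [set: R] f -> mu.-integrable setT (EFin \o f) ->
  mu.-integrable setT (EFin \o (fun x => f (c - x))) /\
  Rintegral mu setT (fun x => f (c - x)) = Rintegral mu setT f.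
Proof.
move=> mf fi.
have mphi : measurable_fun setT ((fun x => c - x) : measurableTypeR R -> measurableTypeR R).
  exact: measurable_funB.
have mf' : measurable_fun [set: R] (EFin \o f) by exact/measurable_EFinP.
have fi' : mu.-integrable setT (EFin \o (fun x => f (c - x))).
  apply/integrableP; split.
    by apply/measurable_EFinP; exact: measurableT_comp mphi.
  case/integrableP: fi => _.
  by rewrite -(ge0_integral_reflect c) //; apply: measurableT_comp.
split=> //.
have := @integral_pushforward _ _ _ _ R _ mphi mu setT _ mf'.
rewrite preimage_setT => /(_ fi' measurableT) H.
rewrite /Rintegral; congr fine.
transitivity (\int[pushforward mu ((fun x => c - x)%R : measurableTypeR R -> measurableTypeR R)]_y (EFin \o f) y)%E; first by rewrite H.
by apply: eq_measure_integral => //= A mA _; exact: lebesgue_measure_reflect.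
Qed.

End line_measure.

(** [leb2] also serves as a single factor: Fubini for convolutions on the plane and for the pairing
    with a Fourier transform runs over [mu2 \x mu2], so the sigma-finite structure has to sit on
    [leb2] itself. *)
Lemma sigma_finite_leb2 (R : realType) : sigma_finite setT (@leb2 R).
Proof.
have /sigma_finiteP[F [TF ndF Foo]] := sigma_finiteT (@lebesgue_measure R).
exists (fun n => F n `*` F n).
  rewrite -setXTT TF predeqE => -[x y]; split; last by move=> [n _ []/= ? ?]; split; exists n.
  move=> [/= [n _ Fnx] [k _ Gky]]; exists (maxn n k) => //; split.
  - by move: x Fnx; exact/subsetPset/ndF/leq_maxl.
  - by move: y Gky; exact/subsetPset/ndF/leq_maxr.
move=> k; have [? ?] := Foo k.
split; first exact: measurableX.
by rewrite /leb2 product_measure1E// lte_mul_pinfty// ge0_fin_numE.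
Qed.

HB.instance Definition _ (R : realType) := Measure.on (@leb2 R).
HB.instance Definition _ (R : realType) :=
  Measure_isSigmaFinite.Build _ _ _ (@leb2 R) (@sigma_finite_leb2 R).

Section plane_measure.
Variable R : realType.
Local Notation mu := (@lebesgue_measure R).
Local Notation mu2 := (@leb2 R).

Lemma leb2_tonelli (f : R * R -> \bar R) :
  measurable_fun [set: R * R] f -> (forall x, (0 <= f x)%E) ->
  (\int[mu2]_z f z = \int[mu]_x \int[mu]_y f (x, y))%E.
Proof. by move=> mf f0; exact: fubini_tonelli1. Qed.

Lemma leb2_fubini (f : R * R -> \bar R) : mu2.-integrable setT f ->
  (\int[mu2]_z f z = \int[mu]_x \int[mu]_y f (x, y))%E.
Proof. by move=> fi; apply/esym; exact: integral12_prod_meas1. Qed.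

Lemma ge0_integral_reflect2 (c : R * R) (f : R * R -> \bar R) :
  measurable_fun [set: R * R] f -> (forall x, (0 <= f x)%E) ->
  (\int[mu2]_x f (c.1 - x.1, c.2 - x.2)%R = \int[mu2]_x f x)%E.
Proof.
move=> mf f0; rewrite !leb2_tonelli //; last first.
  apply: measurableT_comp => //.
  by apply: measurable_fun_pair; apply: measurable_funB.
rewrite /=.
rewrite -(@ge0_integral_reflect _ c.1) /=; last 2 first.
- apply: (@measurable_fun_fubini_tonelli_F _ _ _ _ R mu (fun z : R * R => f (c.1 - z.1, c.2 - z.2))) => //.
  by apply: measurableT_comp mf _; apply: measurable_fun_pair; apply: measurable_funB.
- by move=> x; exact: integral_ge0.
apply: eq_integral => x _; rewrite subKr.
by rewrite (@ge0_integral_reflect _ c.2 (fun y => f (x, y))) //; exact: measurableT_comp.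
Qed.

Lemma measurable_strip (p q h : R) (l : R -> R) : measurable_fun [set: R] l ->
  measurable [set x : R * R | (p <= x.1 <= q) && (`|x.2 - l x.1| <= h)].
Proof.
move=> ml.
have -> : [set x : R * R | (p <= x.1 <= q) && (`|x.2 - l x.1| <= h)] =
  (fst @^-1` `[p, q]) `&` ((fun x => x.2 - l x.1) @^-1` `[-h, h]).
  apply/seteqP; split => x /=; rewrite !in_itv /=.
    by case/andP => -> /=; rewrite ler_norml.
  by case=> -> /=; rewrite ler_norml.
apply: measurableI; rewrite -[X in measurable X]setTI.
  exact: measurable_fst.
have mm : measurable_fun [set: R * R] (fun x => x.2 - l x.1).
  by apply: measurable_funB => //; exact: measurableT_comp.
exact: mm.
Qed.

Lemma measure_strip (p q h : R) (l : R -> R) : p <= q -> 0 <= h ->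
  measurable_fun [set: R] l ->
  mu2 [set x | (p <= x.1 <= q) && (`|x.2 - l x.1| <= h)] = ((q - p) * (2 * h))%:E.
Proof.
move=> pq h0 ml.
transitivity (\int[mu]_x mu (xsection [set x0 : R * R | (p <= x0.1 <= q)%R && (`|x0.2 - l x0.1| <= h)%R] x))%E; first by [].
under eq_integral => x _.
  rewrite (_ : mu _ = (2 * h)%:E * (\1_(`[p, q]%classic) x)%:E)%E; last first.
  rewrite indicE.
  have [xpq|xpq] := boolP (x \in `[p, q]%classic).
    rewrite mule1 (_ : xsection _ _ = `[l x - h, l x + h]%classic); last first.
      apply/seteqP; split => y; rewrite /xsection /= inE /=.
        by case/andP => _; rewrite in_itv /= ler_distl.
      by rewrite in_itv /= => H; move/set_mem: xpq; rewrite /= in_itv /= => -> /=; rewrite ler_distl.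
    rewrite lebesgue_measure_itv /= lte_fin; case: ifP => H; first by congr (_%:E); lra.
    by congr (_%:E); lra.
  rewrite mule0 (_ : xsection _ _ = set0) ?measure0//.
  apply/seteqP; split => y //; rewrite /xsection /= inE /= => /andP[H _].
  by move/negP: xpq; apply; apply/mem_set; rewrite /= in_itv.
  over.
rewrite /= ge0_integralZl //; last 2 first.
- exact/measurable_EFinP/measurable_indic.
- by rewrite lee_fin; lra.
rewrite integral_indic// setIT /= lebesgue_measure_itv /= lte_fin.
case: ifP => H; first by rewrite -EFinB -EFinM; congr (_%:E); lra.
by rewrite mule0 (_ : q = p) ?subrr ?mul0r //; lra.
Qed.

End plane_measure.

(** * Integrals against bounded kernels and choice of signs *)

Section bounded_kernel.
Context d1 d2 (T1 : measurableType d1) (T2 : measurableType d2) (R : realType).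
Variables (m1 : {sigma_finite_measure set T1 -> \bar R})
  (m2 : {sigma_finite_measure set T2 -> \bar R}).

(** The product [f z.1 * g z.2] dominates. In the applications [k] is a cosine, or an indicator
    times a chirp. *)
Lemma integrable_bounded_kernel (f : T1 -> R) (g : T2 -> R) (k : T1 * T2 -> R) :
  m1.-integrable setT (EFin \o f) -> m2.-integrable setT (EFin \o g) ->
  measurable_fun setT k -> (forall z, `|k z| <= 1) ->
  (m1 \x m2)%E.-integrable setT (EFin \o (fun z => f z.1 * g z.2 * k z)).
Proof.
move=> fi gi mk k1.
have mf : measurable_fun setT f by apply/measurable_EFinP; case/integrableP: fi.
have mg : measurable_fun setT g by apply/measurable_EFinP; case/integrableP: gi.
have mfg : measurable_fun setT (fun z : T1 * T2 => f z.1 * g z.2).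
  by apply: measurable_funM; [exact: measurableT_comp mf _|exact: measurableT_comp mg _].
apply: (@le_integrable _ _ _ _ _ measurableT _ (EFin \o (fun z : T1 * T2 => f z.1 * g z.2))).
- by apply/measurable_EFinP; exact: measurable_funM.
- move=> z _ /=; rewrite lee_fin normrM -[leRHS]mulr1; exact: ler_wpM2l.
apply/integrable12ltyP; first exact/measurable_EFinP.
case/integrableP: fi => _ fi; case/integrableP: gi => _ gi.
under eq_integral => x _.
  rewrite (_ : (\int[m2]_y _)%E = (`|f x|%:E * \int[m2]_y `|(g y)%:E|)%E); last first.
    rewrite -ge0_integralZl //; last by apply: measurableT_comp => //; exact/measurable_EFinP.
    by apply: eq_integral => y _; rewrite /= normrM EFinM.
  over.
have gE : (\int[m2]_y `|(g y)%:E| = (fine (\int[m2]_y `|(g y)%:E|))%:E)%E.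
  rewrite fineK //.
  by rewrite ge0_fin_numE ?integral_ge0.
rewrite /= gE ge0_integralZr //; last 2 first.
- by apply/measurable_EFinP; apply: measurableT_comp.
- by rewrite lee_fin; apply: fine_ge0; exact: integral_ge0.
by apply: lte_mul_pinfty => //; [exact: integral_ge0|by rewrite ge0_fin_numE ?integral_ge0|exact: ltry].
Qed.

Lemma fubini_bounded_kernel (f : T1 -> R) (g : T2 -> R) (k : T1 * T2 -> R) :
  m1.-integrable setT (EFin \o f) -> m2.-integrable setT (EFin \o g) ->
  measurable_fun setT k -> (forall z, `|k z| <= 1) ->
  Rintegral m1 setT (fun x => f x * Rintegral m2 setT (fun y => g y * k (x, y))) =
  Rintegral m2 setT (fun y => g y * Rintegral m1 setT (fun x => f x * k (x, y))).
Proof.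
move=> fi gi mk k1.
have H := integrable_bounded_kernel fi gi mk k1.
have mk1 x : measurable_fun setT (fun y => k (x, y)) by exact: measurableT_comp mk _.
have mk2 y : measurable_fun setT (fun x => k (x, y)) by exact: measurableT_comp mk _.
have gki x : m2.-integrable setT (EFin \o (fun y => g y * k (x, y))).
  apply: (le_integrable _ _ _ gi) => //.
    apply/measurable_EFinP/measurable_funM => //; apply/measurable_EFinP; by case/integrableP: gi.
  by move=> y _ /=; rewrite lee_fin normrM -[leRHS]mulr1; exact: ler_wpM2l.
have fki y : m1.-integrable setT (EFin \o (fun x => f x * k (x, y))).
  apply: (le_integrable _ _ _ fi) => //.
    apply/measurable_EFinP/measurable_funM => //; apply/measurable_EFinP; by case/integrableP: fi.
  by move=> x _ /=; rewrite lee_fin normrM -[leRHS]mulr1; exact: ler_wpM2l.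
have F := Fubini H.
transitivity (fine (\int[m1]_x \int[m2]_y (f x * g y * k (x, y))%:E)%E).
  rewrite /Rintegral; congr fine; apply: eq_integral => x _.
  rewrite EFinM fineK; last exact: (integrable_fin_num measurableT (gki x)).
  rewrite -[LHS](integralZl measurableT (gki x)).
  by apply: eq_integral => y _ /=; rewrite -EFinM mulrA.
rewrite F.
rewrite /Rintegral; congr fine; apply: eq_integral => y _.
rewrite EFinM fineK; last exact: (integrable_fin_num measurableT (fki y)).
rewrite -[RHS](integralZl measurableT (fki y)).
by apply: eq_integral => x _ /=; rewrite -EFinM; congr (_%:E); ring.
Qed.

Lemma measurable_Rintegral_section (k : T1 * T2 -> R) : measurable_fun setT k ->
  measurable_fun setT (fun x => Rintegral m2 setT (fun y => k (x, y))).
Proof.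
move=> mk; rewrite /Rintegral.
have mk' : measurable_fun setT (EFin \o k) by exact/measurable_EFinP.
have -> : (fun x => fine (\int[m2]_y (k (x, y))%:E)%E) =
  fine \o (fun x => fubini_F m2 (EFin \o k)^\+ x - fubini_F m2 (EFin \o k)^\- x)%E.
  apply/funext => x /=; congr fine; rewrite [LHS]integralE /fubini_F.
  by congr (_ - _)%E; apply: eq_integral => y _; rewrite ?funeposE ?funenegE.
apply: measurableT_comp; first exact: fine_measurable.
apply: emeasurable_funB; apply: measurable_fun_fubini_tonelli_F => //.
  exact: measurable_funepos.
exact: measurable_funeneg.
Qed.

End bounded_kernel.

Section signs.
Context d (T : measurableType d) (R : realType) (mu : {measure set T -> \bar R}).

(* The signs are chosen one at a time: by the parallelogram identity, the two
   choices of the next sign add the mass of h N on average. *)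
Lemma exists_signs (D : set T) (I : finType) (h : nat -> I -> T -> R) :
  measurable D -> (forall j i, measurable_fun setT (h j i)) ->
  forall N : nat, exists e : nat -> R, (forall j, `|e j| = 1) /\
  (\sum_(j < N) \int[mu]_(x in D) (\sum_i (h j i x) ^+ 2)%:E <=
   \int[mu]_(x in D) (\sum_i (\sum_(j < N) e j * h j i x) ^+ 2)%:E)%E.
Proof.
move=> mD mh; elim=> [|N [e [e1 IH]]].
  exists (fun=> 1); split=> [j|]; first by rewrite normr1.
  rewrite big_ord0; apply: integral_ge0 => x _; rewrite lee_fin.
  by apply: sumr_ge0 => i _; exact: sqr_ge0.
pose S i x := \sum_(j < N) e j * h j i x.
have mS i : measurable_fun setT (S i).
  by apply: measurable_sum => j; exact: measurable_funM.
pose Q (s : R) := (\int[mu]_(x in D) (\sum_i (S i x + s * h N i x) ^+ 2)%:E)%E.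
pose A := (\int[mu]_(x in D) (\sum_i (S i x) ^+ 2)%:E)%E.
pose B := (\int[mu]_(x in D) (\sum_i (h N i x) ^+ 2)%:E)%E.
have msq (g : I -> T -> R) : (forall i, measurable_fun setT (g i)) ->
    measurable_fun D (fun x => (\sum_i (g i x) ^+ 2)%:E).
  move=> mg; apply: measurable_funTS; apply/measurable_EFinP.
  by apply: measurable_sum => i; exact: measurable_funX.
have ge0 (g : I -> T -> R) x : (0 <= (\sum_i (g i x) ^+ 2)%:E)%E.
  by rewrite lee_fin; apply: sumr_ge0 => i _; exact: sqr_ge0.
have mSh s i : measurable_fun setT (fun x => S i x + s * h N i x).
  by apply: measurable_funD => //; exact: measurable_funM.
have par : (Q 1%R + Q (- 1)%R = (A + B) + (A + B))%E.
  rewrite /Q /A /B.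
  rewrite -ge0_integralD //; last 4 first.
  - by move=> x _; exact: (ge0 (fun i x => S i x + 1 * h N i x)).
  - exact: (msq (fun i x => S i x + 1 * h N i x)).
  - by move=> x _; exact: (ge0 (fun i x => S i x + - 1 * h N i x)).
  - exact: (msq (fun i x => S i x + - 1 * h N i x)).
  rewrite -[in RHS]ge0_integralD //; last 2 first.
  - exact: msq.
  - exact: msq.
  rewrite -[in RHS]ge0_integralD //; last 4 first.
  - by move=> x _; rewrite -EFinD lee_fin addr_ge0 // -lee_fin ge0.
  - by apply: emeasurable_funD; exact: msq.
  - by move=> x _; rewrite -EFinD lee_fin addr_ge0 // -lee_fin ge0.
  - by apply: emeasurable_funD; exact: msq.
  apply: eq_integral => x _; rewrite -!EFinD; congr (_%:E).
  rewrite -!big_split /=; apply: eq_bigr => i _; ring.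
(* If both signs gave less than [A + B], adding the two strict inequalities would contradict [par].
   Nothing is subtracted, so infinite masses do no harm. *)
have [s [s1 Qs]] : exists s : R, `|s| = 1 /\ (A + B <= Q s)%E.
  case: (leP (A + B)%E (Q 1%R)) => [H|H1]; first by exists 1; rewrite normr1.
  case: (leP (A + B)%E (Q (- 1)%R)) => [H|H2]; first by exists (-1); rewrite normrN1.
  by have := lteD H1 H2; rewrite par ltxx.
exists (fun j => if j == N then s else e j); split=> [j|].
  by case: ifP.
rewrite big_ord_recr /=.
apply: (@le_trans _ _ (A + B)%E).
  rewrite leeD2r //; move: IH; congr (_ <= _)%E.
apply: (le_trans Qs); rewrite le_eqVlt; apply/orP; left; apply/eqP.
apply: eq_integral => x _; congr (_%:E); apply: eq_bigr => i _.
rewrite big_ord_recr /= eqxx; congr ((_ + _) ^+ 2).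
by apply: eq_bigr => j _; rewrite ltn_eqF.
Qed.

End signs.

Section lower_integral.
Context d (T : measurableType d) (R : realType) (mu : {measure set T -> \bar R}).

(* Unlike ge0_le_integral, this needs no measurability: V2A is a supremum over
   an uncountable family. *)
Lemma ge0_le_integral_nomeas (f g : T -> \bar R) :
  (forall x, (0 <= f x)%E) -> (forall x, (f x <= g x)%E) ->
  (\int[mu]_x f x <= \int[mu]_x g x)%E.
Proof.
move=> f0 fg.
have g0 x : (0 <= g x)%E by exact: le_trans (f0 x) (fg x).
rewrite !ge0_integralTE //.
apply: ub_ereal_sup => _ [h hf <-]; apply: ereal_sup_ubound; exists h => //.
by move=> x; exact: le_trans (hf x) (fg x).
Qed.

End lower_integral.

(** * Kakeya lines *)

Section kakeya_digits.
Variable R : realType.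

(* The digits of j, read from the least significant one, select the terms. *)
Fixpoint digit_sum (n : nat) (d : nat -> R) (j : nat) : R :=
  if n is m.+1 then
    (if odd j then d 0%N else 0) / 2 + digit_sum m (fun k => d k.+1) j./2 / 2
  else 0.

Lemma eq_digit_sum n d1 d2 j : (forall k, (k < n)%N -> d1 k = d2 k) ->
  digit_sum n d1 j = digit_sum n d2 j.
Proof.
elim: n d1 d2 j => //= n IH d1 d2 j H.
by rewrite H // (IH _ (fun k => d2 k.+1)) // => k kn; exact: H.
Qed.

Lemma digit_sumD n d1 d2 (c : R) j :
  digit_sum n (fun k => d1 k + c * d2 k) j = digit_sum n d1 j + c * digit_sum n d2 j.
Proof.
elim: n d1 d2 j => [|n IH] d1 d2 j /=; first by ring.
by rewrite IH; case: odd; field.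
Qed.

Lemma digit_sum_ge0 n d j : (forall k, 0 <= d k) -> 0 <= digit_sum n d j.
Proof.
elim: n d j => //= n IH d j H.
have := IH (fun k => d k.+1) j./2 (fun k => H k.+1).
by have := H 0%N; case: odd; lra.
Qed.

(** The weights 2^-(k+1) have total mass and first moment at most 1. Dropping the lowest digit turns
    [B] into [A + B], and B/2 + (2A + B)/2 = A + B. *)
Lemma digit_sum_le n d j (A B : R) : 0 <= A -> 0 <= B ->
  (forall k, `|d k| <= A * k%:R + B) -> `|digit_sum n d j| <= A + B.
Proof.
elim: n d j A B => [|n IH] d j A B A0 B0 H /=; first by rewrite normr0; lra.
have := IH (fun k => d k.+1) j./2 A (A + B) A0 (addr_ge0 A0 B0).
have H1 : forall k, `|d k.+1| <= A * k%:R + (A + B).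
  by move=> k; have := H k.+1; rewrite -natr1; lra.
move=> /(_ H1); have := H 0%N; rewrite mulr0 add0r => /ler_normlP[? ?] /ler_normlP[? ?].
by apply/ler_normlP; case: odd; split; lra.
Qed.

(** The deficit [2^-1 ^+ n] of the geometric sum is the gap that [digit_sum_sep] converts into a
    separation. *)
Lemma digit_sum_upper n d (j : nat) (D : R) : 0 <= D ->
  (forall k, 0 <= d k <= D) -> digit_sum n d j <= D * (1 - 2^-1 ^+ n).
Proof.
elim: n d j => [|n IH] d j D0 H /=; first by rewrite expr0; lra.
have := IH (fun k => d k.+1) j./2 D0 (fun k => H k.+1).
have /andP[h1 h2] := H 0%N; rewrite exprS.
set q := 2^-1 ^+ n; case: odd; nra.
Qed.

(* At the first digit where the two indices differ the larger term dominates
   the sum of all later ones, because the d k are decreasing. *)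
Lemma digit_sum_sep n d (j1 j2 : nat) (D : R) : 0 <= D -> (forall k, D <= d k) ->
  (forall k, d k.+1 <= d k) ->
  (j1 < 2 ^ n)%N -> (j2 < 2 ^ n)%N -> j1 != j2 ->
  D * 2^-1 ^+ n <= `|digit_sum n d j1 - digit_sum n d j2|.
Proof.
elim: n d j1 j2 => [|n IH] d j1 j2 D0 H Hd.
  by rewrite expn0 !ltnS !leqn0 => /eqP-> /eqP->; rewrite eqxx.
move=> l1 l2 ne /=; rewrite exprS.
have h1 : (j1./2 < 2 ^ n)%N by rewrite ltn_half_double -muln2 mulnC -expnS.
have h2 : (j2./2 < 2 ^ n)%N by rewrite ltn_half_double -muln2 mulnC -expnS.
(* Digit 1 against digit 0: even if all remaining digits of [b] are 1, the geometric deficit leaves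
   2^-n times [d 0], and [d 0] is at least [D]. *)
have main a b : 2^-1 ^+ n * D <= d 0%N / 2 *2 + digit_sum n (fun k => d k.+1) a - digit_sum n (fun k => d k.+1) b.
  have d0 k : 0 <= d k.+1 <= d 0%N.
    apply/andP; split; first exact: le_trans D0 (H _).
    by elim: k => [|k ih]; [exact: Hd|exact: le_trans (Hd _) ih].
  have D00 : 0 <= d 0%N by exact: le_trans D0 (H _).
  have U := @digit_sum_upper n (fun k => d k.+1) b _ D00 d0.
  have L : 0 <= digit_sum n (fun k => d k.+1) a by apply: digit_sum_ge0 => k; case/andP: (d0 k).
  have q0 : 0 <= 2^-1 ^+ n :> R by apply: exprn_ge0; lra.
  have HD := H 0%N; nra.
case o1 : (odd j1); case o2 : (odd j2).
- have ne' : j1./2 != j2./2.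
    by apply: contra ne => /eqP E; rewrite -[j1]odd_double_half -[j2]odd_double_half E o1 o2.
  have := IH (fun k => d k.+1) _ _ D0 (fun k => H k.+1) (fun k => Hd k.+1) h1 h2 ne'.
  set u := digit_sum n _ _; set v := digit_sum n _ _.
  rewrite (_ : _ + _ - _ = (u - v) / 2); last by field.
  rewrite normrM (gtr0_norm (_ : 0 < 2^-1)) ?invr_gt0//; lra.
- apply: le_trans (ler_norm _); have := main j1./2 j2./2; lra.
- rewrite distrC; apply: le_trans (ler_norm _); have := main j2./2 j1./2; lra.
- have ne' : j1./2 != j2./2.
    by apply: contra ne => /eqP E; rewrite -[j1]odd_double_half -[j2]odd_double_half E o1 o2.
  have := IH (fun k => d k.+1) _ _ D0 (fun k => H k.+1) (fun k => Hd k.+1) h1 h2 ne'.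
  set u := digit_sum n _ _; set v := digit_sum n _ _.
  rewrite (_ : _ + _ - _ = (u - v) / 2); last by field.
  rewrite normrM (gtr0_norm (_ : 0 < 2^-1)) ?invr_gt0//; lra.
Qed.

Lemma digit_sum_prefix i m d (j : nat) :
  digit_sum (i + m) d j = digit_sum i d (j %% 2 ^ i) +
    2^-1 ^+ i * digit_sum m (fun k => d (i + k)%N) (j %/ 2 ^ i).
Proof.
elim: i d j => [|i IH] d j.
  by rewrite add0n expn0 divn1 expr0 mul1r /= add0r; apply: eq_digit_sum.
rewrite addSn /= IH.
have od : odd (j %% 2 ^ i.+1) = odd j.
  by rewrite odd_mod // expnS oddM.
have hf : (j %% 2 ^ i.+1)./2 = (j./2 %% 2 ^ i)%N.
  by rewrite -!divn2 expnS modn_divl mulnC.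
have dv : (j %/ 2 ^ i.+1 = j./2 %/ 2 ^ i)%N by rewrite expnS divnMA divn2.
rewrite od hf dv exprS.
set a := digit_sum i _ _; set b := digit_sum m _ _.
by case: odd; field.
Qed.

End kakeya_digits.

(** * An oscillatory integral *)

Section oscillation.
Variable R : realType.
Local Notation mu := (@lebesgue_measure R).

Lemma sin_le (x : R) : 0 <= x -> sin x <= x.
Proof.
move=> x0; have [->|xn0] := eqVneq x 0; first by rewrite sin0.
have x0' : 0 < x by rewrite lt_def xn0.
have [c /andP[]] := @MVT R sin cos 0 x x0' (fun y _ => is_derive_sin y)
   (continuous_subspaceT (@continuous_sin R)).
rewrite sin0 !subr0 => _ _ ->.
by rewrite -[leRHS]mul1r; apply: ler_wpM2r => //; exact: cos_le1.
Qed.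

Lemma norm_sin_le (x : R) : `|sin x| <= `|x|.
Proof.
have [x0|x0] := leP 0 x.
  rewrite (ger0_norm x0) ler_norml sin_le // andbT.
  have [x1|x1] := leP x 1; last by have := sin_geN1 x; lra.
  have : 0 <= sin x; last lra.
  by apply: sin_ge0_pi; have := pi_ge2 R; lra.
have x0' : 0 <= - x by lra.
rewrite (ltr0_norm x0) -normrN -sinN ler_norml sin_le // andbT.
have [x1|x1] := leP (- x) 1; last by have := sin_geN1 (- x); lra.
have : 0 <= sin (- x); last lra.
by apply: sin_ge0_pi; have := pi_ge2 R; lra.
Qed.

Lemma subr_cos (x : R) : 1 - cos x = 2 * sin (x / 2) ^+ 2.
Proof.
have {1}-> : x = (x / 2) *+ 2 by rewrite mulr2n; lra.
by have := cos2Dsin2 (x / 2); rewrite cos_mulr2n mulr2n; lra.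
Qed.

Lemma subr_cos_le (x : R) : 1 - cos x <= x ^+ 2 / 2.
Proof.
rewrite subr_cos; have := norm_sin_le (x / 2).
have h : sin (x/2) ^+ 2 = `|sin (x/2)| ^+ 2 by rewrite real_normK// num_real.
have h2 : (x/2) ^+ 2 = `|x/2| ^+ 2 by rewrite real_normK// num_real.
move=> H; have : `|sin (x/2)| ^+ 2 <= `|x/2| ^+ 2 by rewrite ler_sqr ?nnegrE.
by rewrite -h -h2; lra.
Qed.

Lemma sin_ge_half (x : R) : 0 <= x <= 1 -> x / 2 <= sin x.
Proof.
move=> /andP[x0 x1]; have [->|xn0] := eqVneq x 0; first by rewrite sin0; lra.
have x0' : 0 < x by rewrite lt_def xn0.
have [c /andP[]] := @MVT R sin cos 0 x x0' (fun y _ => is_derive_sin y)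
   (continuous_subspaceT (@continuous_sin R)).
rewrite sin0 !subr0 !bnd_simp => c0 cx ->.
have := subr_cos_le c => H.
have : c ^+ 2 <= 1 by rewrite expr_le1 //; lra.
by nra.
Qed.

Lemma subr_cos_ge (x : R) : 0 <= x <= 2 -> x ^+ 2 / 8 <= 1 - cos x.
Proof.
move=> /andP[x0 x2]; rewrite subr_cos.
have := @sin_ge_half (x / 2).
have -> : 0 <= x / 2 <= 1 by apply/andP; split; lra.
move=> /(_ isT) H; nra.
Qed.

(** Along a circle of radius t the phase of a plane wave of frequency kap, measured from the point
    where the wave front is tangent, is [K * (1 - cos a)] with K = kap t. The sine component is the
    one whose integral is bounded below by an elementary integration by parts. *)
Definition chirp (K a : R) : R := sin (K * (1 - cos a)).

Lemma chirpN K a : chirp K (- a) = chirp K a. Proof. by rewrite /chirp cosN. Qed.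

Lemma continuous_chirp K : continuous (chirp K).
Proof.
move=> x; apply: continuous_comp; last exact: continuous_sin.
apply: cvgM; first exact: cvg_cst.
by apply: cvgB; [exact: cvg_cst|exact: continuous_cos].
Qed.

Lemma integrable_chirp K a b : mu.-integrable `[a, b] (EFin \o chirp K).
Proof.
apply: continuous_compact_integrable; first exact: segment_compact.
by apply: continuous_subspaceT; exact: continuous_chirp.
Qed.

(** Integration by parts: with phi = K (1 - cos a) this is (1 - cos phi) / phi'. Taking 1 - cos phi
    instead of - cos phi makes both [amp] and the correction [corr] nonnegative on the first
    quadrant and removes the singularity at a = 0. *)
Let amp (K a : R) := (1 - cos (K * (1 - cos a))) * (K * sin a)^-1.

Lemma is_derive_amp (K a : R) : 0 < K -> sin a != 0 ->
  is_derive a 1 (amp K)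
   (chirp K a - (1 - cos (K * (1 - cos a))) * cos a / (K * sin a ^+ 2)).
Proof.
move=> K0 sa; have Kn0 : K != 0 by rewrite gt_eqF.
have d1 : is_derive a 1 (fun x => K * (1 - cos x)) (K * sin a).
  have -> : (fun x => K * (1 - cos x)) = (K \*: ((cst 1 : R -> R) - cos)) by [].
  by apply: is_derive_eq; rewrite /GRing.scale /= sub0r opprK.
have d2 : is_derive a 1 (fun x => 1 - cos (K * (1 - cos x))) (sin (K * (1 - cos a)) * (K * sin a)).
  have -> : (fun x => 1 - cos (K * (1 - cos x))) = ((cst 1 : R -> R) - (cos \o (fun x => K * (1 - cos x)))) by [].
  have d3 := @is_derive1_comp R cos (fun x => K * (1 - cos x)) a _ _ (is_derive_cos _) d1.
  by apply: is_derive_eq; rewrite sub0r mulNr opprK.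
have d4 : is_derive a 1 (fun x => K * sin x) (K * cos a).
  have -> : (fun x => K * sin x) = (K \*: (sin : R -> R)) by [].
  by apply: is_derive_eq.
have n0 : K * sin a != 0 by rewrite mulf_neq0.
have d5 : is_derive a 1 (fun x => (K * sin x)^-1) (- (K * sin a) ^- 2 *: (K * cos a)).
  exact: is_deriveV.
have d6 := @is_deriveM R R _ _ a 1 _ _ d2 d5.
apply: is_derive_eq.
rewrite /GRing.scale /= /chirp.
by field; rewrite Kn0 sa.
Qed.

Let corr (K a : R) := (1 - cos (K * (1 - cos a))) * cos a / (K * sin a ^+ 2).

Lemma corr_ge0 (K a : R) : 0 < K -> 0 <= cos a -> 0 <= corr K a.
Proof.
move=> K0 ca; rewrite /corr; apply: divr_ge0.
  by apply: mulr_ge0 => //; have := cos_le1 (K * (1 - cos a)); lra.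
by apply: mulr_ge0; [exact: ltW|exact: sqr_ge0].
Qed.

Lemma corr_lower : exists2 c : R, 0 < c & forall K s a : R,
  0 < s -> s <= 2^-1 -> K * s ^+ 2 = 1 -> s <= a <= 2 * s -> c <= corr K a.
Proof.
(* For a comparable with s the phase q lies in [1/8, 2], so 1 - cos q >= q^2 / 8 gives the first
   three factors; cos a >= 1/2 and K (sin a)^2 <= 4 give the last two. *)
exists (8^-1 * 8^-1 / 8 / 2 / 4); first lra.
move=> K s a s0 s1 Ks /andP[sa as2].
have s2 : 0 < s ^+ 2 by rewrite exprn_gt0.
have K0 : 0 < K by rewrite -(pmulr_lgt0 _ s2) Ks.
have a1 : 0 <= a <= 1 by apply/andP; split; lra.
have sina : 0 < sin a by have := sin_ge_half a1; lra.
have sinle : sin a <= a by apply: sin_le; lra.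
have a2 : a ^+ 2 <= 1 by rewrite expr_le1 //; lra.
have ca : 2^-1 <= cos a by have := subr_cos_le a; lra.
have sa2 : s ^+ 2 <= a ^+ 2 by rewrite ler_sqr ?nnegrE; lra.
have as4 : a ^+ 2 <= 4 * s ^+ 2.
  have : a ^+ 2 <= (2 * s) ^+ 2 by rewrite ler_sqr ?nnegrE; lra.
  by rewrite exprMn; lra.
have ss4 : sin a ^+ 2 <= 4 * s ^+ 2.
  by apply: le_trans as4; rewrite ler_sqr ?nnegrE //; lra.
have q1 : 8^-1 <= K * (1 - cos a).
  have a02 : 0 <= a <= 2 by apply/andP; split; lra.
  have h : s ^+ 2 / 8 <= 1 - cos a by have := subr_cos_ge a02; lra.
  by have := ler_wpM2l (ltW K0) h; rewrite mulrA Ks mul1r.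
have q2 : K * (1 - cos a) <= 2.
  have h : 1 - cos a <= 2 * s ^+ 2 by have := subr_cos_le a; lra.
  by have := ler_wpM2l (ltW K0) h; rewrite mulrCA Ks mulr1.
have d0 : 0 < K * sin a ^+ 2 by rewrite mulr_gt0 ?exprn_gt0.
have d4 : K * sin a ^+ 2 <= 4.
  by have := ler_wpM2l (ltW K0) ss4; rewrite (mulrCA K 4) Ks mulr1.
rewrite /corr ler_pdivlMr //.
move: (K * sin a ^+ 2) d0 d4 => u u0 u4.
move: (K * (1 - cos a)) q1 q2 => q q1 q2.
have q3 : 8^-1 * 8^-1 / 8 <= 1 - cos q.
  have q02 : 0 <= q <= 2 by apply/andP; split; lra.
  have := subr_cos_ge q02.
  have : 8^-1 * 8^-1 <= q * q by apply: ler_pM; lra.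
  by rewrite expr2; lra.
move: (1 - cos q) (cos a) q3 ca => x y xge yge.
have : 8^-1 * 8^-1 / 8 * 2^-1 <= x * y by apply: ler_pM; lra.
by move: (x * y) => z; lra.
Qed.

Lemma amp_ge0 (K a : R) : 0 < K -> 0 < sin a -> 0 <= amp K a.
Proof.
move=> K0 sa; rewrite /amp; apply: mulr_ge0; first by have := cos_le1 (K * (1 - cos a)); lra.
by rewrite invr_ge0 mulr_ge0 ?ltW.
Qed.

Lemma amp_le (K s e : R) : 0 < e -> e <= s -> s <= 2^-1 -> K * s ^+ 2 = 1 -> amp K e <= e.
Proof.
move=> e0 es s1 Ks.
have s2 : 0 < s ^+ 2 by rewrite exprn_gt0 // (lt_le_trans e0).
have K0 : 0 < K by rewrite -(pmulr_lgt0 _ s2) Ks.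
have he : e / 2 <= sin e by apply: sin_ge_half; apply/andP; split; lra.
have hq := ler_wpM2l (ltW K0) (subr_cos_le e).
have hq0 : 0 <= K * (1 - cos e) by apply: mulr_ge0; [exact: ltW|have := cos_le1 e; lra].
have Ke : K * e ^+ 2 <= 1.
  by rewrite -Ks; apply: ler_wpM2l; [exact: ltW|rewrite ler_sqr ?nnegrE; lra].
have hc : 1 - cos (K * (1 - cos e)) <= K * e ^+ 2 / 2.
  apply: (le_trans (subr_cos_le _)).
  move: Ke hq hq0; rewrite (mulrA K (e ^+ 2)); move: (K * (1 - cos e)) (K * e ^+ 2) => x y y1 xy x0.
  have : x ^+ 2 <= (y / 2) * 1 by rewrite expr2; apply: ler_pM => //; lra.
  by lra.
have se : 0 < K * sin e by apply: mulr_gt0 => //; lra.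
rewrite /amp ler_pdivrMr //; apply: (le_trans hc).
have -> : K * e ^+ 2 / 2 = e * (K * (e / 2)) by ring.
by apply: ler_wpM2l; [exact: ltW|apply: ler_wpM2l => //; exact: ltW].
Qed.

Lemma chirp_ge0 (K s a : R) : K * s ^+ 2 = 1 -> 0 < K -> 0 <= a -> a <= s -> 0 <= chirp K a.
Proof.
move=> Ks K0 a0 as1; rewrite /chirp; apply: sin_ge0_pi; apply/andP; split.
  by apply: mulr_ge0; [exact: ltW|have := cos_le1 a; lra].
apply: (@le_trans _ _ 1); last by have := pi_ge2 R; lra.
have h : a ^+ 2 <= s ^+ 2 by rewrite ler_sqr ?nnegrE; lra.
rewrite -Ks; apply: ler_wpM2l; first exact: ltW.
by have := subr_cos_le a; have := sqr_ge0 s; lra.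
Qed.

Lemma integral_amp (K e b : R) : 0 < K -> 0 < e -> e < b -> b <= pi / 2 ->
  let f a := chirp K a - corr K a in
  mu.-integrable `[e, b] (EFin \o f) /\ Rintegral mu `[e, b] f = amp K b - amp K e.
Proof.
move=> K0 e0 eb bpi f.
have pi2 := pihalf_lt2 R.
have sinn a : e <= a <= b -> sin a != 0.
  by move=> /andP[ea ab]; rewrite gt_eqF // sin_gt0_pi //; apply/andP; split; lra.
have damp a : e <= a <= b -> is_derive a 1 (amp K) (f a).
  by move=> H; apply: is_derive_amp => //; exact: sinn.
have camp a : e <= a <= b -> {for a, continuous (amp K)}.
  move=> H; apply: differentiable_continuous; apply/derivable1_diffP.
  by have := damp _ H; case.
have cf : {within `[e, b], continuous f}.
  apply: continuous_in_subspaceT => a; rewrite inE /= in_itv /= => H.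
  apply: cvgB; first exact: continuous_chirp.
  rewrite /corr; apply: cvgM; first apply: cvgM.
  - apply: cvgB; first exact: cvg_cst.
    apply: continuous_comp; last exact: continuous_cos.
    apply: cvgM; first exact: cvg_cst.
    by apply: cvgB; [exact: cvg_cst|exact: continuous_cos].
  - exact: continuous_cos.
  - apply: cvgV; first by rewrite mulf_neq0 ?expf_neq0 ?(gt_eqF K0) ?sinn.
    apply: cvgM; first exact: cvg_cst.
    exact: (continuous_comp (@continuous_sin R a) (@exprn_continuous R 2 (sin a))).
have oo a : a \in `]e, b[ -> e <= a <= b.
  by rewrite in_itv /= => /andP[? ?]; apply/andP; split; exact: ltW.
have LR : derivable_oo_LRcontinuous (amp K : R -> R^o) e b.
  split.
  - by move=> a /oo /damp [].
  - by apply: cvg_at_right_filter; apply: camp; rewrite lexx ltW.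
  - by apply: cvg_at_left_filter; apply: camp; rewrite lexx ltW.
have E := @continuous_FTC2 R f (amp K) e b eb cf LR.
have {}E : Rintegral mu `[e, b] f = amp K b - amp K e.
  rewrite /Rintegral E // => a /oo /damp H.
  by rewrite derive1E; exact: derive_val.
split=> //; apply: continuous_compact_integrable => //; exact: segment_compact.
Qed.

(* chirp K differs from the derivative of amp K by a nonnegative term, which is
   bounded below where a is comparable with s = K^(-1/2). *)
Lemma integral_chirp_lower : exists2 c : R, 0 < c & forall K s b : R,
  0 < s -> s <= 2^-1 -> K * s ^+ 2 = 1 -> 2 * s <= b -> b <= pi / 2 ->
  c * s <= Rintegral mu `[0, b] (chirp K).
Proof.
have [c0 c00 corr1] := corr_lower.
have [c4 c40 [c41 c42]] : exists2 c4 : R, 0 < c4 & c4 <= 1 /\ c4 <= c0.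
  by exists (Num.min 1 c0); [rewrite lt_min ltr01|rewrite !ge_min !lexx orbT].
exists (c4 / 2); first lra.
move=> K s b s0 s1 Ks sb bpi.
have s2 : 0 < s ^+ 2 by rewrite exprn_gt0.
have K0 : 0 < K by rewrite -(pmulr_lgt0 _ s2) Ks.
(* The derivative of [amp] is only available where the sine is nonzero, so the integration starts at
   a small e > 0. With e <= c4 s / 4 the boundary term [amp K e] costs at most a quarter of c4 s; c4
   <= 1 ensures e < s, where [chirp_ge0] disposes of [0, e]. *)
have [e [e0 es ec eb]] : exists e, [/\ 0 < e, e < s, e <= c4 * s / 4 & e < b].
  have h : s * (c4 / 4) < s by rewrite -[ltRHS]mulr1 ltr_pM2l //; lra.
  exists (s * (c4 / 4)); split=> //; [by apply: mulr_gt0; lra|by rewrite mulrA (mulrC s)|lra].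
have [fi Ef] := integral_amp K0 e0 eb bpi.
have pi2 := pihalf_lt2 R.
have ampb : 0 <= amp K b by apply: amp_ge0 => //; apply: sin_gt0_pi; apply/andP; split; lra.
have ampe : amp K e <= e by exact: amp_le (ltW es) s1 Ks.
have cosp a : e <= a <= b -> 0 <= cos a.
  by move=> /andP[ea ab]; apply: cos_ge0_pihalf; apply/andP; split; lra.
have corrg a : s <= a <= 2 * s -> c4 <= corr K a.
  by move=> H; apply: le_trans c42 _; exact: corr1 H.
pose g a := c4 * \1_(`[s, 2 * s]%classic) a : R.
have fg (a : R) : e <= a <= b -> (chirp K a - corr K a) + g a <= chirp K a.
  move=> ab; rewrite /g indicE; have := corr_ge0 K0 (cosp a ab).
  have [/set_mem|_] := boolP (a \in _); last by rewrite mulr0; lra.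
  by rewrite /= in_itv /= => /corrg; rewrite mulr1; lra.
have chi : mu.-integrable `[e, b] (EFin \o chirp K) by exact: integrable_chirp.
have gi : mu.-integrable `[e, b] (EFin \o g).
  apply: (@le_integrable _ _ _ _ _ _ _ (EFin \o (fun=> c4))) => //.
  - by apply/measurable_EFinP; apply: measurable_funM => //; exact: measurable_indic.
  - move=> a _ /=; rewrite lee_fin /g indicE normrM -[leRHS]mulr1.
    by apply: ler_wpM2l => //; case: (_ \in _); rewrite ?normr1 ?normr0.
  - apply: continuous_compact_integrable; first exact: segment_compact.
    by apply: continuous_subspaceT => x; exact: cvg_cst.
have Eg : Rintegral mu `[e, b] g = c4 * s.
  rewrite /Rintegral /g; under eq_integral do rewrite EFinM.
  rewrite ge0_integralZl //; last 2 first.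
  - by apply/measurable_EFinP; exact: measurable_indic.
  - by rewrite lee_fin ltW.
  rewrite integral_indic // (_ : _ `&` _ = `[s, 2 * s]%classic); last first.
    apply/seteqP; split => x /=; rewrite !in_itv /=; first by case.
    by move=> /andP[h1 h2]; rewrite h1 h2; split=> //; apply/andP; split; lra.
  rewrite /= lebesgue_measure_itv /= lte_fin ifT; last lra.
  by rewrite -EFinB -EFinM /=; congr (_ * _); lra.
have cg : amp K b - amp K e + c4 * s <= Rintegral mu `[e, b] (chirp K).
  by rewrite -Ef -Eg -RintegralD //; apply: le_Rintegral => //; exact: (integrableD _ fi gi).
have c0b : mu.-integrable `[0, b] (EFin \o chirp K) by exact: integrable_chirp.
have := @Rintegral_itvB R (chirp K) (BLeft 0) (BRight b) e c0b.
rewrite !bnd_simp => /(_ (ltW e0) (ltW eb)).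
rewrite Rintegral_itv_obnd_cbnd; last first.
  apply: integrableS c0b => // x /=; rewrite !in_itv /= => /andP[h1 h2].
  by rewrite h2 andbT ltW // (lt_trans e0).
have : 0 <= Rintegral mu `[0, e] (chirp K).
  apply: Rintegral_ge0 => a; rewrite /= in_itv /= => /andP[a0 ae].
  by apply: (chirp_ge0 Ks K0 a0); exact: le_trans (ltW es).
have : 0 <= c4 * s by apply: mulr_ge0; exact: ltW.
move: cg ec ampb ampe; rewrite [c4 / 2 * s]mulrAC.
move: (Rintegral _ _ _) (Rintegral _ _ _) (Rintegral _ _ _) (amp K b) (amp K e) (c4 * s).
by clear; move=> x1 x2 x3 x4 x5 x6; lra.
Qed.

End oscillation.

(** * A band-limited kernel *)

Section fejer.
Variable R : realType.
Local Notation mu := (@lebesgue_measure R).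

(* The integral form avoids a case distinction at 0. *)
Definition sinc (x : R) : R := Rintegral mu `[0, 1] (fun s => cos (s * x)).

Lemma norm_cosB_le (x y : R) : `|cos x - cos y| <= `|x - y|.
Proof.
wlog xy : x y / x < y.
  move=> H; have [/H//|/H|->] := ltgtP x y; last by rewrite !subrr normr0.
  by rewrite distrC (distrC y).
have [c _ E] := @MVT R cos (fun z => - sin z) x y xy (fun y _ => is_derive_cos y)
   (continuous_subspaceT (@continuous_cos R)).
rewrite distrC (distrC x) E normrM normrN -[leRHS]mul1r; apply: ler_wpM2r => //.
exact: sin_max.
Qed.

Let continuous_cosM (x : R) : continuous (fun s : R => cos (s * x)).
Proof.
move=> s; apply: continuous_comp; last exact: continuous_cos.
by apply: cvgM; [exact: cvg_id|exact: cvg_cst].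
Qed.

Let integrable_cosM (x : R) : mu.-integrable `[0, 1] (EFin \o (fun s : R => cos (s * x))).
Proof.
apply: continuous_compact_integrable; first exact: segment_compact.
exact: continuous_subspaceT.
Qed.

Let integral01 : Rintegral mu `[0, 1] (fun=> 1) = 1.
Proof. by rewrite Rintegral_cst //= mul1r lebesgue_measure_itv /= lte_fin ltr01 oppr0 adde0. Qed.

Let integrable_cst01 (c : R) : mu.-integrable `[0, 1] (EFin \o (fun=> c)).
Proof.
apply: continuous_compact_integrable; first exact: segment_compact.
by apply: continuous_subspaceT => x; exact: cvg_cst.
Qed.

Lemma sinc_le1 x : `|sinc x| <= 1.
Proof.
apply: le_trans (le_normr_Rintegral _ (integrable_cosM x)) _ => //.
rewrite -[leRHS]integral01; apply: le_Rintegral => //.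
  by have := integrable_abse (integrable_cosM x).
by move=> s _; exact: cos_max.
Qed.

Lemma sinc_lipschitz x y : `|sinc x - sinc y| <= `|x - y|.
Proof.
rewrite /sinc -RintegralB //.
have I : mu.-integrable `[0, 1] (EFin \o (fun s : R => cos (s * x) - cos (s * y))).
  by have := integrableB _ (integrable_cosM x) (integrable_cosM y); exact.
apply: le_trans (le_normr_Rintegral _ I) _ => //.
have -> : `|x - y| = Rintegral mu `[0, 1] (fun=> `|x - y| * 1).
  by rewrite RintegralZl // integral01 mulr1.
apply: le_Rintegral => //.
- by have := integrable_abse I.
- move=> s; rewrite /= in_itv /= => /andP[s0 s1].
  apply: le_trans (norm_cosB_le _ _) _; rewrite -mulrBr normrM mulr1.
  by rewrite ger0_norm // -[leRHS]mul1r; apply: ler_wpM2r.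
Qed.

Lemma sinc0 : sinc 0 = 1.
Proof. by rewrite /sinc; under eq_Rintegral do rewrite mulr0 cos0. Qed.

Lemma sincE x : x != 0 -> sinc x = sin x / x.
Proof.
move=> x0; rewrite /sinc /Rintegral.
have dF (s : R) : is_derive s 1 ((fun s : R => sin (s * x) / x) : R -> R^o) (cos (s * x)).
  have d1 : is_derive s 1 (fun s : R => s * x) x.
    have -> : (fun s : R => s * x) = (x \*: (id : R -> R)) by apply/funext => t; rewrite /GRing.scale /= mulrC.
    by apply: is_derive_eq; rewrite /GRing.scale /= mulr1.
  have d2 := @is_derive1_comp R sin (fun s => s * x) s _ _ (is_derive_sin _) d1.
  have -> : (fun s : R => sin (s * x) / x) = (x^-1 \*: (sin \o (fun s => s * x))).
    by apply/funext => t; rewrite /GRing.scale /= mulrC.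
  by apply: is_derive_eq; rewrite /GRing.scale /=; field.
rewrite (@continuous_FTC2 R _ (fun s => sin (s * x) / x)) //=.
- by rewrite mul1r mul0r sin0 mul0r subr0.
- exact: continuous_subspaceT.
- have cF (s : R) : {for s, continuous ((fun s : R => sin (s * x) / x) : R -> R^o)}.
    by apply: differentiable_continuous; apply/derivable1_diffP; case: (dF s).
  split.
  + by move=> s _; case: (dF s).
  + by apply: cvg_at_right_filter; exact: cF.
  + by apply: cvg_at_left_filter; exact: cF.
- by move=> s _; rewrite derive1E; exact: derive_val.
Qed.

(** This is (1 - cos x) / x^2, whose Fourier transform is a multiple of a triangle function. Written
    through [sinc] it inherits the bound and the Lipschitz estimate, including at 0. *)
Definition fejer (x : R) : R := sinc (x / 2) ^+ 2 / 2.

Lemma fejerE x : x != 0 -> fejer x = (1 - cos x) / x ^+ 2.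
Proof.
move=> x0; rewrite /fejer sincE; last by rewrite mulf_neq0.
have := cos_mulr2n (x / 2); rewrite mulr2n -splitr => ->.
by rewrite exprMn sin2cos2 mulr2n; field.
Qed.

Lemma fejer0 : fejer 0 = 2^-1.
Proof. by rewrite /fejer mul0r sinc0 expr1n mul1r. Qed.

Lemma fejer_ge0 x : 0 <= fejer x.
Proof. by rewrite /fejer divr_ge0 // sqr_ge0. Qed.

Lemma fejer_le_half x : fejer x <= 2^-1.
Proof.
have : sinc (x / 2) ^+ 2 <= 1 by rewrite -real_normK ?num_real // expr_le1 // sinc_le1.
by rewrite /fejer; lra.
Qed.

Lemma fejer_lipschitz x y : `|fejer x - fejer y| <= `|x - y|.
Proof.
rewrite /fejer -mulrBl subr_sqr 2!normrM (ger0_norm (_ : 0 <= 2^-1)) //.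
have := sinc_lipschitz (x / 2) (y / 2).
rewrite -mulrBl normrM (ger0_norm (_ : 0 <= 2^-1)) //.
have := le_trans (ler_normD (sinc (x/2)) (sinc (y/2))) (lerD (sinc_le1 _) (sinc_le1 _)).
set a := `|sinc _ - _|; set b := `|_ + _|; set c := `|x - y| => hb ha.
have a0 : 0 <= a by exact: normr_ge0.
have b0 : 0 <= b by exact: normr_ge0.
have : a * b <= (c / 2) * (1 + 1) by exact: ler_pM.
by lra.
Qed.

Lemma continuous_fejer : continuous fejer.
Proof.
move=> x; apply/(@cvgrPdist_le _ R^o) => e e0; near=> y.
apply: le_trans (fejer_lipschitz _ _) _; near: y.
by apply: (@cvgr_dist_le _ R^o).
Unshelve. all: by end_near. Qed.

Lemma measurable_fejer : measurable_fun [set: R] fejer.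
Proof. by apply: continuous_measurable_fun; exact: continuous_fejer. Qed.

Lemma fejer_even x : fejer (- x) = fejer x.
Proof.
have [->|x0] := eqVneq x 0; first by rewrite oppr0.
by rewrite !fejerE ?oppr_eq0 // cosN sqrrN.
Qed.

Lemma fejer_le x : fejer x <= 4 / (1 + x ^+ 2).
Proof.
have x2 : 0 <= x ^+ 2 by exact: sqr_ge0.
rewrite ler_pdivlMr; last lra.
have [h|h] := leP (x ^+ 2) 1; first by have := fejer_le_half x; have := fejer_ge0 x; nra.
have x0 : x != 0 by apply/eqP => E; move: h; rewrite E expr0n /=; lra.
have : fejer x * x ^+ 2 = 1 - cos x by rewrite fejerE // divfK // expf_neq0.
by have := cos_geN1 x; have := fejer_ge0 x; have := fejer_le_half x; nra.
Qed.

End fejer.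

Section fejer_integral.
Variable R : realType.
Local Notation mu := (@lebesgue_measure R).

Lemma integrable_fejer : mu.-integrable setT (EFin \o @fejer R).
Proof.
apply/integrableP; split; first by apply/measurable_EFinP; exact: measurable_fejer.
have H : (\int[mu]_x `|(EFin \o @fejer R) x| <= \int[mu]_x (4 * (oneDsqr x)^-1)%:E)%E.
  apply: ge0_le_integral => //.
  - by apply: measurableT_comp => //; apply/measurable_EFinP; exact: measurable_fejer.
  - apply/measurable_EFinP; apply: measurable_funM => //.
    by apply: continuous_measurable_fun; exact: continuous_oneDsqrV.
  - by move=> x _ /=; rewrite lee_fin ger0_norm ?fejer_ge0 // /oneDsqr fejer_le.
apply: le_lt_trans H _.
under eq_integral do rewrite EFinM.
rewrite ge0_integralZl //; last first.
  by apply/measurable_EFinP; apply: continuous_measurable_fun; exact: continuous_oneDsqrV.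
rewrite (@ge0_symfun_integralT R (fun x => (oneDsqr x)^-1)) //.
- by rewrite -set_itvcy integral0y_oneDsqr -!EFinM ltry.
- exact: continuous_oneDsqrV.
- by move=> x /=; rewrite /oneDsqr sqrrN.
Qed.

(** This number is pi; the kernel is normalized by it. *)
Definition fejer_mass : R := Rintegral mu setT (@fejer R).

Lemma fejer_massE : (\int[mu]_x (fejer x)%:E)%E = fejer_mass%:E.
Proof. by rewrite /fejer_mass /Rintegral fineK //; exact: (integrable_fin_num measurableT integrable_fejer). Qed.

Lemma fejer_mass_gt0 : 0 < fejer_mass.
Proof.
rewrite -lte_fin -fejer_massE.
apply: (@lt_le_trans _ _ (\int[mu]_x (8^-1 * \1_(`[0, 1]%classic) x)%:E)%E).
  under eq_integral do rewrite EFinM.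
  rewrite ge0_integralZl //; last exact/measurable_EFinP/measurable_indic.
  rewrite integral_indic // setIT /= lebesgue_measure_itv /= lte_fin ltr01 oppr0 adde0 mule1 lte_fin; lra.
apply: ge0_le_integral => //.
- by apply/measurable_EFinP; apply: measurable_funM => //; exact: measurable_indic.
- by apply/measurable_EFinP; exact: measurable_fejer.
- move=> x _; rewrite lee_fin indicE.
  have [/set_mem|_] := boolP (x \in _); last by rewrite mulr0 fejer_ge0.
  rewrite /= in_itv /= mulr1 => /andP[x0 x1].
  have [->|xn0] := eqVneq x 0; first by rewrite fejer0; lra.
  rewrite fejerE // ler_pdivlMr; last by rewrite exprn_even_gt0.
  have x02 : 0 <= x <= 2 by apply/andP; split; lra.
  by have := subr_cos_ge x02; lra.
Qed.

Lemma integral_fejer_tail (r : R) : 0 < r ->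
  (\int[mu]_(x in `[r, +oo[) (fejer x)%:E <= (2 / r)%:E)%E.
Proof.
move=> r0.
have cf (x : R) : 0 < x -> {for x, continuous (fun x : R => 2 * x ^- 2)}.
  move=> x0; apply: cvgM; first exact: cvg_cst.
  apply: cvgV; first by rewrite expf_neq0 // gt_eqF.
  exact: exprn_continuous.
have cfw : {within `[r, +oo[, continuous (fun x : R => 2 * x ^- 2)}.
  apply/continuous_within_itvcyP; split.
    by move=> x; rewrite in_itv /= andbT => rx; apply: cf; lra.
  by apply: cvg_at_right_filter; exact: cf.
apply: (@le_trans _ _ (\int[mu]_(x in `[r, +oo[) (2 * x ^- 2)%:E)%E).
  apply: ge0_le_integral => //.
  - by move=> x _; rewrite lee_fin fejer_ge0.
  - by apply/measurable_EFinP; apply: measurable_funTS; exact: measurable_fejer.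
  - by apply/measurable_EFinP; apply: subspace_continuous_measurable_fun.
  - move=> x; rewrite /= in_itv /= andbT => rx; rewrite lee_fin fejerE ?gt_eqF //; last lra.
    by apply: ler_wpM2r; [rewrite invr_ge0 sqr_ge0|have := cos_geN1 x; lra].
have dF (x : R) : 0 < x -> is_derive x 1 ((fun x : R => - 2 * x^-1) : R -> R^o) (2 * x ^- 2).
  move=> x0; have xn0 : x != 0 by rewrite gt_eqF.
  have d1 : is_derive x 1 (fun y : R => y^-1) (- x ^- 2 *: 1) by exact: is_deriveV.
  have -> : (fun x : R => - 2 * x^-1) = (- 2) \*: (fun y : R => y^-1) by [].
  by apply: is_derive_eq; rewrite /GRing.scale /= mulr1 mulrNN.
have cF (x : R) : 0 < x -> {for x, continuous ((fun x : R => - 2 * x^-1) : R -> R^o)}.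
  by move=> x0; apply: differentiable_continuous; apply/derivable1_diffP; case: (dF x x0).
rewrite (@ge0_continuous_FTC2y R (fun x => 2 * x ^- 2) (fun x => - 2 * x^-1) r 0) //.
- by rewrite sub0e lee_fin; lra.
- by move=> x _; rewrite mulr_ge0 // invr_ge0 sqr_ge0.
- rewrite -[X in _ --> X](mulr0 (-2)); apply: cvgM; first exact: cvg_cst.
  apply/gtr0_cvgV0; last exact: cvg_id.
  by exists 0; split.
- by move=> x rx; case: (dF x (lt_trans r0 rx)).
- by apply: cvg_at_right_filter; exact: cF.
- move=> x; rewrite in_itv /= andbT => rx; rewrite derive1E.
  by have H := dF x (lt_trans r0 rx); exact: derive_val.
Qed.

Lemma integral_fejer_scale (s : R) : 0 < s ->
  mu.-integrable setT (EFin \o (fun x => fejer (s * x))) /\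
  (\int[mu]_x (fejer (s * x))%:E)%E = (fejer_mass / s)%:E.
Proof.
move=> s0.
have mf : measurable_fun [set: R] (EFin \o @fejer R) by apply/measurable_EFinP; exact: measurable_fejer.
have f0 (x : R) : (0 <= (fejer x)%:E)%E by rewrite lee_fin fejer_ge0.
have := @ge0_integral_scale R s (EFin \o @fejer R) s0 mf f0.
rewrite /= fejer_massE => H.
have E : (\int[mu]_x (fejer (s * x))%:E)%E = (fejer_mass / s)%:E.
  rewrite mulrC EFinM -H muleA -EFinM mulVf ?gt_eqF // mul1e //.
split=> //.
apply/integrableP; split.
  apply/measurable_EFinP; apply: measurableT_comp; first exact: measurable_fejer.
  exact: measurable_funM.
under eq_integral do rewrite /= ger0_norm ?fejer_ge0 //.
by rewrite E ltry.
Qed.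

End fejer_integral.

Section kernel.
Variable R : realType.
Local Notation mu := (@lebesgue_measure R).

(** An approximate identity at scale 1/L with spectrum in [-L, L]. The phase c in the last field
    covers cosine and sine integrals at once. The two bounds M may grow with L and serve only the
    continuity of convolutions, whereas the tail constant C has to be the same for all L. *)
Record bandlimited_kernel (C L : R) (k : R -> R) : Prop := BandlimitedKernel {
  kernel_ge0 : forall x, 0 <= k x;
  kernel_lipschitz : exists2 M, 0 <= M & forall x y, `|k x - k y| <= M * `|x - y|;
  kernel_bounded : exists2 M, 0 <= M & forall x, k x <= M;
  kernel_measurable : measurable_fun [set: R] k;
  kernel_mass : (\int[mu]_x (k x)%:E = 1)%E;
  kernel_tail : forall r : R, 0 < r ->
    (\int[mu]_x (k x * (r < `|x|)%R%:R)%:E <= (C / (L * r))%:E)%E;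
  kernel_spectrum : forall a c, L < `|a| ->
    Rintegral mu setT (fun x => k x * cos (a * x + c)) = 0 }.

Lemma kernel_integrable C L k : bandlimited_kernel C L k ->
  mu.-integrable setT (EFin \o k).
Proof.
move=> H; apply/integrableP; split; first by apply/measurable_EFinP; exact: kernel_measurable H.
under eq_integral do rewrite /= ger0_norm ?(kernel_ge0 H) //.
by rewrite (kernel_mass H) ltry.
Qed.

Lemma exists_bandlimited_kernel : exists2 C : R, 0 < C &
  forall L, 0 < L -> exists k, bandlimited_kernel C L k.
Proof.
pose C := @fejer_mass R; have C0 : 0 < C := fejer_mass_gt0 R.
(* Each half line contributes at most 2 / (L r) by [integral_fejer_tail]; the two together, divided
   by the mass [C], give 4 / C. *)
exists (4 / C); first by rewrite divr_gt0.
move=> L L0; exists (fun x => L / C * fejer (L * x)).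
have LC : 0 < L / C by rewrite divr_gt0.
have Cn0 : C != 0 by rewrite gt_eqF.
have Ln0 : L != 0 by rewrite gt_eqF.
have [iL EL] := integral_fejer_scale L0.
have mL : measurable_fun [set: R] (fun x => fejer (L * x)).
  by apply: measurableT_comp; [exact: measurable_fejer|exact: measurable_funM].
have mk : measurable_fun [set: R] (fun x => L / C * fejer (L * x)) by exact: measurable_funM.
have k0 x : 0 <= L / C * fejer (L * x) by rewrite mulr_ge0 ?fejer_ge0 // ltW.
split=> //.
- exists (L / C * L); first by rewrite mulr_ge0 // ltW.
  move=> x y; rewrite -mulrBr normrM gtr0_norm // -mulrA; apply: ler_wpM2l; first exact: ltW.
  by apply: le_trans (fejer_lipschitz _ _) _; rewrite -mulrBr normrM gtr0_norm.
- exists (L / C * 2^-1); first by rewrite mulr_ge0 // ltW.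
  by move=> x; apply: ler_wpM2l; [exact: ltW|exact: fejer_le_half].
- under eq_integral do rewrite EFinM.
  rewrite ge0_integralZl //; last 3 first.
  + exact/measurable_EFinP.
  + by move=> x _; rewrite lee_fin fejer_ge0.
  + by rewrite lee_fin ltW.
  by rewrite EL -EFinM -/C; congr (_%:E); field; rewrite Ln0.
- move=> r r0.
  have Lr : 0 < L * r by rewrite mulr_gt0.
  pose g y := (fejer y * (L * r <= y)%R%:R : R).
  have mg : measurable_fun [set: R] g.
    have -> : g = (fun y => fejer y * \1_(`[L * r, +oo[%classic) y).
      by apply/funext => y; rewrite /g indicE mem_setE in_itv /= andbT.
    by apply: measurable_funM; [exact: measurable_fejer|exact: measurable_indic].
  have g0 y : (0 <= (g y)%:E)%E by rewrite lee_fin /g mulr_ge0 ?fejer_ge0.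
  have mg' : measurable_fun [set: R] (EFin \o g) by exact/measurable_EFinP.
  have mgL : measurable_fun [set: R] (fun x => g (L * x)).
    by apply: measurableT_comp mg _; exact: measurable_funM.
  have mgN : measurable_fun [set: R] (fun x => g (0 - L * x)).
    by apply: measurableT_comp mg _; apply: measurable_funB => //; exact: measurable_funM.
  have Ig : (\int[mu]_y (g y)%:E <= (2 / (L * r))%:E)%E.
    apply: le_trans (integral_fejer_tail Lr).
    rewrite [leRHS]integral_mkcond le_eqVlt; apply/orP; left; apply/eqP.
    apply: eq_integral => y _; rewrite /g patchE mem_setE in_itv /= andbT.
    by case: ifP => _; rewrite ?mulr1 ?mulr0.
  have Ig1 := @ge0_integral_scale R L _ L0 mg' g0.
  have mg2 : measurable_fun [set: R] (EFin \o (fun x => g (0 - x))).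
    by apply/measurable_EFinP; apply: measurableT_comp mg _; exact: measurable_funB.
  have Ig2 := @ge0_integral_scale R L _ L0 mg2 (fun x => g0 (0 - x)).
  have Ig3 := @ge0_integral_reflect R 0 _ mg' g0.
  apply: (@le_trans _ _ (\int[mu]_x ((C^-1)%:E * (L%:E * (g (L * x))%:E + L%:E * (g (0 - L * x))%:E)))%E).
    apply: ge0_le_integral => //.
    + by move=> x _; rewrite lee_fin mulr_ge0.
    + apply/measurable_EFinP; apply: measurable_funM => //.
      have -> : (fun x : R => (r < `|x|)%R%:R : R) = (\1_(~` `[-r, r]%classic) : R -> R).
        apply/funext => x; rewrite indicE; congr ((_ : bool)%:R).
        by rewrite in_setC mem_setE in_itv /= -ler_norml ltNge.
      by apply: measurable_indic; exact: measurableC.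
    + have -> : (fun x : R => (C^-1)%:E * (L%:E * (g (L * x))%:E + L%:E * (g (0 - L * x))%:E))%E =
          EFin \o (fun x : R => C^-1 * (L * g (L * x) + L * g (0 - L * x))) by [].
      apply/measurable_EFinP; apply: measurable_funM => //.
      by apply: measurable_funD; exact: measurable_funM.
    + move=> x _.
      suff : L / C * fejer (L * x) * (r < `|x|)%R%:R <= C^-1 * (L * g (L * x) + L * g (0 - L * x)).
        by rewrite -lee_fin.
      have -> : L / C * fejer (L * x) * (r < `|x|)%R%:R = C^-1 * (L * (fejer (L * x) * (r < `|x|)%R%:R)) by ring.
      apply: ler_wpM2l; first by rewrite invr_ge0 ltW.
      rewrite -mulrDr; apply: ler_wpM2l; first exact: ltW.
      have h1 := g0 (L * x); have h2 := g0 (0 - L * x); rewrite !lee_fin in h1 h2.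
      case: ltP => [|_]; last by rewrite mulr0 addr_ge0.
      rewrite lter_normr => /orP[rx|rx]; rewrite mulr1.
        by rewrite /g (_ : L * r <= L * x) ?mulr1 ?lerDl // ler_pM2l // ltW.
      rewrite [leRHS]addrC /g (_ : L * r <= 0 - L * x) ?mulr1 ?sub0r ?fejer_even ?lerDl //.
      by rewrite -mulrN ler_pM2l // ltW.
  rewrite ge0_integralZl //; last 3 first.
  + by apply: emeasurable_funD; apply/measurable_EFinP; exact: measurable_funM.
  + by move=> x _; rewrite adde_ge0 // mule_ge0 // lee_fin ltW.
  + by rewrite lee_fin invr_ge0 ltW.
  rewrite ge0_integralD //; last 4 first.
  + by move=> x _; rewrite mule_ge0 // lee_fin ltW.
  + by apply/measurable_EFinP; exact: measurable_funM.
  + by move=> x _; rewrite mule_ge0 // lee_fin ltW.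
  + by apply/measurable_EFinP; exact: measurable_funM.
  have L0' : (0 <= L%:E)%E by rewrite lee_fin ltW.
  have Z1 : (\int[mu]_x (L%:E * (g (L * x))%:E) = L%:E * \int[mu]_x (g (L * x))%:E)%E.
    by apply: ge0_integralZl => //; exact/measurable_EFinP.
  have Z2 : (\int[mu]_x (L%:E * (g (0 - L * x))%:E) = L%:E * \int[mu]_x (g (0 - L * x))%:E)%E.
    by apply: ge0_integralZl => //; exact/measurable_EFinP.
  rewrite Z1 Z2.
  rewrite /= in Ig1 Ig2 Ig3.
  rewrite Ig1 Ig2 Ig3.
  have Ci : (0 <= (C^-1)%:E)%E by rewrite lee_fin invr_ge0 ltW.
  apply: (le_trans (lee_wpmul2l Ci (leeD Ig Ig))).
  by rewrite -EFinD -EFinM lee_fin le_eqVlt; apply/orP; left; apply/eqP; field; rewrite Ln0 Cn0 gt_eqF.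
- move=> a c La.
  wlog a0 : a c La / 0 < a.
    move=> H; have [/(H a c La)//|aN|a0] := ltgtP 0 a; last by move: La; rewrite -a0 normr0; lra.
    rewrite -(H (- a) (- c)) ?normrN //; last lra.
    by apply: eq_Rintegral => x _; rewrite mulNr -opprD cosN.
  have aL : L < a by rewrite gtr0_norm in La.
  pose k x := L / C * fejer (L * x).
  have ik : mu.-integrable setT (EFin \o k).
    apply/integrableP; split; first exact/measurable_EFinP.
    have := integrableZl measurableT (L / C) iL => /integrableP[_].
    by apply: le_lt_trans; rewrite le_eqVlt; apply/orP; left; apply/eqP; apply: eq_integral.
  have dom (h : R -> R) : measurable_fun [set: R] h -> (forall x, `|h x| <= 1) ->
      mu.-integrable setT (EFin \o (fun x => k x * h x)).
    move=> mh h1; apply: (le_integrable _ _ _ ik) => //.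
      by apply/measurable_EFinP; exact: measurable_funM.
    by move=> x _ /=; rewrite lee_fin normrM -[leRHS]mulr1; apply: ler_wpM2l.
  have ma : measurable_fun [set: R] (fun x : R => a * x) by exact: measurable_funM.
  have mc : measurable_fun [set: R] (fun x : R => cos (a * x)).
    by apply: measurableT_comp ma; apply: continuous_measurable_fun; exact: continuous_cos.
  have ms : measurable_fun [set: R] (fun x : R => sin (a * x)).
    by apply: measurableT_comp ma; apply: continuous_measurable_fun; exact: continuous_sin.
  have ic := dom _ mc (fun x => cos_max _).
  have isn := dom _ ms (fun x => sin_max _).
  have Is : Rintegral mu setT (fun x => k x * sin (a * x)) = 0.
    have mks : measurable_fun [set: R] (fun x => k x * sin (a * x)) by exact: measurable_funM.
    have [_] := @integral_reflect R 0 _ mks isn.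
    have -> : (fun x => k (0 - x) * sin (a * (0 - x))) = (fun x => - 1 * (k x * sin (a * x))).
      by apply/funext => x; rewrite sub0r /k !mulrN fejer_even sinN mulrN mulN1r.
    by rewrite RintegralZl //; lra.
  have Ic : Rintegral mu setT (fun x => k x * cos (a * x)) = 0.
    (* k x * cos (a * x) is a second difference in a of (1 - cos (a * x)) / x ^+ 2,
       whose integral is linear in a as long as a stays positive. *)
    pose A (s x : R) : R := s ^+ 2 * fejer (s * x).
    have AE s x : 0 < s -> x != 0 -> A s x = (1 - cos (s * x)) / x ^+ 2.
      move=> s0 x0; have sn0 : s != 0 by rewrite gt_eqF.
      rewrite /A fejerE ?mulf_neq0 //; move: (cos _) => z.
      by field; rewrite sn0 x0.
    have iA s : 0 < s -> mu.-integrable setT (EFin \o A s).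
      by move=> s0; have [i _] := integral_fejer_scale s0; exact: (integrableZl measurableT (s ^+ 2) i).
    have EA s : 0 < s -> Rintegral mu setT (A s) = s * C.
      move=> s0; have [i E] := integral_fejer_scale s0.
      have sn0 : s != 0 by rewrite gt_eqF.
      rewrite /A (RintegralZl _ measurableT i) /Rintegral E /= -/C.
      by field.
    have p1 : 0 < a + L by lra.
    have p2 : 0 < a - L by lra.
    have E x : k x * cos (a * x) = (L * C)^-1 * (2^-1 * A (a + L) x + 2^-1 * A (a - L) x - A a x).
      have [->|x0] := eqVneq x 0.
        by rewrite /k /A !mulr0 fejer0 cos0; field; rewrite Ln0 Cn0.
      rewrite (AE (a + L)) // (AE (a - L)) // (AE a) // /k fejerE ?mulf_neq0 //.
      rewrite (mulrDl a L x) (mulrBl x a L) cosD cosB.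
      move: (cos _) (cos _) (sin _) (sin _) => z1 z2 z3 z4.
      by field; rewrite Ln0 Cn0 x0.
    under eq_Rintegral do rewrite E.
    have i1 : mu.-integrable setT (EFin \o (fun x => 2^-1 * A (a + L) x)).
      exact: (integrableZl measurableT 2^-1 (iA _ p1)).
    have i2 : mu.-integrable setT (EFin \o (fun x => 2^-1 * A (a - L) x)).
      exact: (integrableZl measurableT 2^-1 (iA _ p2)).
    have i12 : mu.-integrable setT (EFin \o (fun x => 2^-1 * A (a + L) x + 2^-1 * A (a - L) x)).
      exact: (integrableD measurableT i1 i2).
    have i3 : mu.-integrable setT (EFin \o (fun x => 2^-1 * A (a + L) x + 2^-1 * A (a - L) x - A a x)).
      exact: (integrableB measurableT i12 (iA _ a0)).
    have E1 : Rintegral mu setT (fun x => 2^-1 * A (a + L) x) = 2^-1 * ((a + L) * C).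
      by rewrite (RintegralZl _ measurableT (iA _ p1)) EA.
    have E2 : Rintegral mu setT (fun x => 2^-1 * A (a - L) x) = 2^-1 * ((a - L) * C).
      by rewrite (RintegralZl _ measurableT (iA _ p2)) EA.
    rewrite (RintegralZl _ measurableT i3) (RintegralB measurableT i12 (iA _ a0)).
    rewrite (RintegralD measurableT i1 i2) E1 E2 EA //.
    by field; rewrite Ln0 Cn0.
  have E x : k x * cos (a * x + c) = cos c * (k x * cos (a * x)) - sin c * (k x * sin (a * x)).
    by rewrite cosD; ring.
  under eq_Rintegral do rewrite -/(k _) E.
  rewrite RintegralB //; last 2 first.
  + exact: (integrableZl measurableT (cos c) ic).
  + exact: (integrableZl measurableT (sin c) isn).
  by rewrite !RintegralZl // Is Ic !mulr0 subr0.
Qed.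

End kernel.

(** * Compressed lines: separation on the left, small union on the right *)

Section kakeya.
Variables (R : realType) (n : nat).
Hypothesis n0 : (0 < n)%N.
Local Notation mu2 := (@leb2 R).

Definition node (k : nat) : R := 8^-1 * (1 - k%:R / n%:R).

(* For i = n this is a line of slope [slope j]; the k-th digit of j has no effect
   on its height over [node k], so that lines sharing their first i digits nearly
   meet around [node i]. *)
Definition line (i j : nat) (x : R) : R :=
  digit_sum i (fun k => node k - x) j + 2 * x.

Definition slope (j : nat) : R := 2 - digit_sum n (fun=> 1) j.

Lemma lineB (j : nat) (x y : R) : line n j x - line n j y = slope j * (x - y).
Proof.
have E z : digit_sum n (fun k => node k - z) j =
    digit_sum n node j + (- z) * digit_sum n (fun=> 1) j.
  by rewrite -digit_sumD; apply: eq_digit_sum => k; rewrite mulr1.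
by rewrite /line !E /slope; ring.
Qed.

Lemma slope_itv j : 1 <= slope j <= 2.
Proof.
have h0 : 0 <= digit_sum n (fun=> 1 : R) j by apply: digit_sum_ge0.
have h1 : digit_sum n (fun=> 1 : R) j <= 1 * (1 - 2^-1 ^+ n).
  by apply: digit_sum_upper => // k; rewrite lexx ler01.
have h2 : 0 <= 2^-1 ^+ n :> R by rewrite exprn_ge0 // invr_ge0.
by rewrite /slope; apply/andP; split; lra.
Qed.

Let nR0 : 0 < n%:R :> R. Proof. by rewrite ltr0n. Qed.

Lemma node_ge0 k : (k <= n)%N -> 0 <= node k.
Proof.
move=> kn; rewrite /node mulr_ge0 ?invr_ge0 // subr_ge0 ler_pdivrMr // mul1r ler_nat.
exact: kn.
Qed.

(** To the left of - 1/8 every term [node k - x] is at least 1/8 and they decrease in k, which is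
    the situation of [digit_sum_sep]. *)
Lemma line_sep j1 j2 (x : R) : (j1 < 2 ^ n)%N -> (j2 < 2 ^ n)%N -> j1 != j2 ->
  x <= - 8^-1 -> 8^-1 * 2^-1 ^+ n <= `|line n j1 x - line n j2 x|.
Proof.
move=> l1 l2 ne x8; rewrite /line opprD addrACA subrr addr0.
have n0' : 0 <= n%:R^-1 :> R by rewrite invr_ge0 ltW.
(* [digit_sum_sep] asks for bounds at all k, but nodes beyond n are negative; clamping the index at
   n changes no digit in use and keeps the sequence nonincreasing. *)
have E j : digit_sum n (fun k => node k - x) j = digit_sum n (fun k => node (minn k n) - x) j.
  by apply: eq_digit_sum => k kn; rewrite (minn_idPl (ltnW kn)).
rewrite !E; apply: digit_sum_sep => // k.
  have : 0 <= node (minn k n) by rewrite node_ge0 // geq_minr.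
  by lra.
rewrite lerD2r /node; apply: ler_wpM2l => //.
rewrite lerD2l lerN2; apply: ler_wpM2r => //.
by rewrite ler_nat leq_min geq_minr andbT (leq_trans (geq_minl _ _)).
Qed.

(** From a point over [0, 1/8] the tangency point lies t cos theta to the left, with 1 <= t <= 2 and
    2/5 <= cos theta <= 1, hence over [-2, -11/40]. The range [-3, -1/8] contains this with room for
    the whole arc. *)
Definition tube (w : R) (j : nat) : set (R * R) :=
  [set x | (- 3 <= x.1 <= - 8^-1) && (`|x.2 - line n j x.1| <= w)].

Definition core (w : R) (j : nat) : set (R * R) :=
  [set x | (0 <= x.1 <= 8^-1) && (`|x.2 - line n j x.1| <= w)].

(** The half-height is the error from forgetting the digits beyond i, which [digit_sum_le] bounds by
    2^-i times 2 / (8 n), plus the half-width w of the core itself. *)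
Definition strip (w : R) (i j : nat) : set (R * R) :=
  [set x | (node i.+1 <= x.1 <= node i) &&
           (`|x.2 - line i j x.1| <= 2^-1 ^+ i * (2 * (8^-1 / n%:R)) + w)].

Lemma continuous_digit_sum i j : continuous (fun x => digit_sum i (fun k => node k - x) j).
Proof.
have -> : (fun x => digit_sum i (fun k => node k - x) j) =
  (fun x => digit_sum i node j + (- x) * digit_sum i (fun=> 1) j).
  apply/funext => z; rewrite -digit_sumD; apply: eq_digit_sum => k; by rewrite mulr1.
move=> x; apply: cvgD; first exact: cvg_cst.
by apply: cvgM; [apply: cvgN; exact: cvg_id|exact: cvg_cst].
Qed.

Lemma measurable_line i j : measurable_fun [set: R] (line i j).
Proof.
apply: measurable_funD; last exact: measurable_funM.
by apply: continuous_measurable_fun; exact: continuous_digit_sum.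
Qed.

Lemma node_step k : node k - node k.+1 = 8^-1 / n%:R.
Proof. by rewrite /node -natr1; field; rewrite gt_eqF. Qed.

(* The first i digits fix the line up to 2^-i / n over the i-th interval,
   since there the remaining nodes are within (k + 1) / (8 n) of the point. *)
Lemma core_sub_strip w j (x : R * R) : core w j x ->
  exists i : 'I_n, strip w i (j %% 2 ^ i) x.
Proof.
move=> /andP[/andP[x0 x1] xl].
have [i /andP[i1 i2]] : exists i : 'I_n, node i.+1 <= x.1 <= node i.
  have H m : (m <= n)%N -> node m <= x.1 -> exists i : 'I_n, node i.+1 <= x.1 <= node i.
    elim: m => [_|m IH mn h].
      rewrite /node mul0r subr0 mulr1 => h.
      exists (Ordinal n0); rewrite /= /node mul0r subr0 mulr1 x1 andbT.
      apply: le_trans h.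
      have : 0 <= n%:R^-1 :> R by rewrite invr_ge0 ltW.
      by rewrite mul1r; lra.
    have [h2|h2] := leP (node m) x.1; first exact: IH (ltnW mn) h2.
    by exists (Ordinal mn); rewrite /= h ltW.
  by apply: (H n) => //; rewrite /node divff ?gt_eqF // subrr mulr0.
exists i; rewrite /strip /= i1 i2 /=.
have step0 : 0 <= 8^-1 / n%:R :> R by rewrite divr_ge0 ?invr_ge0 // ltW.
have E : line n j x.1 - line i (j %% 2 ^ i) x.1 =
    2^-1 ^+ i * digit_sum (n - i) (fun k => node (i + k) - x.1) (j %/ 2 ^ i).
  by rewrite /line -{1}(subnKC (ltnW (ltn_ord i))) digit_sum_prefix; ring.
have nodeE k : node (i + k) = node i - k%:R * (8^-1 / n%:R).
  by rewrite /node natrD; field; rewrite gt_eqF.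
have B : `|digit_sum (n - i) (fun k => node (i + k) - x.1) (j %/ 2 ^ i)| <= 8^-1 / n%:R + 8^-1 / n%:R.
  apply: digit_sum_le => // k; rewrite nodeE.
  have k0 : 0 <= k%:R * (8^-1 / n%:R) :> R by rewrite mulr_ge0.
  have := node_step i; move: i1 i2 => i1 i2 st.
  by rewrite ler_norml; apply/andP; split; lra.
have q0 : 0 <= 2^-1 ^+ i :> R by rewrite exprn_ge0 // invr_ge0.
have : `|x.2 - line i (j %% 2 ^ i) x.1| <= `|x.2 - line n j x.1| + `|line n j x.1 - line i (j %% 2 ^ i) x.1|.
  by apply: le_trans (ler_normD _ _); rewrite addrA subrK.
move=> /le_trans; apply; rewrite addrC; apply: lerD => //.
rewrite E normrM (ger0_norm q0); apply: ler_wpM2l => //.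
by apply: le_trans B _; rewrite mulr2n mulrDl mul1r.
Qed.

Definition strips (w : R) : set (R * R) :=
  \big[setU/set0]_(i < n) \big[setU/set0]_(j < 2 ^ i) strip w i j.

Lemma measurable_strip_set w i j : measurable (strip w i j).
Proof. by apply: measurable_strip; exact: measurable_line. Qed.

Lemma measurable_strips w : measurable (strips w).
Proof.
apply: bigsetU_measurable => i _; apply: bigsetU_measurable => j _.
exact: measurable_strip_set.
Qed.

Lemma core_sub_strips w j : core w j `<=` strips w.
Proof.
move=> x /core_sub_strip [i xi]; rewrite /strips.
rewrite -(bigcup_mkord n (fun i => \big[setU/set0]_(j < 2 ^ i) strip w i j)).
exists i => //=; rewrite -(bigcup_mkord _ (strip w i)).
by exists (j %% 2 ^ i)%N => //=; rewrite ltn_mod expn_gt0.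
Qed.

(** Level i has 2^i strips of length 1 / (8 n). Their heights proportional to 2^-i add up to area 1
    / (16 n^2), so to 1 / (16 n) over all n levels. The contributions of w form a geometric sum, at
    most 1 / (4 n) because w <= 2^-n. *)
Lemma measure_strips w : 0 <= w -> w <= 2^-1 ^+ n ->
  (mu2 (strips w) <= (n%:R^-1)%:E)%E.
Proof.
move=> w0 wn.
have step0 : 0 <= 8^-1 / n%:R :> R by rewrite divr_ge0 ?invr_ge0 // ltW.
pose h i : R := 2^-1 ^+ i * (2 * (8^-1 / n%:R)) + w.
have h0 i : 0 <= h i by rewrite addr_ge0 // mulr_ge0 ?exprn_ge0 ?invr_ge0 // mulr_ge0.
have S i (j : nat) : mu2 (strip w i j) = ((8^-1 / n%:R) * (2 * h i))%:E.
  rewrite /strip measure_strip; [by rewrite node_step|by rewrite -subr_ge0 node_step|exact: h0|exact: measurable_line].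
have S2 (i : nat) : (mu2 (\big[setU/set0]_(j < 2 ^ i) strip w i j) <= ((2 ^ i)%:R * ((8^-1 / n%:R) * (2 * h i)))%:E)%E.
  have := @content_subadditive _ _ _ mu2 (\big[setU/set0]_(j < 2 ^ i) strip w i j) (strip w i) (2 ^ i)%N.
  move=> /(_ (fun k _ => measurable_strip_set _ _ _) _ (fun x h => h)) H.
  apply: le_trans (H _) _.
    by apply: bigsetU_measurable => k _; exact: measurable_strip_set.
  rewrite (_ : \sum_(k < 2 ^ i) _ = \sum_(k < 2 ^ i) ((8^-1 / n%:R) * (2 * h i))%:E)%E; last first.
    by apply: eq_bigr => k _; exact: S.
  rewrite sumEFin lee_fin sumr_const card_ord.
  by rewrite -[leLHS]mulr_natl lexx.
apply: (@le_trans _ _ (\sum_(i < n) ((2 ^ i)%:R * ((8^-1 / n%:R) * (2 * h i)))%:E)%E).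
  have := @content_subadditive _ _ _ mu2 (strips w) (fun i => \big[setU/set0]_(j < 2 ^ i) strip w i j) n.
  move=> /(_ _ (measurable_strips w) (fun x h => h)) H.
  apply: le_trans (H _) _; last by apply: lee_sum => i _; exact: S2.
  by move=> k _; apply: bigsetU_measurable => j _; exact: measurable_strip_set.
rewrite sumEFin lee_fin.
have pw i : (2 ^ i)%:R * 2^-1 ^+ i = 1 :> R by rewrite natrX -exprMn mulfV // expr1n.
have H (i : 'I_n) : (2 ^ i)%:R * ((8^-1 / n%:R) * (2 * h i)) <= (8^-1 / n%:R) * (4 * (8^-1 / n%:R)) + (8^-1 / n%:R) * (2 * 2^-1 ^+ n) * (2 ^ i)%:R.
  have -> : (2 ^ i)%:R * ((8^-1 / n%:R) * (2 * h i)) = ((2 ^ i)%:R * 2^-1 ^+ i) * ((8^-1 / n%:R) * (4 * (8^-1 / n%:R))) + (8^-1 / n%:R) * (2 * w) * (2 ^ i)%:R.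
    by rewrite /h; move: (8^-1 / _) (2^-1 ^+ i) ((2 ^ i)%:R) => u v z; ring.
  rewrite pw mul1r lerD2l; apply: ler_wpM2r => //; apply: ler_wpM2l => //.
  by apply: ler_wpM2l.
apply: le_trans (ler_sum _ (fun i _ => H i)) _.
rewrite big_split /= sumr_const card_ord -mulr_sumr.
have geo m : \sum_(i < m) (2 ^ i)%:R <= (2 ^ m)%:R :> R.
  elim: m => [|m IH]; first by rewrite big_ord0.
  by rewrite big_ord_recr /= expnS natrM; lra.
have G : (8^-1 / n%:R) * (2 * 2^-1 ^+ n) * (\sum_(i < n) (2 ^ i)%:R) <= (8^-1 / n%:R) * 2 :> R.
  have := ler_wpM2l (_ : 0 <= (8^-1 / n%:R) * (2 * 2^-1 ^+ n) :> R) (geo n).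
  move=> /(_ _) /le_trans; apply; first by rewrite mulr_ge0 // mulr_ge0 // exprn_ge0 // invr_ge0.
  by rewrite -!mulrA (mulrC (2^-1 ^+ n)) pw mulr1.
have -> : ((8^-1 / n%:R) * (4 * (8^-1 / n%:R))) *+ n = 16^-1 / n%:R :> R.
  by rewrite -mulr_natr; field; rewrite gt_eqF.
have : 0 <= n%:R^-1 :> R by rewrite invr_ge0 ltW.
by lra.
Qed.

End kakeya.

(** * Continuous functions and test functions on the plane *)

Section plane_continuous.
Variable R : realType.

(** The sigma-algebra of [R * R] is the product one, so an open set is exhausted by the countably
    many boxes with rational corners that it contains. *)
Lemma open_measurable2 (O : set (R * R)) : open O -> measurable O.
Proof.
move=> oO.
pose B (q : (rat * rat) * (rat * rat)) : set (R * R) :=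
  `]ratr q.1.1, ratr q.1.2[%classic `*` `]ratr q.2.1, ratr q.2.2[%classic.
have mB q : measurable (B q) by apply: measurableX; exact: measurable_itv.
have -> : O = \bigcup_(q in [set q | B q `<=` O]) B q.
  apply/seteqP; split => [[x y] Oxy|z [q /= BO Bz]]; last exact: BO.
  have /nbhs_ballP[e /= e0 He] : nbhs (x, y) O by exact: open_nbhs_nbhs.
  have /rat_in_itvoo[a /itvP ha] : x - e < x by rewrite ltrBlDr ltrDl.
  have /rat_in_itvoo[b /itvP hb] : x < x + e by rewrite ltrDl.
  have /rat_in_itvoo[c /itvP hc] : y - e < y by rewrite ltrBlDr ltrDl.
  have /rat_in_itvoo[d /itvP hd] : y < y + e by rewrite ltrDl.
  exists ((a, b), (c, d)); last by split; rewrite /= in_itv /= ?ha ?hb ?hc ?hd.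
  move=> [u v] [/= hu hv]; rewrite !in_itv /= in hu hv.
  have a1 : x - e < ratr a by rewrite ha.
  have b1 : ratr b < x + e by rewrite hb.
  have c1 : y - e < ratr c by rewrite hc.
  have d1 : ratr d < y + e by rewrite hd.
  case/andP: hu => hu1 hu2; case/andP: hv => hv1 hv2.
  by apply: He; split; rewrite /ball /= ltr_norml; apply/andP; split; lra.
rewrite bigcup_mkcond; apply: countable_bigcupT_measurable => // q.
by case: ifP => // _; exact: measurable0.
Qed.

Lemma continuous_measurable_fun2 (f : R * R -> R) : continuous f ->
  measurable_fun [set: R * R] f.
Proof.
move=> /continuousP cf; apply: (measurability _ (RGenOpens.measurableE R)).
move=> _ [_ [a [b ->] <-]]; rewrite setTI; apply: open_measurable2.
exact/cf/interval_open.
Qed.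

Lemma continuous_bounded_box (f : R * R -> R) (M : R) : continuous f ->
  exists2 C, 0 <= C & forall x, `|x.1| <= M -> `|x.2| <= M -> `|f x| <= C.
Proof.
move=> cf.
have [M0|M0] := leP 0 M; last first.
  by exists 0 => // x h; have := normr_ge0 x.1; lra.
have cK : compact (`[- M, M]%classic `*` `[- M, M]%classic : set (R * R)).
  by apply: compact_setX; exact: segment_compact.
have /compact_bounded[N [_ HN]] : compact (f @` (`[- M, M]%classic `*` `[- M, M]%classic)).
  by apply: continuous_compact => //; exact: continuous_subspaceT.
exists (`|N| + 1); first by rewrite addr_ge0.
move=> x x1 x2; apply: (HN (`|N| + 1)); first by have := ler_norm N; lra.
by exists x => //; split; rewrite /= in_itv /= -ler_norml.
Qed.

Lemma test_integrable (lam : R) (phi : R * R -> R) : test_outside lam phi ->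
  (@leb2 R).-integrable setT (EFin \o phi).
Proof.
move=> [[D [D0 [cD _]]] [r [M [_ H0]]]].
have cphi : continuous phi by rewrite -D0.
have mphi := continuous_measurable_fun2 cphi.
have [C C0 HC] := continuous_bounded_box M cphi.
move: (M : R) (C : R) C0 HC H0 => {}M {}C C0 HC H0.
pose box := [set x : R * R | (- M <= x.1 <= M) && (`|x.2 - 0| <= M)].
have mbox : measurable box by apply: (@measurable_strip R (-M) M M (fun=> 0)).
have M2 : leb2 box \is a fin_num.
  have [M0|M0] := leP 0 M; first by rewrite (@measure_strip R (-M) M M (fun=> 0)) //; lra.
  rewrite (_ : box = set0); first by rewrite /leb2 measure0.
  by apply/seteqP; split => x //= /andP[/andP[h1 h2] _]; have := le_trans h1 h2; clear -M0; lra.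
have bi : (@leb2 R).-integrable setT (EFin \o (\1_box : R * R -> R)).
  apply/integrableP; split; first exact/measurable_EFinP/measurable_indic.
  under eq_integral do rewrite /= ger0_norm //.
  by rewrite integral_indic // setIT ltey_eq M2.
have gi : (@leb2 R).-integrable setT (EFin \o (fun x : R * R => C * \1_box x : R)).
  exact: (integrableZl measurableT C bi).
apply: (le_integrable _ _ _ gi) => //.
- exact/measurable_EFinP.
- move=> x _ /=; rewrite lee_fin indicE.
  have [/set_mem xb|/negP xb] := boolP (x \in box).
    rewrite mulr1 [leRHS]ger0_norm //; case/andP: xb => x1; rewrite subr0 => x2.
    by apply: HC => //; rewrite ler_norml.
  rewrite mulr0 normr0 H0 ?normr0 //; right.
  rewrite ltNge; apply/negP => xM; apply: xb; apply/mem_set.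
  have M0 : 0 <= M by apply: le_trans xM; exact: sqrtr_ge0.
  have sq : x.1 ^+ 2 + x.2 ^+ 2 <= M ^+ 2.
    by rewrite -(@ler_sqrt _ _ (M ^+ 2)) ?sqr_ge0 // sqrtr_sqr ger0_norm.
  have abs (u v : R) : u ^+ 2 + v ^+ 2 <= M ^+ 2 -> `|u| <= M.
    move=> h; rewrite -(ger0_norm M0) -ler_sqr ?nnegrE // !real_normK ?num_real //.
    by have := sqr_ge0 v; lra.
  rewrite /box /= subr0 -ler_norml (abs _ _ sq) /=.
  by apply: (abs _ x.1); rewrite addrC.
Qed.

End plane_continuous.

(** * Mollified indicators of plane sets *)

Section line_shift.
Variable R : realType.
Local Notation mu := (@lebesgue_measure R).

Lemma integral_shift (c : R) (f : R -> R) :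
  measurable_fun [set: R] f -> mu.-integrable setT (EFin \o f) ->
  mu.-integrable setT (EFin \o (fun x => f (x - c))) /\
  Rintegral mu setT (fun x => f (x - c)) = Rintegral mu setT f.
Proof.
move=> mf fi.
have mN : measurable_fun [set: R] (fun x => f (0 - x)).
  by apply: measurableT_comp mf _; exact: measurable_funB.
have [iN EN] := @integral_reflect R 0 _ mf fi.
have [i E] := @integral_reflect R c _ mN iN.
have H : (fun x => f (0 - (c - x))) = (fun x => f (x - c)).
  by apply/funext => x; congr f; ring.
by rewrite H in i E; split=> //; rewrite E.
Qed.

End line_shift.

Section mollify.
Variables (R : realType) (C L : R) (k : R -> R).
Hypothesis kP : bandlimited_kernel C L k.
Local Notation mu := (@lebesgue_measure R).
Local Notation mu2 := (@leb2 R).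

(** A tensor product has its spectrum in the square of half-side L, so a frequency with a single
    coordinate beyond L is already annihilated. *)
Definition kernel2 (z : R * R) : R := k z.1 * k z.2.

Definition mollify (T : set (R * R)) (x : R * R) : R :=
  Rintegral mu2 setT (fun z => kernel2 z * \1_T (x.1 - z.1, x.2 - z.2)).

Let mk : measurable_fun [set: R] k := kernel_measurable kP.

Lemma kernel2_ge0 z : 0 <= kernel2 z.
Proof. by rewrite mulr_ge0 // (kernel_ge0 kP). Qed.

Lemma measurable_kernel2 : measurable_fun [set: R * R] kernel2.
Proof. by apply: measurable_funM; exact: measurableT_comp mk _. Qed.

Lemma measurable_reflect2 (x : R * R) :
  measurable_fun [set: R * R] (fun z : R * R => (x.1 - z.1, x.2 - z.2)).
Proof. by apply: measurable_fun_pair; exact: measurable_funB. Qed.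

Lemma kernel2_mass : (\int[mu2]_z (kernel2 z)%:E = 1)%E.
Proof.
rewrite leb2_tonelli; last 2 first.
- by apply/measurable_EFinP; exact: measurable_kernel2.
- by move=> z; rewrite lee_fin kernel2_ge0.
under eq_integral => x _.
  rewrite (_ : (\int[mu]_y (kernel2 (x, y))%:E)%E = (k x)%:E); last first.
    rewrite /kernel2 /=; under eq_integral do rewrite EFinM.
    rewrite ge0_integralZl //; first by rewrite (kernel_mass kP) mule1.
    + exact/measurable_EFinP.
    + by move=> y _; rewrite lee_fin (kernel_ge0 kP).
    + by rewrite lee_fin (kernel_ge0 kP).
  over.
exact: kernel_mass kP.
Qed.

Lemma kernel2_integrable : mu2.-integrable setT (EFin \o kernel2).
Proof.
apply/integrableP; split; first by apply/measurable_EFinP; exact: measurable_kernel2.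
under eq_integral do rewrite /= ger0_norm ?kernel2_ge0 //.
by rewrite kernel2_mass ltry.
Qed.

Lemma kernel2_mass_shift (y : R * R) :
  (\int[mu2]_x (kernel2 (x.1 - y.1, x.2 - y.2))%:E = 1)%E.
Proof.
pose g (z : R * R) := (kernel2 (0 - z.1, 0 - z.2))%:E.
have mg : measurable_fun [set: R * R] g.
  apply/measurable_EFinP; apply: measurableT_comp measurable_kernel2 _.
  exact: (measurable_reflect2 (0, 0)).
have g0 z : (0 <= g z)%E by rewrite lee_fin kernel2_ge0.
have := ge0_integral_reflect2 y mg g0.
have mK : measurable_fun [set: R * R] (EFin \o kernel2).
  by apply/measurable_EFinP; exact: measurable_kernel2.
have K0 z : (0 <= (EFin \o kernel2) z)%E by rewrite lee_fin kernel2_ge0.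
have := ge0_integral_reflect2 (0, 0) mK K0.
rewrite /= kernel2_mass /g => -> <-.
by apply: eq_integral => x _ /=; congr (kernel2 (_, _))%:E; ring.
Qed.

Section mollify_set.
Variables (T : set (R * R)) (mT : measurable T).

Let mind : measurable_fun [set: R * R] (\1_T : R * R -> R).
Proof. exact: measurable_indic. Qed.

Lemma mollify_integrand_integrable x :
  mu2.-integrable setT (EFin \o (fun z => kernel2 z * \1_T (x.1 - z.1, x.2 - z.2))).
Proof.
apply: (le_integrable _ _ _ kernel2_integrable) => //.
  apply/measurable_EFinP; apply: measurable_funM; first exact: measurable_kernel2.
  by apply: measurableT_comp mind _; exact: measurable_reflect2.
move=> z _ /=; rewrite lee_fin normrM -[leRHS]mulr1; apply: ler_wpM2l => //.
by rewrite indicE; case: (_ \in _); rewrite ?normr1 ?normr0.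
Qed.

Lemma EFin_mollify x :
  (mollify T x)%:E = (\int[mu2]_z (kernel2 z * \1_T (x.1 - z.1, x.2 - z.2))%:E)%E.
Proof.
rewrite /mollify /Rintegral fineK //.
exact: (integrable_fin_num measurableT (mollify_integrand_integrable x)).
Qed.

Lemma mollifyE x :
  (mollify T x)%:E = (\int[mu2]_y (\1_T y * kernel2 (x.1 - y.1, x.2 - y.2))%:E)%E.
Proof.
rewrite EFin_mollify.
have mg : measurable_fun [set: R * R] (fun z => (kernel2 z * \1_T (x.1 - z.1, x.2 - z.2))%:E).
  by have /measurable_int := mollify_integrand_integrable x.
have g0 z : (0 <= (kernel2 z * \1_T (x.1 - z.1, x.2 - z.2))%:E)%E.
  by rewrite lee_fin mulr_ge0 ?kernel2_ge0 // indicE.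
rewrite -(ge0_integral_reflect2 x mg g0); apply: eq_integral => y _ /=.
rewrite mulrC; congr (\1_T _ * _)%:E.
by case: y => y1 y2 /=; congr (_, _); ring.
Qed.

Lemma mollify_ge0 x : 0 <= mollify T x.
Proof. by apply: Rintegral_ge0 => z _; rewrite mulr_ge0 ?kernel2_ge0 // indicE. Qed.

Lemma measurable_mollify : measurable_fun [set: R * R] (mollify T).
Proof.
pose K (w : (R * R) * (R * R)) : R := kernel2 w.2 * \1_T (w.1.1 - w.2.1, w.1.2 - w.2.2).
apply: (@measurable_Rintegral_section _ _ _ _ R mu2 K).
apply: measurable_funM.
  by apply: measurableT_comp measurable_kernel2 _; exact: measurable_snd.
apply: measurableT_comp mind _.
by apply: measurable_fun_pair; apply: measurable_funB;
  [exact: measurableT_comp measurable_fst measurable_fst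
  |exact: measurableT_comp measurable_fst measurable_snd
  |exact: measurableT_comp measurable_snd measurable_fst
  |exact: measurableT_comp measurable_snd measurable_snd].
Qed.

Let Kj (w : (R * R) * (R * R)) : R := \1_T w.2 * kernel2 (w.1.1 - w.2.1, w.1.2 - w.2.2).

Let measurable_Kj : measurable_fun [set: (R * R) * (R * R)] Kj.
Proof.
apply: measurable_funM; first exact: measurableT_comp mind measurable_snd.
apply: measurableT_comp measurable_kernel2 _.
by apply: measurable_fun_pair; apply: measurable_funB;
  [exact: measurableT_comp measurable_fst measurable_fst
  |exact: measurableT_comp measurable_fst measurable_snd
  |exact: measurableT_comp measurable_snd measurable_fst
  |exact: measurableT_comp measurable_snd measurable_snd].
Qed.

Let Kj_ge0 w : (0 <= (Kj w)%:E)%E.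
Proof. by rewrite lee_fin mulr_ge0 ?kernel2_ge0 // indicE. Qed.

Lemma integral_mollify : (\int[mu2]_x (mollify T x)%:E = mu2 T)%E.
Proof.
transitivity (\int[mu2]_x \int[mu2]_y (Kj (x, y))%:E)%E.
  by apply: eq_integral => x _; rewrite mollifyE.
rewrite (@fubini_tonelli _ _ _ _ R mu2 mu2 (EFin \o Kj)) //; last exact/measurable_EFinP.
transitivity (\int[mu2]_y (\1_T y)%:E)%E; last by rewrite integral_indic // setIT.
apply: eq_integral => y _; rewrite /Kj /=.
under eq_integral do rewrite EFinM.
rewrite ge0_integralZl //.
- by rewrite kernel2_mass_shift mule1.
- apply/measurable_EFinP; apply: measurableT_comp measurable_kernel2 _.
  by apply: measurable_fun_pair; apply: measurable_funB.
- by move=> x _; rewrite lee_fin kernel2_ge0.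
Qed.

Hypothesis Tfin : (mu2 T < +oo)%E.

Lemma mollify_integrable : mu2.-integrable setT (EFin \o mollify T).
Proof.
apply/integrableP; split; first by apply/measurable_EFinP; exact: measurable_mollify.
under eq_integral do rewrite /= ger0_norm ?mollify_ge0 //.
by rewrite integral_mollify.
Qed.

(** With the convolution written as an integral over y in T, Fubini puts the x-integral inside. For
    fixed y it is a product integral of two translated kernels, and the coordinate whose frequency
    exceeds L makes it vanish. *)
Lemma mollify_spectrum (a : R * R) (c : R) : L < `|a.1| \/ L < `|a.2| ->
  Rintegral mu2 setT (fun x => mollify T x * cos (a.1 * x.1 + a.2 * x.2 + c)) = 0.
Proof.
move=> La.
have mcos : measurable_fun [set: R] (@cos R).
  by apply: continuous_measurable_fun; exact: continuous_cos.
have point (y : R * R) : Rintegral mu2 setT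
    (fun x => kernel2 (x.1 - y.1, x.2 - y.2) * cos (a.1 * x.1 + a.2 * x.2 + c)) = 0.
  have ks y1 := integral_shift y1 mk (kernel_integrable kP).
  have mcc : measurable_fun [set: R * R] (fun x : R * R => cos (a.1 * x.1 + a.2 * x.2 + c)).
    apply: measurableT_comp mcos _; apply: measurable_funD => //.
    by apply: measurable_funD; exact: measurable_funM.
  have cc1 (x : R * R) : `|cos (a.1 * x.1 + a.2 * x.2 + c)| <= 1 by exact: cos_max.
  have H := integrable_bounded_kernel (ks y.1).1 (ks y.2).1 mcc cc1.
  have E : Rintegral mu2 setT (fun x => kernel2 (x.1 - y.1, x.2 - y.2) * cos (a.1 * x.1 + a.2 * x.2 + c)) =
     Rintegral mu setT (fun x1 => k (x1 - y.1) * Rintegral mu setT (fun x2 => k (x2 - y.2) * cos (a.1 * x1 + a.2 * x2 + c))).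
    rewrite /Rintegral (leb2_fubini H).
    congr fine; apply: eq_integral => x1 _ /=.
    have i2 : mu.-integrable setT (EFin \o (fun x2 => k (x2 - y.2) * cos (a.1 * x1 + a.2 * x2 + c))).
      apply: (le_integrable _ _ _ (ks y.2).1) => //.
        apply/measurable_EFinP; apply: measurable_funM; first by apply: measurableT_comp mk _; exact: measurable_funB.
        by apply: measurableT_comp mcos _; apply: measurable_funD => //; apply: measurable_funD => //; exact: measurable_funM.
      by move=> x2 _ /=; rewrite lee_fin normrM -[leRHS]mulr1; apply: ler_wpM2l => //; exact: cos_max.
    rewrite EFinM fineK; last exact: (integrable_fin_num measurableT i2).
    rewrite -[RHS](integralZl measurableT i2).
    by apply: eq_integral => x2 _ /=; rewrite -EFinM mulrA.
  have one (a0 c0 y0 : R) : L < `|a0| -> Rintegral mu setT (fun u => k (u - y0) * cos (a0 * u + c0)) = 0.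
    move=> La0.
    have mg : measurable_fun [set: R] (fun u => k u * cos (a0 * (u + y0) + c0)).
      apply: measurable_funM => //; apply: measurableT_comp mcos _.
      by apply: measurable_funD => //; apply: measurable_funM => //; exact: measurable_funD.
    have ig : mu.-integrable setT (EFin \o (fun u => k u * cos (a0 * (u + y0) + c0))).
      apply: (le_integrable _ _ _ (kernel_integrable kP)) => //; first exact/measurable_EFinP.
      move=> u _ /=; rewrite lee_fin normrM -[leRHS]mulr1; apply: ler_wpM2l => //.
      exact: cos_max.
    have [_] := integral_shift y0 mg ig.
    under eq_Rintegral do rewrite subrK.
    move=> ->; under eq_Rintegral do rewrite mulrDr -addrA.
    exact: kernel_spectrum kP _ _ La0.
  (* In [E] the inner variable is the second one; when the first frequency is the large one, the
     order of integration is exchanged. *)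
  case: La => La.
    rewrite E (fubini_bounded_kernel (ks y.1).1 (ks y.2).1 mcc cc1).
    rewrite (_ : (fun _ => _) = (fun=> 0)); first by rewrite Rintegral_cst // mul0r.
    apply/funext => x2 /=; rewrite -[RHS](mulr0 (k (x2 - y.2))); congr (_ * _).
    under eq_Rintegral do rewrite -addrA.
    exact: one.
  rewrite E (_ : (fun _ => _) = (fun=> 0)); first by rewrite Rintegral_cst // mul0r.
  apply/funext => x1 /=; rewrite -[RHS](mulr0 (k (x1 - y.1))); congr (_ * _).
  under eq_Rintegral do rewrite addrAC addrC.
  exact: one.
pose cc (x : R * R) := cos (a.1 * x.1 + a.2 * x.2 + c).
have mcc : measurable_fun [set: R * R] cc.
  apply: measurableT_comp mcos _; apply: measurable_funD => //.
  by apply: measurable_funD; exact: measurable_funM.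
pose H (w : (R * R) * (R * R)) := Kj w * cc w.1.
have iK : (mu2 \x mu2)%E.-integrable setT (EFin \o Kj).
  apply/integrable12ltyP; first exact/measurable_EFinP.
  rewrite (_ : (\int[mu2]_x _)%E = mu2 T) //; rewrite -integral_mollify.
  apply: eq_integral => x _; rewrite mollifyE; apply: eq_integral => y _ /=.
  by rewrite ger0_norm // -lee_fin Kj_ge0.
have iH : (mu2 \x mu2)%E.-integrable setT (EFin \o H).
  apply: (le_integrable _ _ _ iK) => //.
    apply/measurable_EFinP; apply: measurable_funM => //.
    exact: measurableT_comp mcc measurable_fst.
  by move=> w _ /=; rewrite lee_fin normrM -[leRHS]mulr1; apply: ler_wpM2l => //; exact: cos_max.
have F := Fubini iH.
transitivity (fine (\int[mu2]_x \int[mu2]_y (H (x, y))%:E)%E).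
  rewrite /Rintegral; congr fine; apply: eq_integral => x _.
  rewrite EFinM mollifyE muleC.
  have ix : mu2.-integrable setT (EFin \o (fun y => Kj (x, y))).
    apply/integrableP; split; first by apply/measurable_EFinP; exact: measurableT_comp measurable_Kj _.
    under eq_integral do rewrite /= ger0_norm -?lee_fin ?Kj_ge0 //.
    by rewrite /Kj -mollifyE ltry.
  rewrite -(integralZl measurableT ix).
  by apply: eq_integral => y _ /=; rewrite -EFinM mulrC.
rewrite F (_ : (\int[mu2]_y _)%E = 0%E) //.
rewrite -[RHS](@integral0 _ _ _ mu2 setT); apply: eq_integral => y _ /=.
have iy : mu2.-integrable setT (EFin \o (fun x => kernel2 (x.1 - y.1, x.2 - y.2) * cc x)).
  have i0 : mu2.-integrable setT (EFin \o (fun x => kernel2 (x.1 - y.1, x.2 - y.2))).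
    apply/integrableP; split.
      apply/measurable_EFinP; apply: measurableT_comp measurable_kernel2 _.
      by apply: measurable_fun_pair; apply: measurable_funB.
    under eq_integral do rewrite /= ger0_norm ?kernel2_ge0 //.
    by rewrite kernel2_mass_shift ltry.
  apply: (le_integrable _ _ _ i0) => //.
    apply/measurable_EFinP; apply: measurable_funM => //.
    by apply/measurable_EFinP; case/integrableP: i0.
  by move=> x _ /=; rewrite lee_fin normrM -[leRHS]mulr1; apply: ler_wpM2l => //; exact: cos_max.
transitivity ((\1_T y)%:E * \int[mu2]_x (kernel2 (x.1 - y.1, x.2 - y.2) * cc x)%:E)%E.
  rewrite -[RHS](integralZl measurableT iy).
  apply: eq_integral => x _.
  by rewrite [RHS]/= -EFinM /H /Kj; congr (_%:E); rewrite /= -mulrA.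
have := point y; rewrite /Rintegral => P.
by rewrite -[X in (_ * X)%E]fineK ?P ?mule0 //; exact: (integrable_fin_num measurableT iy).
Qed.

End mollify_set.

End mollify.

Section bounded_kernel_outer.
Context d1 d2 (T1 : measurableType d1) (T2 : measurableType d2) (R : realType).
Variables (m1 : {sigma_finite_measure set T1 -> \bar R})
  (m2 : {sigma_finite_measure set T2 -> \bar R}).

Lemma integrable_bounded_kernel_outer (f : T1 -> R) (g : T2 -> R) (k : T1 * T2 -> R) :
  m1.-integrable setT (EFin \o f) -> m2.-integrable setT (EFin \o g) ->
  measurable_fun setT k -> (forall z, `|k z| <= 1) ->
  m1.-integrable setT (EFin \o (fun x => f x * Rintegral m2 setT (fun y => g y * k (x, y)))).
Proof.
move=> fi gi mk k1.
have iF := integrable_fubini_F (integrable_bounded_kernel fi gi mk k1).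
apply: (eq_integrable measurableT _ _ _ iF) => x _.
have gki : m2.-integrable setT (EFin \o (fun y => g y * k (x, y))).
  apply: (le_integrable _ _ _ gi) => //.
    apply/measurable_EFinP/measurable_funM; first by apply/measurable_EFinP; case/integrableP: gi.
    exact: measurableT_comp mk _.
  by move=> y _ /=; rewrite lee_fin normrM -[leRHS]mulr1; exact: ler_wpM2l.
rewrite /= EFinM fineK; last exact: (integrable_fin_num measurableT gki).
rewrite /fubini_F -[RHS](integralZl measurableT gki).
by apply: eq_integral => y _ /=; rewrite -EFinM mulrA.
Qed.

End bounded_kernel_outer.

Section mollify_continuous.
Variables (R : realType) (C L : R) (k : R -> R).
Hypothesis kP : bandlimited_kernel C L k.
Local Notation mu2 := (@leb2 R).

Lemma lipschitz_continuous2 (D : R) (f : R * R -> R) :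
  (forall x y, `|f x - f y| <= D * (`|x.1 - y.1| + `|x.2 - y.2|)) -> continuous f.
Proof.
move=> H x; apply/cvgrPdist_le => e e0.
have cg : (fun y : R * R => D * (`|x.1 - y.1| + `|x.2 - y.2|)) y @[y --> x] --> D * (`|x.1 - x.1| + `|x.2 - x.2|).
  apply: cvgM; first exact: cvg_cst.
  by apply: cvgD; apply: cvg_norm; apply: cvgB; [exact: cvg_cst|exact: cvg_fst|exact: cvg_cst|exact: cvg_snd].
rewrite !subrr normr0 addr0 mulr0 in cg.
move/cvgr0_norm_le : cg => /(_ e e0); apply: filterS => y yh.
by apply: le_trans (H x y) _; apply: le_trans yh; exact: ler_norm.
Qed.

(** The kernel is bounded and Lipschitz and T has finite measure, so the convolution is Lipschitz.
    Membership in [in_E] demands continuity. *)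
Lemma continuous_mollify (T : set (R * R)) : measurable T -> (mu2 T < +oo)%E ->
  continuous (mollify k T).
Proof.
move=> mT Tfin; have [M M0 lip] := kernel_lipschitz kP; have [B B0 bd] := kernel_bounded kP.
have k0 := kernel_ge0 kP.
have mk := measurable_kernel2 kP.
pose h (x : R * R) (y : R * R) : R := \1_T y * kernel2 k (x.1 - y.1, x.2 - y.2).
have mi : mu2.-integrable setT (EFin \o (\1_T : R * R -> R)).
  apply/integrableP; split; first by apply/measurable_EFinP; exact: measurable_indic.
  rewrite (_ : (\int[mu2]_x _)%E = mu2 T) //.
  by rewrite -[in RHS](setIT T) -integral_indic //; apply: eq_integral => y _; rewrite /= ger0_norm // indicE.
have mh x : measurable_fun [set: R * R] (h x).
  apply: measurable_funM; first exact: measurable_indic.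
  by apply: measurableT_comp mk _; apply: measurable_fun_pair; apply: measurable_funB.
have hi x : mu2.-integrable setT (EFin \o h x).
  apply: (le_integrable _ _ _ (integrableZl measurableT (B * B) mi)) => //; first by apply/measurable_EFinP; exact: mh.
  move=> y _ /=; rewrite lee_fin /h normrM (normrM (B * B)) mulrC; apply: ler_wpM2r => //.
  rewrite /kernel2 /= !ger0_norm ?mulr_ge0 //; exact: ler_pM.
have E x : mollify k T x = Rintegral mu2 setT (h x).
  have := mollifyE kP mT x; rewrite /Rintegral => H.
  have := integrable_fin_num measurableT (hi x) => /fineK.
  by rewrite -[X in _ = X]H => -[].
have k2lip u v : `|kernel2 k u - kernel2 k v| <= B * M * (`|u.1 - v.1| + `|u.2 - v.2|).
  rewrite /kernel2 (_ : k u.1 * k u.2 - k v.1 * k v.2 = (k u.1 - k v.1) * k u.2 + k v.1 * (k u.2 - k v.2)); last by ring.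
  apply: le_trans (ler_normD _ _) _; rewrite [leRHS]mulrDr (normrM (k u.1 - _)) (normrM (k v.1)).
  apply: lerD.
    rewrite mulrC -mulrA; apply: ler_pM => //; by rewrite ger0_norm.
  by rewrite -mulrA; apply: ler_pM => //; rewrite ger0_norm.
apply: (@lipschitz_continuous2 (B * M * fine (mu2 T))) => x y.
rewrite !E -(RintegralB measurableT (hi x) (hi y)).
have iB := integrableB measurableT (hi x) (hi y).
apply: le_trans (le_normr_Rintegral measurableT iB) _.
pose e := B * M * (`|x.1 - y.1| + `|x.2 - y.2|).
have -> : B * M * fine (mu2 T) * (`|x.1 - y.1| + `|x.2 - y.2|) = Rintegral mu2 setT (fun z => e * \1_T z).
  rewrite (RintegralZl _ measurableT mi) /Rintegral integral_indic // setIT /e.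
  by ring.
apply: le_Rintegral => //.
- apply: (le_integrable _ _ _ iB) => //; last by move=> z _ /=; rewrite normr_id.
  apply/measurable_EFinP; apply: (measurableT_comp (@normr_measurable R setT)).
  exact: measurable_funB (mh x) (mh y).
- exact: (integrableZl measurableT e mi).
move=> z _; rewrite /h -mulrBr normrM mulrC.
rewrite (@ger0_norm _ (\1_T z)) ?indicE //; apply: ler_wpM2r => //.
apply: le_trans (k2lip _ _) _; rewrite /e /=.
by rewrite !opprB !addrA !subrK.
Qed.

(** At each point at most one of the disjoint indicators is 1, and averaging against a probability
    density keeps their sum below 1. This replaces the disjointness of supports that is lost in
    mollifying. *)
Lemma sum_mollify_le1 (N : nat) (T : nat -> set (R * R)) :
  (forall j, measurable (T j)) ->
  (forall i j, (i < N)%N -> (j < N)%N -> i != j -> T i `&` T j = set0) ->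
  forall x, \sum_(j < N) mollify k (T j) x <= 1.
Proof.
move=> mT dT x.
have mK := measurable_kernel2 kP.
have K0 := kernel2_ge0 kP.
have m1 j : measurable_fun [set: R * R] (fun z => kernel2 k z * \1_(T j) (x.1 - z.1, x.2 - z.2)).
  apply: measurable_funM => //.
  apply: measurableT_comp; first exact: measurable_indic.
  by apply: measurable_fun_pair; apply: measurable_funB.
rewrite -lee_fin -sumEFin.
under eq_bigr do rewrite (EFin_mollify kP) //.
rewrite -ge0_integral_sum //; last 2 first.
- by move=> j; apply/measurable_EFinP; exact: m1.
- by move=> j z _; rewrite lee_fin mulr_ge0 // indicE.
rewrite -(kernel2_mass kP); apply: ge0_le_integral_nomeas => z.
  by rewrite sumEFin lee_fin sumr_ge0 // => j _; rewrite mulr_ge0 // indicE.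
rewrite sumEFin lee_fin -mulr_sumr -[leRHS]mulr1; apply: ler_wpM2l => //.
set u := (_, _).
have [[i Ti]|nT] := pselect (exists i : 'I_N, T i u); last first.
  rewrite big1 // => j _; rewrite indicE memNset // => Tj.
  by apply: nT; exists j.
rewrite (bigD1 i) //= big1 ?addr0; first by rewrite indicE; case: (_ \in _).
move=> j ji; rewrite indicE memNset // => Tj.
have : (T i `&` T j) u by [].
by rewrite dT // eq_sym.
Qed.

End mollify_continuous.

(** * Sums of wave packets: size and spectrum *)

Section wave_packets.
Variables (R : realType) (N : nat).
Variables (chi : nat -> R * R -> R) (e : nat -> R) (a : nat -> R * R).
Local Notation mu2 := (@leb2 R).
Hypothesis chi_cont : forall j, continuous (chi j).
Hypothesis chi_ge0 : forall j x, 0 <= chi j x.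
Hypothesis e1 : forall j, `|e j| = 1.

(** The cosine and sine versions are the real and imaginary parts of the function. With the factor
    1/2 each part is at most half the sum of the cutoffs, so the modulus stays below that sum. *)
Definition packets (trig : R -> R) (x : R * R) : R :=
  \sum_(j < N) e j * (2^-1 * chi j x * trig (dot2 (a j) x)).

Lemma continuous_phase (trig : R -> R) (b : R * R) : continuous trig ->
  continuous (fun x => trig (dot2 b x)).
Proof.
move=> ct x; apply: continuous_comp; last exact: ct.
by apply: cvgD; apply: cvgM; [exact: cvg_cst|exact: cvg_fst|exact: cvg_cst|exact: cvg_snd].
Qed.

Lemma continuous_packet j (trig : R -> R) : continuous trig ->
  continuous (fun x => 2^-1 * chi j x * trig (dot2 (a j) x)).
Proof.
move=> ct x; apply: cvgM; last exact: continuous_phase.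
by apply: cvgM; [exact: cvg_cst|exact: chi_cont].
Qed.

Lemma continuous_packets (trig : R -> R) : continuous trig -> continuous (packets trig).
Proof.
move=> ct x; rewrite /packets; apply: cvg_big => [|j _]; first exact: add_continuous.
by apply: cvgM; [exact: cvg_cst|exact: continuous_packet].
Qed.

(** The modulus is at most s, the sum of the cutoffs, and s <= 1. Hence its p-th power is at most
    the modulus itself, thus at most s, whose integral is at most 1. *)
Lemma LpN_packets (p : R) : 1 <= p ->
  (forall x, \sum_(j < N) chi j x <= 1) ->
  (\sum_(j < N) \int[mu2]_x (chi j x)%:E <= 1)%E ->
  (LpN p (packets (@cos R), packets (@sin R)) <= 1)%E.
Proof.
move=> p1 s1 i1; rewrite /LpN unlock /Lnorm.
have p0 : 0 < p by exact: lt_le_trans p1.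
rewrite -[leRHS](poweR1r p^-1).
apply: (@gt0_ler_poweR _ p^-1); first by rewrite invr_ge0 ltW.
- by rewrite in_itv /= leey andbT; apply: integral_ge0.
- by rewrite in_itv /= leey andbT.
apply: le_trans i1; rewrite -ge0_integral_sum //; last 2 first.
- by move=> j; apply/measurable_EFinP; exact: continuous_measurable_fun2.
- by move=> j x _; rewrite lee_fin.
apply: ge0_le_integral_nomeas => x; first exact: poweR_ge0.
rewrite sumEFin abse_EFin poweR_EFin lee_fin ger0_norm ?sqrtr_ge0 //.
set s := \sum_(j < N) chi j x.
have s0 : 0 <= s by exact: sumr_ge0.
have B (trig : R -> R) : (forall u, `|trig u| <= 1) -> `|packets trig x| <= 2^-1 * s.
  move=> t1; rewrite mulr_sumr; apply: le_trans (ler_norm_sum _ _ _) _; apply: ler_sum => j _.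
  rewrite !normrM e1 mul1r (ger0_norm (chi_ge0 _ _)) ger0_norm ?invr_ge0 //.
  by rewrite -[leRHS]mulr1; apply: ler_wpM2l; [rewrite mulr_ge0 ?invr_ge0|].
have Bc := B _ (@cos_max R); have Bs := B _ (@sin_max R).
have cs : cmod2 (packets (@cos R), packets (@sin R)) x <= s.
  rewrite /cmod2 /= -[leRHS](ger0_norm s0) -sqrtr_sqr ler_wsqrtr //.
  move: Bc Bs; rewrite !ler_norml => /andP[b1 b2] /andP[b3 b4].
  move: (packets cos x) (packets sin x) b1 b2 b3 b4 => u v b1 b2 b3 b4.
  have : u ^+ 2 <= (2^-1 * s) ^+ 2 by rewrite -subr_ge0 subr_sqr mulr_ge0 //; lra.
  have : v ^+ 2 <= (2^-1 * s) ^+ 2 by rewrite -subr_ge0 subr_sqr mulr_ge0 //; lra.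
  have : 0 <= s ^+ 2 by exact: sqr_ge0.
  lra.
apply: le_trans (_ : cmod2 (packets (@cos R), packets (@sin R)) x `^ 1 <= _); last by rewrite powRr1 ?sqrtr_ge0.
have c0 : 0 <= cmod2 (packets (@cos R), packets (@sin R)) x by exact: sqrtr_ge0.
have [->|cn0] := eqVneq (cmod2 (packets (@cos R), packets (@sin R)) x) 0.
  by rewrite !powR0 // ?gt_eqF.
apply: ger_powR => //; rewrite lt_def cn0 c0 /=; exact: le_trans cs (s1 x).
Qed.

Hypothesis chi_int : forall j, mu2.-integrable setT (EFin \o chi j).

(** The shift c treats both parts of the complex pairing together: c = 0 gives the real part and c =
    - pi/2 the imaginary part. *)
Lemma pairing_phase (b : R * R) (c : R) (phi : R * R -> R) (x : R * R) :
  mu2.-integrable setT (EFin \o phi) ->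
  cos (dot2 b x + c) * FTc phi x + sin (dot2 b x + c) * FTs phi x =
  Rintegral mu2 setT (fun xi => phi xi * cos ((b.1 - xi.1) * x.1 + (b.2 - xi.2) * x.2 + c)).
Proof.
move=> ip.
have it (trig : R -> R) : continuous trig -> (forall u, `|trig u| <= 1) ->
    mu2.-integrable setT (EFin \o (fun xi => phi xi * trig (dot2 x xi))).
  move=> ct t1; apply: (le_integrable _ _ _ ip) => //.
    apply/measurable_EFinP/measurable_funM; first by apply/measurable_EFinP; case/integrableP: ip.
    apply: continuous_measurable_fun2; exact: continuous_phase.
  by move=> z _ /=; rewrite lee_fin normrM -[leRHS]mulr1; exact: ler_wpM2l.
have ic := it _ (@continuous_cos R) (@cos_max R).
have is' := it _ (@continuous_sin R) (@sin_max R).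
rewrite /FTc /FTs -(RintegralZl _ measurableT ic) -(RintegralZl _ measurableT is').
rewrite -(RintegralD measurableT (integrableZl measurableT _ ic) (integrableZl measurableT _ is')).
apply: eq_Rintegral => xi _.
have -> : (b.1 - xi.1) * x.1 + (b.2 - xi.2) * x.2 + c = (dot2 b x + c) - dot2 x xi by rewrite /dot2; ring.
by rewrite cosB; ring.
Qed.

(** After Fubini the inner integral is the Fourier integral of the cutoff at the frequency of the
    packet minus xi. It vanishes wherever phi may be nonzero, since there |xi| > lam. *)
Lemma pairing_packet (lam : R) (phi : R * R -> R) j (c : R) :
  test_outside lam phi ->
  (forall (xi : R * R) c', lam < norm2 xi ->
    Rintegral mu2 setT (fun x => chi j x * cos ((a j).1 * x.1 - xi.1 * x.1 + ((a j).2 - xi.2) * x.2 + c')) = 0) ->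
  mu2.-integrable setT (EFin \o (fun x => chi j x *
    (cos (dot2 (a j) x + c) * FTc phi x + sin (dot2 (a j) x + c) * FTs phi x))) /\
  (\int[mu2]_x (chi j x *
    (cos (dot2 (a j) x + c) * FTc phi x + sin (dot2 (a j) x + c) * FTs phi x))%:E = 0)%E.
Proof.
move=> tphi spec; have ip := test_integrable tphi.
pose K (z : (R * R) * (R * R)) := cos (((a j).1 - z.2.1) * z.1.1 + ((a j).2 - z.2.2) * z.1.2 + c).
have mK : measurable_fun [set: (R * R) * (R * R)] K.
  apply: measurableT_comp; first by apply: continuous_measurable_fun; exact: continuous_cos.
  have m11 : measurable_fun [set: (R * R) * (R * R)] (fun z => z.1.1) by exact: measurableT_comp measurable_fst measurable_fst.
  have m12 : measurable_fun [set: (R * R) * (R * R)] (fun z => z.1.2) by exact: measurableT_comp measurable_snd measurable_fst.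
  have m21 : measurable_fun [set: (R * R) * (R * R)] (fun z => z.2.1) by exact: measurableT_comp measurable_fst measurable_snd.
  have m22 : measurable_fun [set: (R * R) * (R * R)] (fun z => z.2.2) by exact: measurableT_comp measurable_snd measurable_snd.
  apply: measurable_funD => //.
  by apply: measurable_funD; apply: measurable_funM => //; exact: measurable_funB.
have K1 z : `|K z| <= 1 by exact: cos_max.
have E : (fun x => chi j x *
    (cos (dot2 (a j) x + c) * FTc phi x + sin (dot2 (a j) x + c) * FTs phi x)) =
  (fun x => chi j x * Rintegral mu2 setT (fun xi => phi xi * K (x, xi))).
  by apply/funext => x; rewrite pairing_phase.
have I := integrable_bounded_kernel_outer (chi_int j) ip mK K1.
have EF : EFin \o (fun x => chi j x *
    (cos (dot2 (a j) x + c) * FTc phi x + sin (dot2 (a j) x + c) * FTs phi x)) =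
  EFin \o (fun x => chi j x * Rintegral mu2 setT (fun xi => phi xi * K (x, xi))) by rewrite E.
rewrite EF; split; first exact: I.
under eq_integral => x _.
  rewrite (_ : (chi j x * _)%:E = (EFin \o (fun x => chi j x * Rintegral mu2 setT (fun xi => phi xi * K (x, xi)))) x); last by rewrite -EF.
  over.
rewrite -(fineK (integrable_fin_num measurableT I)).
have F := fubini_bounded_kernel (chi_int j) ip mK K1.
rewrite /Rintegral in F; rewrite F; congr (_%:E).
rewrite (_ : (\int[mu2]_x _)%E = 0%E) //.
rewrite -[RHS](@integral0 _ _ _ mu2 setT); apply: eq_integral => xi _.
have [r [M [lr H0]]] := tphi.2.
have [xr|xr] := ltP (norm2 xi) r; first by rewrite H0 ?mul0r //; left.
have := spec xi c (lt_le_trans lr xr); rewrite /Rintegral => S.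
rewrite (_ : (\int[mu2]_x (chi j x * K (x, xi))%:E)%E = (\int[mu2]_x (chi j x * cos ((a j).1 * x.1 - xi.1 * x.1 + ((a j).2 - xi.2) * x.2 + c))%:E)%E).
  by rewrite S mulr0.
by apply: eq_integral => x _; rewrite /K /= mulrBl.
Qed.

Lemma in_E_packets (lam : R) :
  (forall j (xi : R * R) c, lam < norm2 xi ->
    Rintegral mu2 setT (fun x => chi j x * cos ((a j).1 * x.1 - xi.1 * x.1 + ((a j).2 - xi.2) * x.2 + c)) = 0) ->
  in_E lam (packets (@cos R), packets (@sin R)).
Proof.
move=> spec; split; first by apply: continuous_packets; exact: continuous_cos.
split; first by apply: continuous_packets; exact: continuous_sin.
move=> phi tphi.
pose g c j x := chi j x * (cos (dot2 (a j) x + c) * FTc phi x + sin (dot2 (a j) x + c) * FTs phi x).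
have P c j := pairing_packet c tphi (spec j).
have Z c (h : R * R -> R) : (forall x, h x = \sum_(j < N) (e j * 2^-1) * g c j x) -> (\int[mu2]_x (h x)%:E = 0)%E.
  move=> hE.
  under eq_integral => x _ do rewrite hE -sumEFin.
  rewrite integral_sum //; last by move=> j; exact: (integrableZl measurableT _ (P c j).1).
  rewrite big1 // => j _.
  have := integralZl measurableT (P c j).1 (e j * 2^-1) => /=.
  by rewrite (P c j).2 mule0 => H; rewrite -[RHS]H; apply: eq_integral => x _; rewrite EFinM.
split.
  apply: (Z 0) => x; rewrite /packets !mulr_suml -big_split /=; apply: eq_bigr => j _.
  by rewrite /g addr0; ring.
apply: (Z (- (pi / 2))) => x; rewrite /packets !mulr_suml -sumrB; apply: eq_bigr => j _.
rewrite /g sinB cosB sin_pihalf cos_pihalf; ring.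
Qed.

End wave_packets.

(** * Circles meeting a tube *)

Section arc.
Variables (R : realType) (theta slp : R).
Hypotheses (th_itv : - (pi / 2) < theta < pi / 2) (slp_itv : 1 <= slp <= 2)
  (th_slope : sin theta = slp * cos theta).

(** From (1 + slp^2) (cos theta)^2 = 1 and slp <= 2 the cosine is at least 5^(-1/2); 2/5 is a
    rational value below it. *)
Lemma cos_theta_ge : 2 / 5 <= cos theta.
Proof.
have c0 : 0 < cos theta by exact: cos_gt0_pihalf.
have := cos2Dsin2 theta; rewrite th_slope => H.
move: slp_itv => /andP[s1 s2]; have : (slp * cos theta) ^+ 2 <= (2 * cos theta) ^+ 2.
  by rewrite !exprMn ler_wpM2r ?sqr_ge0 // ler_sqr ?nnegrE //; lra.
by move=> H2; rewrite leNgt; apply/negP => c1; nra.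
Qed.

Lemma sin_theta_ge : 2^-1 <= sin theta.
Proof.
have c0 := cos_theta_ge; move: slp_itv => /andP[s1 s2].
have sc : cos theta <= sin theta by rewrite th_slope ler_peMl //; lra.
have := cos2Dsin2 theta; rewrite leNgt => H; apply/negP => c1; nra.
Qed.

Lemma ler_sin_pihalf (x y : R) : - (pi / 2) <= x -> x <= y -> y <= pi / 2 -> sin x <= sin y.
Proof.
move=> x1 xy y1; have [->//|ne] := eqVneq x y.
apply: ltW; rewrite ltr_sin ?in_itv /=; first by rewrite lt_neqAle ne xy.
- by rewrite x1 (le_trans xy).
- by rewrite y1 andbT (le_trans x1).
Qed.

Lemma ler_sin_pihalfV (x y : R) : - (pi / 2) <= x <= pi / 2 -> - (pi / 2) <= y <= pi / 2 ->
  sin x <= sin y -> x <= y.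
Proof.
move=> hx hy h; rewrite leNgt; apply/negP => yx.
by move: h; rewrite leNgt ltr_sin ?in_itv //= yx.
Qed.

Lemma theta_ge0 : 0 <= theta.
Proof.
rewrite leNgt; apply/negP => t0.
have : sin theta <= sin 0 by apply: ler_sin_pihalf; have := pi_ge0 R; move: th_itv => /andP[]; lra.
by have := sin_theta_ge; rewrite sin0; lra.
Qed.

Lemma asin_small (b : R) : 0 <= b <= 4^-1 ->
  [/\ b <= asin b, asin b <= pi / 2, asin b <= theta & sin (asin b) = b].
Proof.
move=> /andP[b0 b1].
have b11 : -1 <= b <= 1 by apply/andP; split; lra.
have [/andP[h1 h2] h3] := asin_def b11.
move: th_itv => /andP[t1 t2]; have t0 := theta_ge0; have p0 := pi_ge2 R.
split=> //.
  rewrite -[leLHS]h3; apply: sin_le.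
  by apply: ler_sin_pihalfV; rewrite ?sin0 ?h3 ?h1 ?h2 //; apply/andP; split; lra.
apply: ler_sin_pihalfV; rewrite ?h3 ?h1 ?h2 //; first by apply/andP; split; lra.
by have := sin_theta_ge; lra.
Qed.

Variables (l : R -> R) (w v t : R) (u : R * R).
Hypotheses (lB : forall x y, l x - l y = slp * (x - y)) (w0 : 0 < w) (w1 : w <= 64^-1)
  (v1 : `|v| <= w / 2) (t1 : 1 <= t <= 2) (uv : u.2 = l u.1 + v)
  (u1 : - 64^-1 <= u.1 <= 8^-1 + 64^-1).

Let S a := sin (a - theta).
Let b1 := (w - v) * cos theta / t.
Let b2 := (w + v) * cos theta / t.

Let in_tube a :=
  (- 3 <= u.1 - t * cos a <= - 8^-1) && (`|(u.2 - t * sin a) - l (u.1 - t * cos a)| <= w).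

(** Since theta is the direction of the line, the height of the point of the circle above the line
    is v - t sin(a - theta) / cos theta. The tube thus cuts out a window for S. *)
Let heightE a : (`|(u.2 - t * sin a) - l (u.1 - t * cos a)| <= w) = (- b1 <= S a <= b2).
Proof.
have c0 := cos_theta_ge; move: t1 => /andP[t1' t2].
have tp : 0 < t by lra.
have cp : 0 < cos theta by lra.
have -> : (u.2 - t * sin a) - l (u.1 - t * cos a) = v - t * S a / cos theta.
  have -> : l (u.1 - t * cos a) = l u.1 - slp * (t * cos a).
    by have := lB (u.1 - t * cos a) u.1; lra.
  rewrite uv /S sinB th_slope; field; rewrite gt_eqF //; lra.
have -> : (- b1 <= S a) = (v * cos theta - w * cos theta <= t * S a).
  by rewrite lerNl ler_pdivlMr // mulNr (mulrC (S a)) mulrBl; apply/idP/idP; lra.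
have -> : (S a <= b2) = (t * S a <= w * cos theta + v * cos theta).
  by rewrite ler_pdivlMr // (mulrC (S a)) mulrDl.
have e x : (x <= t * S a / cos theta) = (x * cos theta <= t * S a) by rewrite ler_pdivlMr.
have f x : (t * S a / cos theta <= x) = (t * S a <= x * cos theta) by rewrite ler_pdivrMr.
rewrite -mulrBl -mulrDl -e -f ler_norml.
by apply/andP/andP => -[h1 h2]; split; lra.
Qed.

Let b_itv : (w / 10 <= b1 <= 40^-1) * (w / 10 <= b2 <= 40^-1).
Proof.
have c0 := cos_theta_ge; have cl := cos_le1 theta; move: t1 v1 => /andP[t1' t2].
rewrite ler_norml => /andP[v2 v3].
have tp : 0 < t by lra.
have A (x : R) : w / 2 <= x -> x <= w * 3 / 2 -> w / 10 <= x * cos theta / t <= 40^-1.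
  move=> x1 x2; rewrite ler_pdivlMr // ler_pdivrMr //; apply/andP; split.
    have : w / 10 * t <= w / 10 * 2 by apply: ler_wpM2l => //; lra.
    have : w / 2 * (2 / 5) <= x * cos theta by apply: ler_pM => //; lra.
    lra.
  have : x * cos theta <= x * 1 by apply: ler_wpM2l => //; lra.
  by have := w1; lra.
by split; apply: A; lra.
Qed.

Let cosE a : cos a = cos (a - theta) * cos theta - S a * sin theta.
Proof. by rewrite /S -cosD subrK. Qed.

(** The circle crosses the line at two opposite places. At the one with cos(a - theta) <= 0, cos a
    is at most 1/40, so the point stays to the right of - 1/8 and misses the tube. *)
Let far a : cos (a - theta) <= 0 -> - b1 <= S a <= b2 -> - 8^-1 < u.1 - t * cos a.
Proof.
move=> ca /andP[s1 s2]; have := cosE a; have c0 := cos_theta_ge.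
have := sin_theta_ge; have := sin_le1 theta; move: t1 u1 b_itv => /andP[t1' t2] /andP[u11 u12] [/andP[_ b11] /andP[_ b21]].
move=> h1 h2 h3.
have : cos a <= 40^-1 by rewrite h3; nra.
by move=> h4; nra.
Qed.

Let near_ a : 0 <= cos (a - theta) -> - b1 <= S a <= b2 -> - 3 <= u.1 - t * cos a <= - 8^-1.
Proof.
move=> ca /andP[s1 s2]; have cE := cosE a; have c0 := cos_theta_ge.
have h2 := sin_theta_ge; have h1 := sin_le1 theta.
move: t1 u1 b_itv => /andP[t1' t2] /andP[u11 u12] [/andP[_ b11] /andP[_ b21]].
have cl := cos_le1 a; have cl2 := cos_le1 (a - theta).
have P := cos2Dsin2 (a - theta); rewrite -/(S a) in P.
have S2 : S a ^+ 2 <= 1 / 100 by nra.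
have C9 : 99 / 100 <= cos (a - theta) by nra.
have : 1 / 3 <= cos a by rewrite cE; nra.
move=> C3; apply/andP; split; nra.
Qed.

(** Exactly one arc about theta survives, with ends given by arcsines of the window. Its
    half-lengths are at least (w/2)(2/5)/2 = w/10. Because theta is bounded away from 0, the arc
    does not wrap around the origin of angles. *)
Lemma arc_tube : exists be1 be2 : R,
  [/\ w / 10 <= be1 <= pi / 2, w / 10 <= be2 <= pi / 2, 0 <= theta - be1, theta + be2 <= 2 * pi &
   forall a, 0 <= a <= 2 * pi -> in_tube a = (theta - be1 <= a <= theta + be2)].
Proof.
have [/andP[b11 b12] /andP[b21 b22]] := b_itv.
have w10 : 0 <= w / 10 by rewrite divr_ge0 // ltW.
have small x : w / 10 <= x -> x <= 40^-1 -> 0 <= x <= 4^-1.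
  by move=> x1 x2; apply/andP; split; lra.
have [p1 p2 p3 p4] := asin_small (small _ b11 b12).
have [q1 q2 q3 q4] := asin_small (small _ b21 b22).
move: th_itv => /andP[th1 th2]; have th0 := theta_ge0; have pi2 := pi_ge2 R.
exists (asin b1), (asin b2); split; try lra.
move=> a /andP[a0 a2]; rewrite /in_tube heightE.
apply/idP/idP.
  move=> /andP[/andP[y1 y2] hS].
  have ca : 0 < cos (a - theta).
    by rewrite ltNge; apply/negP => ca; have := far ca hS; lra.
  move/andP: hS => [s1 s2].
  (* Up to pi/2 the sine is monotone and can be inverted; between pi/2 and 3 pi/2 the cosine is not
     positive; beyond, a <= 2 pi forces S a <= - sin theta <= - 1/2, outside the window. *)
  have [h|h] := leP (a - theta) (pi / 2).
    have i1 : - (pi / 2) <= a - theta <= pi / 2 by apply/andP; split; lra.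
    have : - asin b1 <= a - theta.
      by apply: ler_sin_pihalfV; rewrite ?sinN ?p4 //; apply/andP; split; lra.
    have : a - theta <= asin b2.
      by apply: ler_sin_pihalfV; rewrite ?q4 //; apply/andP; split; lra.
    by move=> h1 h2; apply/andP; split; lra.
  have [h2|h2] := leP (a - theta) (3 * (pi / 2)).
    have : 0 <= cos (a - theta - pi) by apply: cos_ge0_pihalf; apply/andP; split; lra.
    by rewrite cosB cospi sinpi; lra.
  have : sin (a - theta - 2 * pi) <= sin (- theta) by apply: ler_sin_pihalf; lra.
  rewrite sinN; have -> : a - theta - 2 * pi = (a - theta) - pi *+ 2 by rewrite mulr2n; ring.
  rewrite sinB cos2pi sin2pi -/(S a); have := sin_theta_ge; lra.
move=> /andP[h1 h2].
have s1 : - b1 <= S a.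
  by rewrite -p4 -sinN; apply: ler_sin_pihalf; lra.
have s2 : S a <= b2.
  by rewrite -q4; apply: ler_sin_pihalf; lra.
rewrite s1 s2 /= andbT; apply: near_; last by rewrite s1 s2.
by apply: cos_ge0_pihalf; apply/andP; split; lra.
Qed.

End arc.

(** * Circular means of a packet *)

Section kernel2_tail.
Variables (R : realType) (C L : R) (k : R -> R).
Hypothesis kP : bandlimited_kernel C L k.
Local Notation mu := (@lebesgue_measure R).
Local Notation mu2 := (@leb2 R).

(** A majorant of the indicator of the complement of a square, taken as a sum so that its mass
    splits into two one-dimensional kernel tails. *)
Definition far2 (r : R) (z : R * R) : R := (r < `|z.1|)%R%:R + (r < `|z.2|)%R%:R.

Lemma measurable_far1 (r : R) : measurable_fun [set: R] (fun x : R => (r < `|x|)%R%:R : R).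
Proof.
rewrite (_ : (fun x => _) = \1_[set x | r < `|x|]); last first.
  apply/funext => x; rewrite indicE; case: (boolP (r < `|x|)) => h; first by rewrite mem_set.
  by rewrite memNset //; exact/negP.
apply: measurable_indic.
rewrite -[X in measurable X]setTI.
have -> : [set x : R | r < `|x|] = (fun x : R => `|x|) @^-1` `]r, +oo[.
  by apply/seteqP; split => x /=; rewrite in_itv /= andbT.
exact: (@normr_measurable R setT).
Qed.

Lemma measurable_far2 r : measurable_fun [set: R * R] (far2 r).
Proof.
apply: measurable_funD.
  exact: measurableT_comp (measurable_far1 r) measurable_fst.
exact: measurableT_comp (measurable_far1 r) measurable_snd.
Qed.

Lemma far2_ge0 r z : 0 <= far2 r z. Proof. by rewrite addr_ge0. Qed.

Lemma far2_le2 r z : far2 r z <= 2.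
Proof. by rewrite /far2; case: (_ < _); case: (_ < _) => /=; lra. Qed.

Lemma kernel2_far2_integrable r :
  mu2.-integrable setT (EFin \o (fun z => kernel2 k z * far2 r z)).
Proof.
apply: (le_integrable _ _ _ (integrableZl measurableT 2 (kernel2_integrable kP))) => //.
  apply/measurable_EFinP/measurable_funM; first exact: measurable_kernel2 kP.
  exact: measurable_far2.
move=> z _; have K0 := kernel2_ge0 kP z; have F0 := far2_ge0 r z.
rewrite /= lee_fin (ger0_norm (mulr_ge0 K0 F0)) (ger0_norm (mulr_ge0 _ K0)) // mulrC.
by apply: ler_wpM2r => //; exact: far2_le2.
Qed.

Lemma kernel2_tail (r : R) : 0 < r ->
  Rintegral mu2 setT (fun z => kernel2 k z * far2 r z) <= 2 * (C / (L * r)).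
Proof.
move=> r0; have k0 := kernel_ge0 kP; have mk := kernel_measurable kP.
have tail := kernel_tail kP r0.
have mt : measurable_fun [set: R] (fun x => (k x * (r < `|x|)%R%:R)%:E).
  by apply/measurable_EFinP/measurable_funM => //; exact: measurable_far1.
have m1 : measurable_fun [set: R * R] (fun z : R * R => (kernel2 k z * (r < `|z.1|)%R%:R)%:E).
  apply/measurable_EFinP/measurable_funM; first exact: measurable_kernel2 kP.
  exact: measurableT_comp (measurable_far1 r) measurable_fst.
have m2 : measurable_fun [set: R * R] (fun z : R * R => (kernel2 k z * (r < `|z.2|)%R%:R)%:E).
  apply/measurable_EFinP/measurable_funM; first exact: measurable_kernel2 kP.
  exact: measurableT_comp (measurable_far1 r) measurable_snd.
have p1 z : (0 <= (kernel2 k z * (r < `|z.1|)%R%:R)%:E)%E.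
  by rewrite lee_fin mulr_ge0 // (kernel2_ge0 kP).
have p2 z : (0 <= (kernel2 k z * (r < `|z.2|)%R%:R)%:E)%E.
  by rewrite lee_fin mulr_ge0 // (kernel2_ge0 kP).
have T1 : (\int[mu2]_z (kernel2 k z * (r < `|z.1|)%R%:R)%:E <= (C / (L * r))%:E)%E.
  apply: le_trans tail; rewrite leb2_tonelli // le_eqVlt; apply/orP; left; apply/eqP.
  apply: eq_integral => x _ /=.
  rewrite /kernel2 /=; under eq_integral do rewrite mulrAC EFinM.
  rewrite ge0_integralZl //.
  - by rewrite (kernel_mass kP) mule1.
  - exact/measurable_EFinP.
  - by move=> y _; rewrite lee_fin.
  - by rewrite lee_fin mulr_ge0.
have T2 : (\int[mu2]_z (kernel2 k z * (r < `|z.2|)%R%:R)%:E <= (C / (L * r))%:E)%E.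
  apply: le_trans tail; rewrite leb2_tonelli // -[leRHS]mul1e -(kernel_mass kP).
  rewrite -ge0_integralZr //; last 3 first.
  - exact/measurable_EFinP.
  - by move=> y _; rewrite lee_fin.
  - by apply: integral_ge0 => x _; rewrite lee_fin mulr_ge0.
  rewrite le_eqVlt; apply/orP; left; apply/eqP.
  apply: eq_integral => x _ /=.
  rewrite /kernel2 /=; under eq_integral do rewrite -mulrA EFinM.
  rewrite ge0_integralZl //.
  - by move=> y _; rewrite lee_fin mulr_ge0.
  - by rewrite lee_fin.
rewrite -lee_fin /Rintegral fineK; last exact: (integrable_fin_num measurableT (kernel2_far2_integrable r)).
under eq_integral do rewrite /far2 mulrDr EFinD.
rewrite ge0_integralD //; apply: le_trans (leeD T1 T2) _.
by rewrite -EFinD lee_fin; lra.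
Qed.

End kernel2_tail.

Section arc_integral.
Variables (R : realType).
Local Notation mu := (@lebesgue_measure R).

Lemma measurable_chirp (K : R) : measurable_fun [set: R] (chirp K).
Proof. by apply: continuous_measurable_fun; exact: continuous_chirp. Qed.

Lemma Rintegral_patch_itv (i : interval R) (f : R -> R) :
  continuous f -> mu.-integrable [set` i] (EFin \o f) ->
  measurable_fun [set: R] (f \_ [set` i]) /\ mu.-integrable setT (EFin \o (f \_ [set` i])).
Proof.
move=> cf fi; split.
  apply/(measurable_restrictT _ _).1 => //.
  by apply: measurable_funTS; exact: continuous_measurable_fun.
rewrite -restrict_EFin; exact/(integrable_mkcond _ _).1.
Qed.

Lemma integral_chirp_arc (K m th b1 b2 : R) : 0 <= b1 -> 0 <= b2 ->
  m <= Rintegral mu `[0, b1] (chirp K) -> m <= Rintegral mu `[0, b2] (chirp K) ->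
  2 * m <= Rintegral mu `[th - b1, th + b2] (fun a => chirp K (a - th)).
Proof.
move=> b10 b20 h1 h2.
have ic (a b : R) := integrable_chirp K a b.
have cc := @continuous_chirp R K.
have [mg ig] := Rintegral_patch_itv cc (ic (- b1) b2).
have [_ E] := integral_shift th mg ig.
have -> : Rintegral mu `[th - b1, th + b2] (fun a => chirp K (a - th)) = Rintegral mu `[- b1, b2] (chirp K).
  rewrite Rintegral_mkcond [RHS]Rintegral_mkcond -E; congr (Rintegral _ _ _).
  apply/funext => a; rewrite !patchE.
  have -> : (a \in [set` `[th - b1, th + b2]]) = (a - th \in [set` `[- b1, b2]]); last by [].
  by rewrite !mem_setE !in_itv /=; apply/idP/idP; lra.
have U : [set` `[- b1, b2]] = [set` `[- b1, 0[] `|` [set` `[0, b2]].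
  by apply/seteqP; split => a /=; rewrite !in_itv /=; [case: (ltP a 0) => ? ?; [left|right]|case]; lra.
have iL : mu.-integrable [set` `[- b1, 0[] (EFin \o chirp K).
  by apply: integrableS (ic (- b1) b2) => //; rewrite U; exact: subsetUl.
rewrite U Rintegral_setU //; last 2 first.
- by rewrite -U; exact: ic.
- rewrite disj_set2E; apply/eqP/seteqP; split => a //=; rewrite !in_itv /=.
  by move=> [/andP[_ a0] /andP[a1 _]]; lra.
have [mL iL'] := Rintegral_patch_itv cc iL.
have [_ E2] := @integral_reflect R 0 _ mL iL'.
have -> : Rintegral mu [set` `[- b1, 0[] (chirp K) = Rintegral mu [set` `[0, b1]] (chirp K).
  rewrite -(@Rintegral_itv_obnd_cbnd R 0 (BRight b1) (chirp K)); last first.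
    by apply: integrableS (ic 0 b1) => //; apply: subset_itvr; rewrite bnd_simp.
  rewrite Rintegral_mkcond [RHS]Rintegral_mkcond -E2; congr (Rintegral _ _ _).
  apply/funext => a; rewrite !patchE sub0r chirpN.
  have -> : (- a \in [set` `[- b1, 0[]) = (a \in [set` `]0, b1]]); last by [].
  by rewrite !mem_setE !in_itv /=; apply/idP/idP; lra.
lra.
Qed.

End arc_integral.

Section packet_lower.
Variables (R : realType).
Local Notation mu := (@lebesgue_measure R).
Local Notation mu2 := (@leb2 R).

(* A component of the circular mean of a packet over the circle of radius t
   about x, after rotation by the phase of the packet at the point of the circle
   in the direction - (cos th, sin th). *)
Definition packet_mean (chi : R * R -> R) (K th t : R) (x : R * R) : R :=
  Rintegral mu `[0, 2 * pi]
    (fun a => chi (x.1 - t * cos a, x.2 - t * sin a) * chirp K (a - th)).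

Section mollified.
Variables (C L : R) (k : R -> R).
Hypothesis kP : bandlimited_kernel C L k.
Variables (T : set (R * R)) (mT : measurable T).
Variables (K th t : R) (x : R * R).

Let Kj (w : R * (R * R)) : R :=
  \1_T (x.1 - w.2.1 - t * cos w.1, x.2 - w.2.2 - t * sin w.1) * chirp K (w.1 - th).

Let mKj : measurable_fun [set: R * (R * R)] Kj.
Proof.
have mc (trig : R -> R) : continuous trig -> measurable_fun [set: R * (R * R)] (fun w => t * trig w.1).
  move=> ct; apply: measurable_funM => //.
  by apply: measurableT_comp; [exact: continuous_measurable_fun|exact: measurable_fst].
have m2 (f : R * R -> R) : measurable_fun [set: R * R] f -> measurable_fun [set: R * (R * R)] (fun w : R * (R * R) => f w.2).
  by move=> mf; exact: measurableT_comp mf measurable_snd.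
apply: measurable_funM.
  apply: (measurableT_comp (_ : measurable_fun [set: R * R] (\1_T : R * R -> R))).
    exact: measurable_indic.
  apply: measurable_fun_pair.
    apply: measurable_funB; last exact: mc (@continuous_cos R).
    by apply: measurable_funB => //; exact: m2 measurable_fst.
  apply: measurable_funB; last exact: mc (@continuous_sin R).
  by apply: measurable_funB => //; exact: m2 measurable_snd.
apply: (measurableT_comp (measurable_chirp K)).
by apply: measurable_funB => //; exact: measurable_fst.
Qed.

Let Kj1 w : `|Kj w| <= 1.
Proof.
rewrite /Kj normrM -[leRHS]mulr1; apply: ler_pM => //; last exact: sin_max.
by rewrite indicE; case: (_ \in _); rewrite ?normr1 ?normr0.
Qed.

Let ind (a : R) : R := \1_[set` `[0, 2 * pi]] a.

Let mu_turn : mu [set` `[0, 2 * pi]] = (2 * pi)%:E.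
Proof.
have p0 : 0 <= 2 * pi :> R by rewrite mulr_ge0 // pi_ge0.
rewrite lebesgue_measure_itv /= lte_fin; case: ltP => [_|h].
  by rewrite -EFinB subr0.
by congr (_%:E); apply/eqP; rewrite eq_le h p0.
Qed.

Let ind_int : mu.-integrable setT (EFin \o ind).
Proof.
have p0 : 0 <= 2 * pi :> R by rewrite mulr_ge0 // pi_ge0.
apply/integrableP; split; first by apply/measurable_EFinP; exact: measurable_indic.
under eq_integral do rewrite /= ger0_norm ?indicE //.
rewrite integral_indic // setIT.
by rewrite [X in (X < _)%E](_ : _ = (2 * pi)%:E) ?ltry //; exact: mu_turn.
Qed.

(** The mean for the sharp indicator of T with the centre displaced by z. Averaging it against
    [kernel2] gives the mean for the mollified cutoff, so the geometry of arcs is needed only for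
    sharp tubes. *)
Definition arc_mean (z : R * R) : R :=
  Rintegral mu setT (fun a => ind a * Kj (a, z)).

Lemma packet_mean_mollify :
  packet_mean (mollify k T) K th t x = Rintegral mu2 setT (fun z => kernel2 k z * arc_mean z).
Proof.
have Ki := kernel2_integrable kP.
rewrite /arc_mean -(fubini_bounded_kernel ind_int Ki mKj Kj1).
rewrite /packet_mean Rintegral_mkcond; congr (Rintegral _ _ _); apply/funext => a.
rewrite patchE /ind indicE; case: (_ \in _); last by rewrite mul0r.
rewrite mul1r mulrC /mollify.
have i0 := mollify_integrand_integrable kP mT (x.1 - t * cos a, x.2 - t * sin a).
rewrite -(RintegralZl _ measurableT i0); congr (Rintegral _ _ _); apply/funext => z.
rewrite /Kj /= mulrCA; congr (_ * _); rewrite mulrC; congr (\1_T _ * _).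
by congr (_, _); ring.
Qed.

Lemma arc_mean_integrable : mu2.-integrable setT (EFin \o (fun z => kernel2 k z * arc_mean z)).
Proof.
have mKj' : measurable_fun [set: (R * R) * R] (fun w => Kj (w.2, w.1)).
  apply: (measurableT_comp mKj).
  by apply: measurable_fun_pair; [exact: measurable_snd|exact: measurable_fst].
exact: (integrable_bounded_kernel_outer (kernel2_integrable kP) ind_int mKj' (fun w => Kj1 _)).
Qed.

Lemma norm_arc_mean z : `|arc_mean z| <= 2 * pi.
Proof.
have p0 : 0 <= 2 * pi :> R by rewrite mulr_ge0 // pi_ge0.
have i0 : mu.-integrable setT (EFin \o (fun a => ind a * Kj (a, z))).
  apply: (le_integrable _ _ _ ind_int) => //.
    apply/measurable_EFinP/measurable_funM; first exact: measurable_indic.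
    exact: measurableT_comp mKj _.
  by move=> a _ /=; rewrite lee_fin normrM -[leRHS]mulr1; exact: ler_wpM2l.
apply: le_trans (le_normr_Rintegral measurableT i0) _.
have -> : 2 * pi = Rintegral mu setT ind.
  rewrite /Rintegral integral_indic // setIT.
  by rewrite [X in fine X](_ : _ = (2 * pi)%:E) //; exact: mu_turn.
apply: le_Rintegral => //; last 1 first.
- move=> a _; rewrite normrM -[leRHS]mulr1; apply: ler_pM => //.
  by rewrite ger0_norm // /ind indicE.
- apply: (le_integrable _ _ _ i0) => //; last by move=> a _ /=; rewrite normr_id.
  apply/measurable_EFinP; apply: (measurableT_comp (@normr_measurable R setT)).
  by apply/measurable_EFinP; case/integrableP: i0.
Qed.

Lemma arc_mean_arc z (p q : R) :
  0 <= p -> q <= 2 * pi ->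
  (forall a, 0 <= a <= 2 * pi ->
    T (x.1 - z.1 - t * cos a, x.2 - z.2 - t * sin a) <-> p <= a <= q) ->
  arc_mean z = Rintegral mu `[p, q] (fun a => chirp K (a - th)).
Proof.
move=> p0 q0 H; rewrite [RHS]Rintegral_mkcond; congr (Rintegral _ _ _).
apply/funext => a; rewrite patchE mem_setE in_itv /= /ind /Kj indicE mem_setE in_itv /=.
have [h|h] := boolP (0 <= a <= 2 * pi).
  rewrite mul1r indicE /=; have [h2|h2] := boolP (p <= a <= q).
    by rewrite mem_set ?mul1r //; exact/(H _ h).
  by rewrite memNset ?mul0r // => /(H _ h) h3; rewrite h3 in h2.
rewrite mul0r; case: ifPn => // h2; case/negP: h; lra.
Qed.

(* Outside the ball of radius r the trivial bound |arc_mean| <= 2 pi is paid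
   for by the tail of the kernel. *)
Lemma packet_mean_ge (m r : R) : 0 <= m -> 0 < r ->
  (forall z, `|z.1| <= r -> `|z.2| <= r -> m <= arc_mean z) ->
  m - (2 * pi + m) * (2 * (C / (L * r))) <= packet_mean (mollify k T) K th t x.
Proof.
move=> m0 r0 H; rewrite packet_mean_mollify.
have Ki := kernel2_integrable kP; have Fi := kernel2_far2_integrable kP r.
have A0 : 0 <= 2 * pi + m by rewrite addr_ge0 // mulr_ge0 // pi_ge0.
have E : m - (2 * pi + m) * (2 * (C / (L * r))) <=
    Rintegral mu2 setT (fun z => m * kernel2 k z - (2 * pi + m) * (kernel2 k z * far2 r z)).
  rewrite (RintegralB measurableT (integrableZl measurableT _ Ki) (integrableZl measurableT _ Fi)).
  rewrite (RintegralZl _ measurableT Ki) (RintegralZl _ measurableT Fi).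
  have -> : Rintegral mu2 setT (kernel2 k) = 1 by rewrite /Rintegral (kernel2_mass kP).
  by rewrite mulr1 lerD2l lerN2; apply: ler_wpM2l => //; exact: kernel2_tail.
apply: le_trans E _; apply: le_Rintegral => //.
- exact: (integrableB measurableT (integrableZl measurableT _ Ki) (integrableZl measurableT _ Fi)).
- exact: arc_mean_integrable.
move=> z _; have K0 := kernel2_ge0 kP z.
have -> : m * kernel2 k z - (2 * pi + m) * (kernel2 k z * far2 r z) = kernel2 k z * (m - (2 * pi + m) * far2 r z) by ring.
apply: ler_wpM2l => //; rewrite /far2.
have := norm_arc_mean z; rewrite ler_norml => /andP[n1 _].
have [h1|h1] := leP `|z.1| r; last first.
  apply: le_trans n1; rewrite lerBlDr.
  have : 0 <= (2 * pi + m) * (r < `|z.2|)%R%:R by rewrite mulr_ge0.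
  by rewrite (_ : true%:R = 1 :> R) //; move: (_%:R) (2 * pi) => b u; lra.
have [h2|h2] := leP `|z.2| r; last by rewrite add0r mulr1; lra.
by rewrite addr0 mulr0 subr0; exact: H.
Qed.

End mollified.

(** With K = kap t the stationary arc has length s = K^(-1/2), comparable with 1/q. It must fit in
    the arc cut out by the tube, and the kernel tail must stay below 1/q; both hold once w q exceeds
    a constant B that depends on C alone. *)
Lemma packet_mean_lower (C : R) : 0 < C -> exists2 c : R, 0 < c & exists2 B : R, 0 < B &
  forall (kap q w th slp t : R) (k l : R -> R) (x : R * R),
  bandlimited_kernel C kap k ->
  - (pi / 2) < th < pi / 2 -> 1 <= slp <= 2 -> sin th = slp * cos th ->
  measurable_fun [set: R] l -> (forall y z, l y - l z = slp * (y - z)) ->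
  0 < w -> w <= 64^-1 -> 0 < q -> q ^+ 2 = kap -> B <= w * q -> 1 <= t <= 2 ->
  0 <= x.1 <= 8^-1 -> `|x.2 - l x.1| <= w / 4 ->
  c / q <= packet_mean (mollify k [set y | (- 3 <= y.1 <= - 8^-1) && (`|y.2 - l y.1| <= w)])
             (kap * t) th t x.
Proof.
move=> C0; have [c c0 low] := integral_chirp_lower R.
exists (c / 2); first lra.
(* The 20 gives 2 s <= w/10, the half-arc guaranteed by [arc_tube]. The other term makes the tail,
   with 2 pi + m <= 8 + 2 c, at most c / (2 q), half of the lower bound c / q for m. *)
pose B := 20 + 64 * ((8 + 2 * c) * C / c).
have Bc : 0 < (8 + 2 * c) * C / c by rewrite divr_gt0 // mulr_gt0 //; lra.
have B0 : 0 < B by rewrite /B; lra.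
exists B => // kap q w th slp t k l x kP th_itv slp_itv th_slope ml lB w0 w1 q0 qk Bwq t12 x1 xl.
have mT := measurable_strip (- 3) (- 8^-1) w ml.
have t0 : 0 < t by move/andP: (t12) => [? ?]; lra.
have rt0 : 0 < Num.sqrt t by rewrite sqrtr_gt0.
have rt2 : Num.sqrt t ^+ 2 = t by rewrite sqr_sqrtr // ltW.
pose s := (q * Num.sqrt t)^-1.
have s0 : 0 < s by rewrite invr_gt0 mulr_gt0.
have rt1 : 1 <= Num.sqrt t.
  by rewrite -sqrtr1 ler_wsqrtr //; case/andP: t12.
have rt3 : Num.sqrt t <= 2.
  have -> : 2 = Num.sqrt (2 ^+ 2) :> R by rewrite sqrtr_sqr ger0_norm.
  by rewrite ler_wsqrtr //; case/andP: t12 => _ h; apply: (le_trans h); rewrite expr2; lra.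
have sq : s <= q^-1 by rewrite lef_pV2 ?posrE ?mulr_gt0 // ler_peMr // ltW.
have sq2 : q^-1 / 2 <= s.
  rewrite -invfM lef_pV2 ?posrE ?mulr_gt0 //.
  by have := ler_wpM2l (ltW q0) rt3; lra.
have Ks : kap * t * s ^+ 2 = 1.
  rewrite -qk /s exprVn exprMn rt2 divff // gt_eqF // mulr_gt0 // exprn_gt0 //.
have B20 : 20 <= w * q by apply: le_trans Bwq; rewrite /B; lra.
have q20 : q^-1 <= w / 20.
  by rewrite -[leLHS]mul1r ler_pdivrMr //; lra.
have sw : 2 * s <= w / 10 by lra.
have s12 : s <= 2^-1 by lra.
have pi4 : pi <= 4 :> R by have := pihalf_lt2 R; lra.
pose m := 2 * (c * s).
have m0 : 0 <= m by rewrite /m !mulr_ge0 // ltW.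
(* A displacement by at most r in each coordinate changes the height over a line of slope at most 2
   by at most 3 r; together with w/4 this remains below the w/2 that [arc_tube] allows. *)
pose r := w / 16.
have r0 : 0 < r by rewrite /r; lra.
have H z : `|z.1| <= r -> `|z.2| <= r ->
   m <= arc_mean [set y | (- 3 <= y.1 <= - 8^-1) && (`|y.2 - l y.1| <= w)] (kap * t) th t x z.
  rewrite !ler_norml => /andP[z1 z1'] /andP[z2 z2'].
  pose u := (x.1 - z.1, x.2 - z.2); pose v := u.2 - l u.1.
  have vE : v = (x.2 - l x.1) - z.2 + slp * z.1.
    by rewrite /v /u /=; have := lB (x.1 - z.1) x.1; lra.
  have vw : `|v| <= w / 2.
    move: xl; rewrite vE ler_norml => /andP[a1 a2]; rewrite ler_norml.
    move/andP: slp_itv => [p1 p2].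
    have b1 : - (2 * r) <= slp * z.1 by nra.
    have b2 : slp * z.1 <= 2 * r by nra.
    by move: b1 b2 z1 z1' z2 z2'; rewrite /r; lra.
  have uv : u.2 = l u.1 + v by rewrite /v; ring.
  have u1 : - 64^-1 <= u.1 <= 8^-1 + 64^-1.
    by rewrite /u /=; move: z1 z1' x1; rewrite /r; lra.
  have [b1 [b2 [hb1 hb2 e1 e2 arc]]] := arc_tube th_itv slp_itv th_slope lB w0 w1 vw t12 uv u1.
  rewrite (@arc_mean_arc _ _ _ _ _ z (th - b1) (th + b2)) //; last by move=> a ha; rewrite /= arc.
  move/andP: hb1 => [hb1 hb1']; move/andP: hb2 => [hb2 hb2'].
  have w10 : 0 <= w / 10 by rewrite divr_ge0 // ltW.
  by apply: integral_chirp_arc; rewrite ?(le_trans w10) //; apply: low; rewrite ?(le_trans sw).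
have := packet_mean_ge kP mT m0 r0 H; apply: le_trans.
have cs : c / 2 * q^-1 <= c * s by have := ler_wpM2l (ltW c0) sq2; lra.
have cq : c * s <= c by rewrite ler_piMr // ?ltW //; lra.
have qB : (8 + 2 * c) * (2 * (C / (kap * r))) <= c / 2 * q^-1.
  have -> : (8 + 2 * c) * (2 * (C / (kap * r))) = 32 * ((8 + 2 * c) * C) / (w * q) * q^-1.
    by rewrite -qk /r; field; rewrite !gt_eqF.
  apply: ler_wpM2r; first by rewrite invr_ge0 ltW.
  rewrite ler_pdivrMr ?mulr_gt0 //.
  have : c / 2 * (64 * ((8 + 2 * c) * C / c)) <= c / 2 * (w * q).
    apply: ler_wpM2l; first lra.
    by apply: le_trans Bwq; rewrite /B; lra.
  apply: le_trans; rewrite le_eqVlt; apply/orP; left; apply/eqP.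
  by field; rewrite gt_eqF.
have CC : 0 <= 2 * (C / (kap * r)).
  by rewrite mulr_ge0 // divr_ge0 ?ltW // mulr_gt0 // -qk exprn_gt0.
have : (2 * pi + m) * (2 * (C / (kap * r))) <= (8 + 2 * c) * (2 * (C / (kap * r))).
  by apply: ler_wpM2r => //; rewrite /m; lra.
by rewrite /m; lra.
Qed.

End packet_lower.

(** * Circular means of packets and their differences in time *)

Section circular_means.
Variables (R : realType).
Local Notation mu := (@lebesgue_measure R).

Lemma integrable_circle (g : R * R -> R) (t : R) (x : R * R) : continuous g ->
  mu.-integrable `[0, 2 * pi] (EFin \o (fun a : R => g (x.1 - t * cos a, x.2 - t * sin a))).
Proof.
move=> cg; apply: continuous_compact_integrable; first exact: segment_compact.
apply: continuous_subspaceT => a.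
have c1 : (fun a : R => x.1 - t * cos a) @ a --> x.1 - t * cos a.
  by apply: cvgB; [exact: cvg_cst|apply: cvgM; [exact: cvg_cst|exact: continuous_cos]].
have c2 : (fun a : R => x.2 - t * sin a) @ a --> x.2 - t * sin a.
  by apply: cvgB; [exact: cvg_cst|apply: cvgM; [exact: cvg_cst|exact: continuous_sin]].
have c12 : (fun a0 : R => (x.1 - t * cos a0, x.2 - t * sin a0)) @ a --> (x.1 - t * cos a, x.2 - t * sin a).
  exact: cvg_pair c1 c2.
exact: (cvg_comp _ _ c12 (cg _)).
Qed.

Lemma measurable_circ_mean (g : R * R -> R) (t : R) : continuous g ->
  measurable_fun [set: R * R] (circ_mean g t).
Proof.
move=> cg; rewrite /circ_mean; apply: measurable_funM => //.
pose K (w : (R * R) * R) : R := \1_[set` `[0, 2 * pi]] w.2 * g (w.1.1 - t * cos w.2, w.1.2 - t * sin w.2).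
have -> : (fun x : R * R => Rintegral mu `[0, 2 * pi] (fun a => g (x.1 - t * cos a, x.2 - t * sin a))) =
    (fun x => Rintegral mu setT (fun a => K (x, a))).
  apply/funext => x; rewrite Rintegral_mkcond; congr (Rintegral _ _ _); apply/funext => a.
  by rewrite patchE /K indicE; case: (_ \in _); rewrite ?mul1r ?mul0r.
apply: measurable_Rintegral_section.
apply: measurable_funM.
  by apply: measurableT_comp; [exact: measurable_indic|exact: measurable_snd].
have mc (trig : R -> R) : continuous trig -> measurable_fun [set: (R * R) * R] (fun w => t * trig w.2).
  move=> ct; apply: measurable_funM => //.
  by apply: measurableT_comp; [exact: continuous_measurable_fun|exact: measurable_snd].
have m1 (f : R * R -> R) : measurable_fun [set: R * R] f -> measurable_fun [set: (R * R) * R] (fun w : (R * R) * R => f w.1).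
  by move=> mf; exact: measurableT_comp mf measurable_fst.
apply: (measurableT_comp (continuous_measurable_fun2 cg)).
apply: measurable_fun_pair; apply: measurable_funB.
- exact: m1 measurable_fst.
- exact: mc (@continuous_cos R).
- exact: m1 measurable_snd.
- exact: mc (@continuous_sin R).
Qed.

Lemma circ_mean_sum (N : nat) (e : nat -> R) (g : nat -> R * R -> R) (t : R) (x : R * R) :
  (forall j, continuous (g j)) ->
  circ_mean (fun y => \sum_(j < N) e j * g j y) t x = \sum_(j < N) e j * circ_mean (g j) t x.
Proof.
move=> cg.
elim: N => [|N IH].
  rewrite big_ord0 /circ_mean; under eq_Rintegral do rewrite big_ord0.
  by rewrite Rintegral_cst // mul0r mulr0.
rewrite big_ord_recr /= -IH /circ_mean; under eq_Rintegral do rewrite big_ord_recr /=.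
have cs : continuous (fun y => \sum_(j < N) e j * g j y).
  move=> y; apply: cvg_big => [|j _]; first exact: add_continuous.
  by apply: cvgM; [exact: cvg_cst|exact: cg].
have i1 := integrable_circle t x cs; have i2 := integrable_circle t x (cg N).
rewrite (RintegralD _ i1 (integrableZl _ (e N) i2)) // (RintegralZl _ _ i2) //.
by rewrite mulrDr mulrCA.
Qed.

Definition packet (chi : R * R -> R) (kap th : R) (trig : R -> R) (x : R * R) : R :=
  2^-1 * chi x * trig (dot2 (kap * cos th, kap * sin th) x).

Section one_packet.
Variables (chi : R * R -> R) (kap th : R).
Hypothesis cchi : continuous chi.

(** P is the phase at x - t (cos th, sin th). The right-hand side is the imaginary part of e^(-iP)
    times the complex mean; 4 pi combines the 2 pi of the mean with the factor 1/2 of the packet. *)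
Lemma circ_mean_packet (t : R) (x : R * R) :
  let P := kap * (cos th * x.1 + sin th * x.2) - kap * t in
  (4 * pi)^-1 * packet_mean chi (kap * t) th t x =
  cos P * circ_mean (packet chi kap th sin) t x - sin P * circ_mean (packet chi kap th cos) t x.
Proof.
move=> P.
have cp (trig : R -> R) : continuous trig -> continuous (packet chi kap th trig).
  move=> ct y; apply: cvgM; last exact: continuous_phase.
  by apply: cvgM; [exact: cvg_cst|exact: cchi].
have ic := integrable_circle t x (cp _ (@continuous_cos R)).
have is' := integrable_circle t x (cp _ (@continuous_sin R)).
have E : Rintegral mu `[0, 2 * pi] (fun a => 2^-1 * (chi (x.1 - t * cos a, x.2 - t * sin a) * chirp (kap * t) (a - th))) =
   Rintegral mu `[0, 2 * pi] (fun a => cos P * packet chi kap th sin (x.1 - t * cos a, x.2 - t * sin a) - sin P * packet chi kap th cos (x.1 - t * cos a, x.2 - t * sin a)).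
  apply: eq_Rintegral => a _; rewrite /packet /chirp.
  have -> : dot2 (kap * cos th, kap * sin th) (x.1 - t * cos a, x.2 - t * sin a) = P + kap * t * (1 - cos (a - th)).
    by rewrite /dot2 /P cosB /=; ring.
  have {1}-> : kap * t * (1 - cos (a - th)) = (P + kap * t * (1 - cos (a - th))) - P by ring.
  by rewrite (sinB (P + _)); ring.
rewrite (RintegralB _ (integrableZl _ _ is') (integrableZl _ _ ic)) // in E.
rewrite (RintegralZl _ _ ic) // (RintegralZl _ _ is') // in E.
have ich : mu.-integrable `[0, 2 * pi]
    (EFin \o (fun a : R => chi (x.1 - t * cos a, x.2 - t * sin a) * chirp (kap * t) (a - th))).
  apply: (le_integrable _ _ _ (integrable_circle t x cchi)) => //.
    apply/measurable_EFinP/measurable_funM.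
      by apply/measurable_EFinP; case/integrableP: (integrable_circle t x cchi).
    apply: measurable_funTS; apply: (measurableT_comp (measurable_chirp _)).
    exact: measurable_funB.
  by move=> a _ /=; rewrite lee_fin normrM -[leRHS]mulr1; apply: ler_wpM2l => //; exact: sin_max.
rewrite (RintegralZl _ _ ich) // in E.
have -> : (4 * pi)^-1 = (2 * pi)^-1 * 2^-1 :> R by rewrite -invfM; congr (_^-1); ring.
by rewrite -mulrA E /circ_mean; ring.
Qed.

(* Over a time step pi / kap the phase P of the packet turns by pi, so the two
   means are added rather than subtracted. *)
Lemma circ_diff2_packet_ge (t : R) (x : R * R) : kap != 0 ->
  ((4 * pi)^-1 * (packet_mean chi (kap * t) th t x + packet_mean chi (kap * (t + pi / kap)) th (t + pi / kap) x)) ^+ 2 <=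
  circ_diff2 (packet chi kap th cos, packet chi kap th sin) (t + pi / kap) t x.
Proof.
move=> k0; set t' := t + pi / kap; have E1 := circ_mean_packet t x; have E2 := circ_mean_packet t' x.
rewrite /= in E1 E2; rewrite mulrDr E1 E2 /circ_diff2 /=.
set P := kap * (_ + _) - kap * t.
have -> : kap * (cos th * x.1 + sin th * x.2) - kap * t' = P - pi.
  by rewrite /P /t'; field.
clearbody P t'; rewrite cosB sinB cospi sinpi.
move: (circ_mean _ t x) (circ_mean _ t' x) (circ_mean _ t x) (circ_mean _ t' x) => a b c d.
have := cos2Dsin2 P; move: (cos P) (sin P) => u v uv.
rewrite -subr_ge0.
(* Lagrange's identity: the projection of (b - a, d - c) on the unit vector (v, - u) does not exceed
   its length. *)
have -> : (b - a) ^+ 2 + (d - c) ^+ 2 - (u * c - v * a + ((u * -1 + v * 0) * d - (v * -1 - u * 0) * b)) ^+ 2 =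
  (1 - (u ^+ 2 + v ^+ 2)) * ((b - a) ^+ 2 + (d - c) ^+ 2) + (u * (b - a) + v * (d - c)) ^+ 2 by ring.
by rewrite uv subrr mul0r add0r sqr_ge0.
Qed.

End one_packet.

End circular_means.

(** * From square mass on a small set to an L^p lower bound *)

Section lower_Lp.
Context d (T : measurableType d) (R : realType) (mu : {measure set T -> \bar R}).

(** Above the level s one has y = y^r y^(1 - r) <= s^(1 - r) y^r, since the exponent 1 - r is not
    positive. Integrated over a set of small measure, this plays the part of Hoelder's
    inequality. *)
Lemma le_level_powR (r s y : R) : 1 <= r -> 0 < s -> 0 <= y ->
  y <= s + s `^ (1 - r) * y `^ r.
Proof.
move=> r1 s0 y0; have [ys|sy] := leP y s.
  by rewrite -[leLHS]addr0; apply: lerD => //; rewrite mulr_ge0 // powR_ge0.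
have yp : 0 < y by exact: lt_trans sy.
apply: le_trans (_ : s `^ (1 - r) * y `^ r <= _); last by rewrite lerDr ltW.
have -> : y `^ r = y * y `^ (r - 1).
  rewrite -[X in X * _](powRr1 y0) -powRD ?subrKC //.
  by rewrite (gt_eqF yp) implybT.
have : s `^ (r - 1) <= y `^ (r - 1).
  by apply: ge0_ler_powR; rewrite ?nnegrE ?subr_ge0 //; exact: ltW.
have -> : s `^ (1 - r) = (s `^ (r - 1))^-1 by rewrite -powRN opprB.
move=> H; rewrite mulrCA -[leLHS]mulr1; apply: ler_wpM2l => //.
by rewrite ler_pdivlMl ?powR_gt0 // mulr1.
Qed.

(* A function of square mass at least c on a set of measure at most nu cannot
   be spread below the level (c / (2 nu))^(1/2). *)
Lemma Lnorm_ge_concentrated (p c nu : R) (E : set T) (G : T -> R) (V : T -> \bar R) :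
  2 <= p -> 0 < c -> 0 < nu -> measurable E -> (mu E <= nu%:E)%E ->
  measurable_fun setT G -> (forall x, 0 <= G x) -> (c%:E <= \int[mu]_(x in E) (G x)%:E)%E ->
  (forall x, ((Num.sqrt (G x))%:E <= V x)%E) ->
  (((c / 2 * (c / (2 * nu)) `^ (p / 2 - 1)) `^ p^-1)%:E <= Lnorm mu p%:E V)%E.
Proof.
move=> p2 c0 nu0 mE Enu mG G0 cG GV.
have p0 : 0 < p by lra.
pose s := c / (2 * nu).
have s0 : 0 < s by rewrite divr_gt0 // mulr_gt0.
pose H x := G x `^ (p / 2).
have H0 x : 0 <= H x by exact: powR_ge0.
have mH : measurable_fun setT H by exact: measurableT_comp (measurable_powR _) mG.
pose J := (\int[mu]_x (H x)%:E)%E.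
have mEH : measurable_fun E (fun x => (H x)%:E) by apply/measurable_EFinP; exact: measurable_funTS.
(* Exponent r = p/2 in [le_level_powR]. The level s is chosen so that s nu = c/2: half of the mass
   is left for the second term. *)
have L1 : (c%:E <= (s * nu)%:E + (s `^ (1 - p / 2))%:E * J)%E.
  apply: (le_trans cG).
  apply: (@le_trans _ _ (\int[mu]_(x in E) (s%:E + (s `^ (1 - p / 2))%:E * (H x)%:E))%E).
    have h0 x : 0 <= s + s `^ (1 - p / 2) * H x by rewrite addr_ge0 ?(ltW s0) // mulr_ge0 // powR_ge0.
    have mh : measurable_fun E (fun x => (s%:E + (s `^ (1 - p / 2))%:E * (H x)%:E)%E).
      by apply: emeasurable_funD; [exact: measurable_cst|exact: measurable_funeM].
    have mGE : measurable_fun E (fun x => (G x)%:E) by apply/measurable_EFinP; exact: measurable_funTS.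
    apply: ge0_le_integral => // x _; rewrite ?lee_fin //.
    by apply: le_level_powR => //; lra.
  have ZH x : (0 <= (s `^ (1 - p / 2))%:E * (H x)%:E)%E by rewrite -EFinM lee_fin mulr_ge0 // powR_ge0.
  have sE (x : T) : E x -> (0 <= s%:E)%E by rewrite lee_fin ltW.
  rewrite ge0_integralD //; last exact: measurable_funeM.
  rewrite integral_cst // ge0_integralZl //; [|by move=> x _; rewrite lee_fin|by rewrite lee_fin powR_ge0].
  apply: leeD; first by rewrite (EFinM s nu); apply: lee_wpmul2l => //; rewrite lee_fin ltW.
  apply: lee_wpmul2l; first by rewrite lee_fin powR_ge0.
  by apply: ge0_subset_integral => //; [exact/measurable_EFinP|move=> x _; rewrite lee_fin].
have L2 : ((c / 2 * s `^ (p / 2 - 1))%:E <= J)%E.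
  have J0 : (0 <= J)%E by apply: integral_ge0 => x _; rewrite lee_fin.
  have q0 : 0 < s `^ (p / 2 - 1) by exact: powR_gt0.
  have : s `^ (1 - p / 2) = (s `^ (p / 2 - 1))^-1 by rewrite -powRN opprB.
  move: (s `^ (p / 2 - 1)) q0 => q q0 qE.
  move: L1 J0; rewrite qE; case: J => [r| |] //; last by move=> _ _; exact: leey.
  rewrite -EFinM -EFinD !lee_fin => L1 r0.
  have snu : s * nu = c / 2 by rewrite /s; field; rewrite gt_eqF.
  have : c / 2 <= q^-1 * r by lra.
  by rewrite ler_pdivlMl // mulrC.
rewrite unlock /Lnorm -poweR_EFin.
have L3 : (J <= \int[mu]_x `|V x| `^ p)%E.
  apply: ge0_le_integral_nomeas => x; first by rewrite lee_fin.
  have -> : (H x)%:E = ((Num.sqrt (G x))%:E `^ p)%E.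
    by rewrite poweR_EFin /H -powR12_sqrt // -powRrM mulrC.
  apply: gt0_ler_poweR; rewrite ?in_itv /= ?leey ?andbT ?lee_fin ?sqrtr_ge0 ?(ltW p0) //.
  by apply: le_trans (GV x) _; exact: lee_abs.
apply: gt0_ler_poweR; rewrite ?in_itv /= ?leey ?andbT ?invr_ge0 ?(ltW p0) //.
- by rewrite lee_fin mulr_ge0 ?powR_ge0 // divr_ge0 // ltW.
- by apply: integral_ge0 => x _; exact: poweR_ge0.
- exact: le_trans L2 L3.
Qed.

End lower_Lp.

(** * Number of lines as a function of lam *)

Lemma exists_scale (R : realType) (B : R) : 0 < B ->
  exists2 lam0 : R, 1 < lam0 & exists2 c : R, 0 < c & forall lam : R, lam0 < lam ->
    exists2 n : nat, (0 < n)%N & 2 ^+ n * B <= Num.sqrt lam /\ c * ln lam <= n%:R.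
Proof.
move=> B0; have l2 : 0 < ln 2 :> R by rewrite ln_gt0 //; lra.
(* Beyond expR A, ln lam / 4 exceeds |ln B| + ln 2; this yields [X1] and [X2]. *)
pose A := 4 * `|ln B| + 4 * ln 2.
have A0 : 0 < A by have := normr_ge0 (ln B); rewrite /A; lra.
exists (expR A); first by rewrite expR_gt1.
(* X is at least ln lam / (4 ln 2), and taking the integer part of a number >= 1 loses at most a
   factor 2. *)
exists (8 * ln 2)^-1; first by rewrite invr_gt0 mulr_gt0.
move=> lam lamA.
have lam0 : 0 < lam by apply: lt_trans lamA; exact: expR_gt0.
have lnA : A < ln lam by rewrite -[ltLHS]expRK ltr_ln ?posrE ?expR_gt0.
(* 2^X = lam^(1/2) / B, so n is the integer part of X. *)
pose X := (ln lam / 2 - ln B) / ln 2.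
have nB := ler_norm (ln B).
have X1 : ln lam / 4 <= X * ln 2.
  by rewrite /X divfK ?gt_eqF //; move: lnA; rewrite /A; lra.
have X2 : 1 <= X.
  rewrite -(ler_pM2r l2) mul1r; apply: le_trans X1; move: lnA; rewrite /A.
  by have := normr_ge0 (ln B); lra.
have [X0] : 0 <= X by lra.
have /andP[tr1 tr2] := truncn_itv X0.
have n1 : (0 < Num.truncn X)%N by rewrite truncn_gt0.
exists (Num.truncn X) => //; split.
  rewrite -ler_ln ?posrE ?mulr_gt0 ?exprn_gt0 ?sqrtr_gt0 //.
  rewrite lnM ?posrE ?exprn_gt0 // lnXn // -powR12_sqrt ?(ltW lam0) // ln_powR.
  have : (Num.truncn X)%:R * ln 2 <= X * ln 2 by apply: ler_wpM2r => //; exact: ltW.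
  by rewrite {2}/X divfK ?gt_eqF // mulr_natl; lra.
have n1R : 1 <= (Num.truncn X)%:R :> R by rewrite ler1n.
rewrite mulrC ler_pdivrMr ?mulr_gt0 //.
have : X * ln 2 <= (2 * (Num.truncn X)%:R) * ln 2.
  by apply: ler_wpM2r; [exact: ltW|move: tr2; rewrite -natr1; lra].
by move: (Num.truncn X)%:R => y; lra.
Qed.

(** * The Kakeya sum of packets *)

Section construction.
Variables (R : realType) (C c B : R).
Local Notation mu := (@lebesgue_measure R).
Local Notation mu2 := (@leb2 R).
Hypotheses (c0 : 0 < c) (B0 : 0 < B).
Hypothesis mean_lower : forall (kap q w th slp t : R) (k l : R -> R) (x : R * R),
  bandlimited_kernel C kap k ->
  - (pi / 2) < th < pi / 2 -> 1 <= slp <= 2 -> sin th = slp * cos th ->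
  measurable_fun [set: R] l -> (forall y z, l y - l z = slp * (y - z)) ->
  0 < w -> w <= 64^-1 -> 0 < q -> q ^+ 2 = kap -> B <= w * q -> 1 <= t <= 2 ->
  0 <= x.1 <= 8^-1 -> `|x.2 - l x.1| <= w / 4 ->
  c / q <= packet_mean (mollify k [set y | (- 3 <= y.1 <= - 8^-1) && (`|y.2 - l y.1| <= w)])
             (kap * t) th t x.

Variables (n : nat) (kap q : R) (k : R -> R).
(** The lines are 2^-n / 8 apart over the tubes, so the half-width 2^-n / 64 keeps the tubes
    disjoint; it also meets the bound w <= 1/64 of [arc_tube]. *)
Let w : R := 64^-1 * 2^-1 ^+ n.
Hypotheses (n0 : (0 < n)%N) (q0 : 0 < q) (qk : q ^+ 2 = kap) (Bwq : B + 1 <= w * q).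
Hypothesis kP : bandlimited_kernel C kap k.

Let th (j : nat) : R := atan (slope R n j).
Let chi (j : nat) : R * R -> R := mollify k (tube n w j).
Let freq (j : nat) : R * R := (kap * cos (th j), kap * sin (th j)).
Let steps : nat := Num.truncn (kap / pi).
Let time (i : nat) : R := 1 + i%:R * (pi / kap).
Let E : set (R * R) := strips n (w / 4).

Let kap0 : 0 < kap. Proof. by rewrite -qk exprn_gt0. Qed.

Let pow0 : 0 < 2^-1 ^+ n :> R. Proof. by rewrite exprn_gt0 // invr_gt0. Qed.

Let pow1 : 2^-1 ^+ n <= 1 :> R.
Proof. by apply: exprn_ile1; rewrite ?invr_ge0 //; lra. Qed.

Let powM : 2 ^+ n * 2^-1 ^+ n = 1 :> R.
Proof. by rewrite -exprMn divff // expr1n. Qed.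

Let w0 : 0 < w. Proof. by rewrite /w mulr_gt0 // invr_gt0. Qed.

Let w1 : w <= 64^-1. Proof. by rewrite /w ler_piMr // invr_ge0. Qed.

(** The [+ 1] in [Bwq] enters here: w q >= 1 gives q >= 64. Thus the time grid has at least one
    step, and the integer part in [steps] costs at most a factor 2. *)
Let kap_pi : pi <= kap.
Proof.
have q64 : 64 <= q.
  have : w * q <= 64^-1 * q by rewrite ler_pM2r.
  by have := Bwq; have := B0; lra.
have : 64 * 1 <= q * q by apply: ler_pM => //; lra.
by rewrite -qk expr2; have := pihalf_lt2 R; lra.
Qed.

Let piR0 : 0 < pi :> R. Proof. exact: pi_gt0. Qed.

Let steps_le : steps%:R * (pi / kap) <= 1.
Proof.
have /andP[h _] : steps%:R <= kap / pi < steps.+1%:R.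
  by apply: truncn_itv; rewrite divr_ge0 ?ltW.
have : steps%:R * (pi / kap) <= kap / pi * (pi / kap) by apply: ler_wpM2r => //; rewrite divr_ge0 ?ltW.
have cancel (u v : R) : 0 < u -> 0 < v -> u / v * (v / u) = 1.
  by move=> u0 v0; field; rewrite !gt_eqF.
by rewrite cancel.
Qed.

Let steps_ge : (2 * pi)^-1 * kap <= steps%:R.
Proof.
have /andP[_ h] : steps%:R <= kap / pi < steps.+1%:R.
  by apply: truncn_itv; rewrite divr_ge0 ?ltW.
have s1 : 1 <= steps%:R :> R by rewrite ler1n truncn_gt0 ler_pdivlMr // mul1r.
rewrite invfM -mulrA (mulrC pi^-1); move: h; rewrite -natr1; move: (kap / pi) => u.
by move: s1; move: (steps%:R) => s s1 h; lra.
Qed.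

Let time_itv i : (i <= steps)%N -> 1 <= time i <= 2.
Proof.
move=> h; have p0 : 0 <= pi / kap by rewrite divr_ge0 ?ltW.
have : i%:R * (pi / kap) <= steps%:R * (pi / kap) by apply: ler_wpM2r => //; rewrite ler_nat.
have : 0 <= i%:R * (pi / kap) by rewrite mulr_ge0.
by have := steps_le; rewrite /time; move: (_ * (pi / kap)) => u; lra.
Qed.

Let timeS i : time i.+1 = time i + pi / kap.
Proof. by rewrite /time -natr1; ring. Qed.

Let th_slope j : sin (th j) = slope R n j * cos (th j).
Proof.
have cp : 0 < cos (th j) by apply: cos_gt0_pihalf; rewrite atan_gtNpi2 atan_ltpi2.
by rewrite -[slope R n j](atanK) /tan divfK // gt_eqF.
Qed.

Let mtube j : measurable (tube n w j).
Proof. by apply: measurable_strip; exact: measurable_line. Qed.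

Let measure_tube j : mu2 (tube n w j) = ((- 8^-1 + 3) * (2 * w))%:E.
Proof.
rewrite /tube measure_strip; [by rewrite opprK|lra|exact: ltW|exact: measurable_line].
Qed.

Let mcore j : measurable (core n (w / 4) j).
Proof. by apply: measurable_strip; exact: measurable_line. Qed.

Let measure_core j : mu2 (core n (w / 4) j) = (8^-1 * (2 * (w / 4)))%:E.
Proof.
have w4 : 0 <= w / 4 by rewrite divr_ge0 // ltW.
by rewrite /core measure_strip; [rewrite subr0|rewrite invr_ge0| |exact: measurable_line].
Qed.

Let chi_cont j : continuous (chi j).
Proof. by apply: (continuous_mollify kP) => //; rewrite measure_tube ltry. Qed.

Let chi_ge0 j x : 0 <= chi j x.
Proof. exact: mollify_ge0 kP _ _. Qed.

Let chi_int j : mu2.-integrable setT (EFin \o chi j).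
Proof. by apply: (mollify_integrable kP) => //; rewrite measure_tube ltry. Qed.

Let tube_disjoint i j : (i < 2 ^ n)%N -> (j < 2 ^ n)%N -> i != j ->
  tube n w i `&` tube n w j = set0.
Proof.
move=> i2 j2 ij; apply/seteqP; split => // x [/andP[/andP[_ x8] xi] /andP[_ xj]].
have := line_sep n0 i2 j2 ij x8.
have : `|line n n i x.1 - line n n j x.1| <= `|x.2 - line n n i x.1| + `|x.2 - line n n j x.1|.
  rewrite -[in leRHS](normrN (x.2 - line n n i _)); apply: le_trans (ler_normD _ _).
  by rewrite le_eqVlt; apply/orP; left; apply/eqP; congr (`| _ |); ring.
move: xi xj pow0; rewrite /w; move: (`|_ - _|) (`|x.2 - _|) (`|x.2 - _|) (2^-1 ^+ n) => u v1 v2 y.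
lra.
Qed.

(** The cutoffs have spectrum in the square of half-side kap, and each packet moves it by a vector
    of length kap. All coordinates thus stay within 2 kap, while |xi| > 4 kap forces one beyond, as
    2 sqrt 2 < 4. *)
Lemma in_E_kakeya (e : nat -> R) : (forall j, `|e j| = 1) ->
  in_E (4 * kap) (packets (2 ^ n) chi e freq cos, packets (2 ^ n) chi e freq sin).
Proof.
move=> e1; apply: in_E_packets => // j xi c' hxi.
under eq_Rintegral do rewrite -mulrBl.
apply: (mollify_spectrum kP (mtube j) _ (a := ((freq j).1 - xi.1, (freq j).2 - xi.2))).
  by rewrite measure_tube ltry.
have big : 2 * kap < `|xi.1| \/ 2 * kap < `|xi.2|.
  have [h1|h1] := ltP (2 * kap) `|xi.1|; first by left.
  have [h2|h2] := ltP (2 * kap) `|xi.2|; first by right.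
  move: hxi; rewrite ltNge => /negP[].
  have k4 : 0 <= 4 * kap by rewrite mulr_ge0 // ltW.
  rewrite -[leRHS](ger0_norm k4) -sqrtr_sqr ler_wsqrtr //.
  have s1 : `|xi.1| ^+ 2 <= (2 * kap) ^+ 2 by rewrite ler_sqr ?nnegrE // mulr_ge0 // ltW.
  have s2 : `|xi.2| ^+ 2 <= (2 * kap) ^+ 2 by rewrite ler_sqr ?nnegrE // mulr_ge0 // ltW.
  have := sqr_ge0 kap; move: s1 s2; rewrite !real_normK ?num_real //.
  by move: (xi.1 ^+ 2) (xi.2 ^+ 2) => u v; lra.
have tri (u v : R) : `|u| <= 1 -> 2 * kap < `|v| -> kap < `|kap * u - v|.
  move=> u1 v2; have : `|v| <= `|kap * u - v| + `|kap * u|.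
    by rewrite -{1}(normrN v); apply: le_trans (ler_normB _ _); rewrite addrAC subrr add0r.
  have : `|kap * u| <= kap * 1 by rewrite normrM (gtr0_norm kap0) ler_pM2l.
  by move: (`|kap * u|) => z; lra.
by case: big => h; [left|right]; apply: tri => //; [exact: cos_max|exact: sin_max].
Qed.

(** The tubes have total area 2^n (23/8) (2 w) = 23/256. *)
Lemma LpN_kakeya (p : R) (e : nat -> R) : 1 <= p -> (forall j, `|e j| = 1) ->
  (LpN p (packets (2 ^ n) chi e freq cos, packets (2 ^ n) chi e freq sin) <= 1)%E.
Proof.
move=> p1 e1; apply: LpN_packets => //.
  exact: (sum_mollify_le1 kP).
under eq_bigr => j _ do rewrite (integral_mollify kP) // measure_tube.
rewrite sumEFin lee_fin sumr_const card_ord -[leLHS]mulr_natl natrX /w.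
have -> : 2 ^+ n * ((- 8^-1 + 3) * (2 * (64^-1 * 2^-1 ^+ n))) = (- 8^-1 + 3) * (2 * 64^-1) * (2 ^+ n * 2^-1 ^+ n) :> R by ring.
by rewrite powM; lra.
Qed.

(** The square of (4 pi)^-1 (c/q + c/q), multiplied by q^2 = kap. *)
Let gain : R := (c / (2 * pi)) ^+ 2.

Let circ_diff2_core j i x : (i < steps)%N -> core n (w / 4) j x ->
  gain / kap <= circ_diff2 (packet (chi j) kap (th j) cos, packet (chi j) kap (th j) sin)
     (time i.+1) (time i) x.
Proof.
move=> is1 /andP[x1 x2].
have th_itv : - (pi / 2) < th j < pi / 2 by rewrite atan_gtNpi2 atan_ltpi2.
have BB : B <= w * q by apply: le_trans Bwq; rewrite lerDl.
have L t : 1 <= t <= 2 -> c / q <= packet_mean (chi j) (kap * t) (th j) t x.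
  move=> t12; apply: (mean_lower kP th_itv (slope_itv R n j) (th_slope j) (@measurable_line R n n j) _ w0 w1 q0 qk BB t12 x1 x2).
  exact: lineB.
have L1 := L _ (time_itv (ltnW is1)); have L2 := L _ (time_itv is1).
rewrite timeS; apply: le_trans (circ_diff2_packet_ge (kap := kap) (th j) (@chi_cont j) (time i) x _); last by rewrite gt_eqF.
rewrite timeS in L2.
have -> : gain / kap = ((4 * pi)^-1 * (c / q + c / q)) ^+ 2.
  have gE (u : R) : 0 < u -> (c / (2 * u)) ^+ 2 / q ^+ 2 = ((4 * u)^-1 * (c / q + c / q)) ^+ 2.
    by move=> u0; field; rewrite !gt_eqF.
  by rewrite /gain -qk gE.
have cq : 0 <= c / q by rewrite divr_ge0 ?ltW.
have p4 : 0 <= (4 * pi)^-1 :> R by rewrite invr_ge0 mulr_ge0 // ltW.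
rewrite ler_sqr ?nnegrE.
- by apply: ler_wpM2l => //; exact: lerD.
- by rewrite mulr_ge0 // addr_ge0.
- by rewrite mulr_ge0 // addr_ge0 // (le_trans cq).
Qed.

Let mean_diff (trig : R -> R) (j i : nat) (x : R * R) : R :=
  circ_mean (packet (chi j) kap (th j) trig) (time i.+1) x -
  circ_mean (packet (chi j) kap (th j) trig) (time i) x.

(** Real and imaginary parts become an index, so that all differences in [circ_diff2] are squares
    over the finite type ['I_steps * bool] on which [exists_signs] acts. *)
Let trig (b : bool) : R -> R := if b then cos else sin.

Let continuous_trig b : continuous (trig b).
Proof. by case: b; [exact: continuous_cos|exact: continuous_sin]. Qed.

Let packet_cont b j : continuous (packet (chi j) kap (th j) (trig b)).
Proof. exact: (@continuous_packet R chi freq chi_cont j _ (@continuous_trig b)). Qed.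

Let sum_squares (g : bool -> nat -> R) :
  \sum_(z : 'I_steps * bool) (g z.2 z.1) ^+ 2 = \sum_(i < steps) ((g true i) ^+ 2 + (g false i) ^+ 2).
Proof.
rewrite -(pair_bigA _ (fun (i : 'I_steps) b => (g b i) ^+ 2)) /=.
by apply: eq_bigr => i _; rewrite big_bool.
Qed.

(** The number of steps is at least kap / (2 pi), each worth gain / kap, and the 2^n cores have
    total area 2^n w / 16 = 1/16 * 1/64. *)
Let total : R := gain / (2 * pi) * (16^-1 * 64^-1).

(** Once the signs are chosen, the packets may be counted separately, each on its own core inside E;
    overlaps of the cores then cost nothing. *)
Lemma exists_kakeya_signs : exists2 e : nat -> R, (forall j, `|e j| = 1) &
  (total%:E <= \int[mu2]_(x in E) (\sum_(i < steps)
     circ_diff2 (packets (2 ^ n) chi e freq cos, packets (2 ^ n) chi e freq sin)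
       (time i.+1) (time i) x)%:E)%E.
Proof.
have mE : measurable E by exact: measurable_strips.
have mh j (z : 'I_steps * bool) : measurable_fun [set: R * R] (mean_diff (trig z.2) j z.1).
  by apply: measurable_funB; exact: measurable_circ_mean (@packet_cont _ _).
have [e [e1 He]] := exists_signs mu2 mE mh (2 ^ n).
exists e => //.
have Epk b t x : circ_mean (packets (2 ^ n) chi e freq (trig b)) t x =
    \sum_(j < 2 ^ n) e j * circ_mean (packet (chi j) kap (th j) (trig b)) t x.
  exact: (circ_mean_sum (2 ^ n) e (g := fun j => packet (chi j) kap (th j) (trig b)) t x (@packet_cont b)).
have R1 x : \sum_(i < steps) circ_diff2 (packets (2 ^ n) chi e freq cos, packets (2 ^ n) chi e freq sin)
       (time i.+1) (time i) x = \sum_(z : 'I_steps * bool) (\sum_(j < 2 ^ n) e j * mean_diff (trig z.2) j z.1 x) ^+ 2.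
  rewrite (sum_squares (fun b i => \sum_(j < 2 ^ n) e j * mean_diff (trig b) j i x)).
  apply: eq_bigr => i _; rewrite /circ_diff2 /= (Epk true) (Epk true) (Epk false) (Epk false).
  by rewrite -!sumrB; congr (_ ^+ 2 + _ ^+ 2); apply: eq_bigr => j _; rewrite mulrBr.
under eq_integral do rewrite R1.
apply: le_trans He.
have one (j : nat) : ((steps%:R * (gain / kap) * (8^-1 * (2 * (w / 4))))%:E <=
    \int[mu2]_(x in E) (\sum_(z : 'I_steps * bool) (mean_diff (trig z.2) j z.1 x) ^+ 2)%:E)%E.
  have m0 : measurable_fun [set: R * R] (fun x => \sum_(z : 'I_steps * bool) (mean_diff (trig z.2) j z.1 x) ^+ 2).
    by apply: measurable_sum => z; exact: measurable_funX (mh _ _).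
  apply: (@le_trans _ _ (\int[mu2]_(x in core n (w / 4) j) (\sum_(z : 'I_steps * bool) (mean_diff (trig z.2) j z.1 x) ^+ 2)%:E)%E); last first.
    apply: ge0_subset_integral => //.
    - exact: mcore.
    - by apply/measurable_EFinP; exact: measurable_funTS.
    - by move=> x _; rewrite lee_fin sumr_ge0 // => z _; exact: sqr_ge0.
    - exact: core_sub_strips.
  have gk : 0 <= gain / kap by rewrite divr_ge0 ?sqr_ge0 ?ltW.
  rewrite EFinM -(measure_core j) -integral_cst; last exact: mcore.
  apply: ge0_le_integral => //.
  - exact: mcore.
  - by move=> x _; rewrite lee_fin mulr_ge0.
  - by apply/measurable_EFinP; exact: measurable_funTS.
  - move=> x xc; rewrite lee_fin (sum_squares (fun b i => mean_diff (trig b) j i x)).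
    rewrite -[leLHS]/(steps%:R * (gain / kap)) mulr_natl -[steps in leLHS]card_ord -sumr_const.
    by apply: ler_sum => i _; exact: circ_diff2_core.
apply: le_trans (lee_sum _ (fun (j : 'I_(2 ^ n)) _ => one j)).
rewrite sumEFin lee_fin sumr_const card_ord -[leRHS]mulr_natl natrX /total.
have -> : 2 ^+ n * (steps%:R * (gain / kap) * (8^-1 * (2 * (w / 4)))) =
   (steps%:R / kap) * gain * (16^-1 * 64^-1) * (2 ^+ n * 2^-1 ^+ n).
  by rewrite /w; field; rewrite gt_eqF.
rewrite powM mulr1 (mulrC gain); apply: ler_wpM2r; first by rewrite mulr_ge0 // invr_ge0.
apply: ler_wpM2r; first exact: sqr_ge0.
by rewrite ler_pdivlMr.
Qed.

Lemma Bp_kakeya (p : R) : 2 <= p ->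
  (((total / 2 * (total / (2 * n%:R^-1)) `^ (p / 2 - 1)) `^ p^-1)%:E <= Bp p (4 * kap))%E.
Proof.
move=> p2; have [e e1 He] := exists_kakeya_signs.
pose f : cfun2 R := (packets (2 ^ n) chi e freq cos, packets (2 ^ n) chi e freq sin).
apply: (@le_trans _ _ (Lnorm mu2 p%:E (V2A f))); last first.
  apply: ereal_sup_ubound; exists f => //; split; first exact: in_E_kakeya.
  by apply: LpN_kakeya => //; lra.
have g0 : 0 < gain by rewrite exprn_gt0 // divr_gt0 // mulr_gt0.
have w4 : 0 <= w / 4 by rewrite divr_ge0 // ltW.
apply: (@Lnorm_ge_concentrated _ _ R mu2 p total n%:R^-1 E
   (fun x => \sum_(i < steps) circ_diff2 f (time i.+1) (time i) x)) => //.
- by rewrite /total mulr_gt0 // divr_gt0 // mulr_gt0.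
- by rewrite invr_gt0 ltr0n.
- exact: measurable_strips.
- apply: measure_strips => //; have := pow0; rewrite /w; move: (2^-1 ^+ n) => y; lra.
- apply: measurable_sum => i; rewrite /circ_diff2 /f /=.
  have cf b : continuous (packets (2 ^ n) chi e freq (trig b)).
    exact: (@continuous_packets R (2 ^ n) chi e freq chi_cont _ (@continuous_trig b)).
  have md b : measurable_fun [set: R * R] (fun x => circ_mean (packets (2 ^ n) chi e freq (trig b)) (time i.+1) x -
      circ_mean (packets (2 ^ n) chi e freq (trig b)) (time i) x).
    by apply: measurable_funB; exact: measurable_circ_mean (cf b).
  by apply: measurable_funD; apply: measurable_funX; [exact: md true|exact: md false].
- by move=> x; apply: sumr_ge0 => i _; rewrite addr_ge0 ?sqr_ge0.
(* [steps] differences need [steps.+1] times, the last of which is still at most 2. *)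
- move=> x; apply: ereal_sup_ubound; exists steps.+1, time; split; last split=> //.
    by move=> i; rewrite ltnS; exact: time_itv.
  by move=> i _; rewrite timeS ltrDl divr_gt0.
Qed.

End construction.

Theorem theorem1p2 (R : realType) (p : R) (hp : 2 < p) :
  exists lam0 c : R, 1 < lam0 /\ 0 < c /\
    forall lam : R, lam0 < lam ->
      ((c * (ln lam) `^ (2^-1 - p^-1))%:E <= Bp p lam)%E.
Proof.
have [C C0 kernels] := exists_bandlimited_kernel R.
have [c c0 [B B0 low]] := packet_mean_lower C0.
(* The 2 comes from q = lam^(1/2) / 2, the 64 from w = 2^-n / 64; with them the scale condition
   becomes w q >= B + 1. *)
have [|lam0 lam01 [c' c'0 scale]] := @exists_scale R (2 * 64 * (B + 1)).
  by rewrite mulr_gt0 //; lra.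
pose total : R := (c / (2 * pi)) ^+ 2 / (2 * pi) * (16^-1 * 64^-1).
have pi0 := pi_gt0 R.
have total0 : 0 < total by rewrite /total mulr_gt0 // divr_gt0 // ?exprn_gt0 ?divr_gt0 // mulr_gt0.
have p0 : 0 < p by lra.
(* Since (p/2 - 1)/p = 1/2 - 1/p, the bound of [Bp_kakeya] equals (total/2)^(1/p) (total n / 2)^(1/2
   - 1/p); then n >= c' ln lam. *)
pose d := (total / 2) `^ p^-1 * (total / 2 * c') `^ (2^-1 - p^-1).
have t20 : 0 < total / 2 by lra.
have d0 : 0 < d by apply: mulr_gt0; apply: powR_gt0 => //; exact: mulr_gt0.
exists lam0, d; split=> //; split=> //.
move=> lam hlam; have [n n0 [n1 n2]] := scale lam hlam.
have lamp : 0 < lam by lra.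
have ln0 : 0 <= ln lam by rewrite ln_ge0 //; lra.
have q0 : 0 < Num.sqrt lam / 2 by rewrite divr_gt0 // sqrtr_gt0.
have qk : (Num.sqrt lam / 2) ^+ 2 = lam / 4.
  by rewrite exprMn sqr_sqrtr ?(ltW lamp) // exprVn; congr (_ * _^-1); ring.
have Bwq : B + 1 <= 64^-1 * 2^-1 ^+ n * (Num.sqrt lam / 2).
  have e0 : 0 <= 2^-1 ^+ n :> R by rewrite exprn_ge0 // invr_ge0.
  have := ler_wpM2l e0 n1.
  have -> : 2^-1 ^+ n * (2 ^+ n * (2 * 64 * (B + 1))) = (2^-1 * 2) ^+ n * (2 * 64 * (B + 1)) by rewrite (mulrA (2^-1 ^+ n)) -exprMn.
  rewrite mulVf // expr1n mul1r; move: (2^-1 ^+ n) (Num.sqrt lam) => u v; lra.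
have [k kP] := kernels (lam / 4) (divr_gt0 lamp (ltr0n R 4)).
have := Bp_kakeya c0 B0 low n0 q0 qk Bwq kP (ltW hp).
rewrite (_ : 4 * (lam / 4) = lam); last by field.
apply: le_trans; rewrite lee_fin -/total /d.
have nR : 0 < n%:R :> R by rewrite ltr0n.
rewrite -mulrA (powRM _ (ltW t20) (powR_ge0 _ _)); apply: ler_wpM2l; first exact: powR_ge0.
have tc0 : 0 <= total / 2 * c' by apply: mulr_ge0; exact: ltW.
rewrite -(powRM _ tc0 ln0) -powRrM.
have -> : (p / 2 - 1) / p = 2^-1 - p^-1 by field; rewrite gt_eqF.
have e0 : 0 <= 2^-1 - p^-1.
  by rewrite subr_ge0 lef_pV2 ?posrE // ltW.
apply: ge0_ler_powR; rewrite ?nnegrE //.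
- exact: mulr_ge0.
- by rewrite divr_ge0 ?(ltW total0) // mulr_ge0 // invr_ge0.
- have -> : total / (2 * n%:R^-1) = total / 2 * n%:R by field; rewrite gt_eqF.
  by rewrite -mulrA; apply: ler_wpM2l => //; rewrite divr_ge0 ?(ltW total0).
Qed.
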